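(* Let $\rho\in L^1(\mathbb{R}^n)$ satisfy $\int_{\mathbb{R}^n}\rho=1$ and let $s>0$. Then the following two properties are equivalent. (a) There exists some $\eta\in\mathcal{S}(\mathbb{R}^n)$ such that $\int\eta\neq0$ and $$\int_0^1\frac 1{\varepsilon^{s+1}}\|\eta-\eta\ast\rho_\varepsilon\|_{L^1}\, d\varepsilon<\infty.$$ (b) $\delta-\rho\in\left(X^s_{\infty,\infty}\right)^\ast$, where $\delta$ is the Dirac mass at the origin; that is, there is a constant $C<\infty$ such that $|(\delta-\rho)(f)|\le C\,[f]_{X^s_{\infty,\infty}}$ for every $f\in X^s_{\infty,\infty}$, where $(\delta-\rho)(f)=f(0)-\int_{\mathbb{R}^n}\rho(x)f(x)\,dx$.
   Context: For a function $g$ on $\mathbb{R}^n$ and $\varepsilon>0$, $g_\varepsilon(x)=\varepsilon^{-n}g(x/\varepsilon)$. $\mathcal{S}(\mathbb{R}^n)$ is the Schwartz class and $\mathcal{S}'(\mathbb{R}^n)$ the space of temperate distributions. Fix $\zeta,\varphi\in\mathcal{S}(\mathbb{R}^n)$ with $\operatorname{supp}\widehat\zeta\subset B(0,2)$, $\widehat\zeta\equiv1$ in a neighborhood of $\overline{B}(0,1)$, and $\varphi:=\zeta_{1/2}-\zeta$, so that $\widehat\varphi=\widehat\zeta(\cdot/2)-\widehat\zeta$ and $\operatorname{supp}\widehat\varphi\subset B(0,4)\setminus\overline{B}(0,1)$. It is assumed moreover that $\varphi$ is even. For $f\in\mathcal{S}'(\mathbb{R}^n)$ such that $\widehat f$ is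 compactly supported in $\mathbb{R}^n\setminus\{0\}$ (such an $f$ is a smooth function), set $f^\sharp_0=f-f\ast\zeta$ and $f^\sharp_j=f\ast\varphi_{2^{-j}}$ for integers $j\le-1$, so that $f=\sum_{j\le0}f^\sharp_j$ (only finitely many terms being nonzero). Define $$[f]_{X^s_{\infty,\infty}}=\sup_{j\le0}2^{sj}\|f^\sharp_j\|_{L^\infty},$$ and let $X^s_{\infty,\infty}$ be the space of temperate distributions $f$ such that $\widehat f$ is compactly supported in $\mathbb{R}^n\setminus\{0\}$ and $[f]_{X^s_{\infty,\infty}}<\infty$, normed by $[\cdot]_{X^s_{\infty,\infty}}$. (Any such $f$ is a bounded smooth function, so $(\delta-\rho)(f)$ is well defined.) *)

(* Defs.v *)
From HB Require Import structures.
From mathcomp Require Import all_boot all_order all_algebra.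
From mathcomp Require Import complex.
From mathcomp Require Import all_classical all_reals all_analysis.

Set Implicit Arguments.
Unset Strict Implicit.
Unset Printing Implicit Defensive.

Import Order.TTheory GRing.Theory Num.Theory.
Import numFieldNormedType.Exports.

Local Open Scope classical_set_scope.
Local Open Scope ring_scope.

Section measurable_rV.
Context {R : realType} {n : nat}.

Let coord (i : 'I_n) (x : 'rV[R]_n) : R := x ord0 i.

Let rV_set0 : g_sigma_preimage coord set0.
Proof. exact: sigma_algebra0. Qed.

Let rV_setC A : g_sigma_preimage coord A -> g_sigma_preimage coord (~` A).
Proof. exact: sigma_algebraC. Qed.

Let rV_bigcup (F : _^nat) : (forall i, g_sigma_preimage coord (F i)) ->
  g_sigma_preimage coord (\bigcup_i (F i)).
Proof. exact: sigma_algebra_bigcup. Qed.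

(* The sigma-algebra generated by the coordinates, i.e. the Borel one. *)
HB.instance Definition _ := @isMeasurable.Build default_measure_display
  'rV[R]_n (g_sigma_preimage coord) rV_set0 rV_setC rV_bigcup.

Lemma measurable_coord (i : 'I_n) :
  measurable_fun setT (fun x : 'rV[R]_n => x ord0 i).
Proof.
move=> _ Y mY; rewrite setTI; apply: sub_sigma_algebra => /=.
rewrite -bigcup_seq/=; exists i => /=; first by rewrite mem_index_enum.
by exists Y => //; rewrite setTI.
Qed.

Lemma measurable_fun_coordP d (T : measurableType d) (f : T -> 'rV[R]_n) :
  (forall i, measurable_fun setT (fun t => f t ord0 i)) -> measurable_fun setT f.
Proof.
move=> mf; have h : g_sigma_preimage (fun i => coord i \o f) `<=` measurable.
  apply: smallest_sub; first exact: sigma_algebra_measurable.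
  apply: (big_ind (fun G : set (set T) => G `<=` measurable)) => //.
    by move=> A B mA mB C [/mA|/mB].
  by move=> i _ A [B mB <-]; exact: mf.
rewrite g_sigma_preimage_comp in h.
by move=> _ A mA; apply: h; exists A.
Qed.

End measurable_rV.

Section lebesgue_rV.
Context {R : realType}.

Definition rV_cons n (p : measurableTypeR R * 'rV[R]_n) : 'rV[R]_n.+1 :=
  \row_i (if unlift ord0 i is Some j then p.2 ord0 j else p.1).

Definition rV_uncons n (x : 'rV[R]_n.+1) : measurableTypeR R * 'rV[R]_n :=
  (x ord0 ord0, \row_j x ord0 (lift ord0 j)).

Lemma rV_consK n : cancel (@rV_cons n) (@rV_uncons n).
Proof.
move=> [a x]; congr pair; first by rewrite mxE unlift_none.
by apply/rowP => j; rewrite !mxE liftK.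
Qed.

Lemma rV_unconsK n : cancel (@rV_uncons n) (@rV_cons n).
Proof.
by move=> x; apply/rowP => i; rewrite mxE; case: unliftP => [j|] ->; rewrite ?mxE.
Qed.

Lemma measurable_rV_cons n : measurable_fun setT (@rV_cons n).
Proof.
apply: measurable_fun_coordP => i.
case: (unliftP ord0 i) => [j|] ->.
  rewrite (_ : (fun _ => _) = (fun x : 'rV[R]_n => x ord0 j) \o snd).
    by apply: measurableT_comp => //; exact: measurable_coord.
  by apply/funext => p /=; rewrite mxE liftK.
rewrite (_ : (fun _ => _) = fst) //.
by apply/funext => p /=; rewrite mxE unlift_none.
Qed.

Lemma measurable_rV_uncons n : measurable_fun setT (@rV_uncons n).
Proof.
apply: measurable_fun_pair; first exact: measurable_coord.
apply: measurable_fun_coordP => i.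
under eq_fun do rewrite mxE.
exact: measurable_coord.
Qed.

Section lebesgue_rV_succ.
Local Open Scope ereal_scope.
Context {n : nat} (mu : {sigma_finite_measure set 'rV[R]_n -> \bar R}).

Definition lebesgue_rV_succ : set 'rV[R]_n.+1 -> \bar R :=
  pushforward (lebesgue_measure \x mu) (@rV_cons n).

Let measurable_preimage_cons A :
  measurable A -> measurable (@rV_cons n @^-1` A).
Proof.
by move=> mA; rewrite -[X in measurable X]setTI; exact: measurable_rV_cons.
Qed.

Let succ0 : lebesgue_rV_succ set0 = 0.
Proof. by rewrite /lebesgue_rV_succ /pushforward preimage_set0 measure0. Qed.

Let succ_ge0 A : 0 <= lebesgue_rV_succ A.
Proof. by rewrite /lebesgue_rV_succ /pushforward measure_ge0. Qed.

Let succ_sigma_additive : semi_sigma_additive lebesgue_rV_succ.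
Proof.
move=> F mF tF mUF; rewrite /lebesgue_rV_succ /pushforward preimage_bigcup.
apply: measure_semi_sigma_additive.
- by move=> k; exact: measurable_preimage_cons.
- apply/trivIsetP => /= i j _ _ ij; rewrite -preimage_setI.
  by move/trivIsetP : tF => /(_ _ _ _ _ ij) ->//; rewrite preimage_set0.
- by rewrite -preimage_bigcup; exact: measurable_preimage_cons.
Qed.

HB.instance Definition _ := isMeasure.Build _ _ _ lebesgue_rV_succ
  succ0 succ_ge0 succ_sigma_additive.

Let succ_sigma_finite : sigma_finite setT lebesgue_rV_succ.
Proof.
have /sigma_finiteP[F1 [TF1 ndF1 F1oo]] :
    sigma_finite setT (@lebesgue_measure R).
  exact: sigma_finiteT.
have /sigma_finiteP[F2 [TF2 ndF2 F2oo]] : sigma_finite setT mu.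
  exact: sigma_finiteT.
pose F k := F1 k `*` F2 k.
have TF : setT = \bigcup_k F k.
  rewrite -setXTT TF1 TF2 predeqE => -[x y]; split.
    move=> [/= [k _ F1x] [l _ F2y]]; exists (maxn k l) => //; split.
    - by move: x F1x; exact/subsetPset/ndF1/leq_maxl.
    - by move: y F2y; exact/subsetPset/ndF2/leq_maxr.
  by move=> [k _ []/= ? ?]; split; exists k.
have Ffin k : measurable (F k) /\ (lebesgue_measure \x mu) (F k) < +oo.
  have [? ?] := F1oo k; have [? ?] := F2oo k.
  split; first exact: measurableX.
  by rewrite product_measure1E// lte_mul_pinfty// ge0_fin_numE.
exists (fun k => @rV_uncons n @^-1` F k).
  by rewrite -preimage_bigcup -TF preimage_setT.
move=> k; have [mF Foo] := Ffin k; split.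
  by rewrite -[X in measurable X]setTI; exact: measurable_rV_uncons.
rewrite /lebesgue_rV_succ /pushforward -comp_preimage.
rewrite (_ : _ \o _ = id) ?preimage_id//.
by apply/funext => p /=; rewrite rV_consK.
Qed.

HB.instance Definition _ :=
  Measure_isSigmaFinite.Build _ _ _ lebesgue_rV_succ succ_sigma_finite.

End lebesgue_rV_succ.

Fixpoint lebesgue_rV (n : nat) : {sigma_finite_measure set 'rV[R]_n -> \bar R} :=
  match n with
  | 0%N => [the {sigma_finite_measure set 'rV[R]_0 -> \bar R}
              of dirac (0 : 'rV[R]_0)]
  | m.+1 => [the {sigma_finite_measure set 'rV[R]_m.+1 -> \bar R}
              of lebesgue_rV_succ (lebesgue_rV m)]
  end.

Let box n (a b : 'rV[R]_n) : set 'rV[R]_n :=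
  [set x | forall i, x ord0 i \in `]a ord0 i, b ord0 i]].

Let measurable_box n (a b : 'rV[R]_n) : measurable (box a b).
Proof.
rewrite (_ : box a b = \bigcap_(i in [set: 'I_n])
    (fun x : 'rV[R]_n => x ord0 i) @^-1` `]a ord0 i, b ord0 i]%classic).
  apply: fin_bigcap_measurable => // i _.
  by rewrite -[X in measurable X]setTI; exact: measurable_coord.
by apply/seteqP; split => x /= h i; [move=> _|]; exact: h.
Qed.

Lemma lebesgue_rV_box n (a b : 'rV[R]_n) :
  (forall i, a ord0 i <= b ord0 i) ->
  lebesgue_rV n [set x | forall i, x ord0 i \in `]a ord0 i, b ord0 i]] =
  (\prod_i (b ord0 i - a ord0 i))%:E.
Proof.
rewrite -/(box a b); elim: n a b => [|n IH] a b ab.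
  by rewrite big_ord0 /= diracE mem_set// => -[].
pose a' := (rV_uncons a).2; pose b' := (rV_uncons b).2.
rewrite /= /lebesgue_rV_succ /pushforward.
rewrite (_ : _ @^-1` _ = `]a ord0 ord0, b ord0 ord0]%classic `*` box a' b').
  rewrite product_measure1E//; last exact: measurable_box.
  rewrite IH => [|i]; last by rewrite !mxE.
  have mI : lebesgue_measure `]a ord0 ord0, b ord0 ord0]%classic =
      (b ord0 ord0 - a ord0 ord0)%:E.
    rewrite lebesgue_measure_itv/= lte_fin.
    have := ab ord0; rewrite le_eqVlt => /predU1P[->|->]//.
    by rewrite ltxx subrr.
  rewrite [X in (X * _)%E]mI big_ord_recl EFinM.
  under eq_bigr do rewrite !mxE.
  by [].
apply/seteqP; split => [[t x]|[t x] [/= ht hx] i].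
  move=> /= h; split => /=.
    by have := h ord0; rewrite mxE unlift_none.
  by move=> i; have := h (lift ord0 i); rewrite !mxE liftK.
rewrite mxE; case: (unliftP ord0 i) => [j|] -> //=.
by have := hx j; rewrite !mxE.
Qed.

End lebesgue_rV.

Section complex_functions.
Local Open Scope complex_scope.
Context {R : realType} {n : nat}.
Implicit Types (f g : 'rV[R]_n -> R[i]) (x xi : 'rV[R]_n).

Definition normc (z : R[i]) : R := ComplexField.Normc.normc z.

Definition expi (t : R) : R[i] := cos t +i* sin t.

(* The norm of the library on ['rV[R]_n] is the sup norm. *)
Definition dotp x xi : R := \sum_(i < n) x ord0 i * xi ord0 i.
Definition enorm x : R := Num.sqrt (dotp x x).

Definition cintegrable f : Prop :=
  (lebesgue_rV n).-integrable setT (fun x => (complex.Re (f x))%:E) /\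
  (lebesgue_rV n).-integrable setT (fun x => (complex.Im (f x))%:E).

Definition cint f : R[i] :=
  (\int[lebesgue_rV n]_x complex.Re (f x)) +i*
  (\int[lebesgue_rV n]_x complex.Im (f x)).

Definition cLnorm (p : \bar R) f : \bar R :=
  Lnorm (lebesgue_rV n) p (fun x => (normc (f x))%:E).

Definition convolution f g : 'rV[R]_n -> R[i] :=
  fun x => cint (fun y => f (x - y) * g y).

Definition dilate (e : R) f : 'rV[R]_n -> R[i] :=
  fun x => (e ^- n)%:C * f (e^-1 *: x).

(* Normalization without 2 pi: the integral of f(x) exp(- i x . xi). *)
Definition fourier f : 'rV[R]_n -> R[i] :=
  fun xi => cint (fun x => f x * expi (- dotp x xi)).

Definition supp f : set 'rV[R]_n := closure [set x | f x != 0].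

Definition ccontinuous f : Prop :=
  continuous (fun x => complex.Re (f x)) /\
  continuous (fun x => complex.Im (f x)).

Definition cderivable f x (v : 'rV[R]_n) : Prop :=
  derivable (fun y => complex.Re (f y)) x v /\
  derivable (fun y => complex.Im (f y)) x v.

Definition pderiv (i : 'I_n) f : 'rV[R]_n -> R[i] := fun x =>
  ('D_(delta_mx ord0 i) (fun y => complex.Re (f y)) x) +i*
  ('D_(delta_mx ord0 i) (fun y => complex.Im (f y)) x).

(* Iterated partial derivative along a list of directions. *)
Definition pderivs (l : seq 'I_n) f : 'rV[R]_n -> R[i] := foldr pderiv f l.

Definition smooth f : Prop := forall l,
  ccontinuous (pderivs l f) /\
  forall i x, cderivable (pderivs l f) x (delta_mx ord0 i).

Definition schwartz f : Prop := smooth f /\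
  forall (k : nat) (l : seq 'I_n), exists M : R,
    forall x, enorm x ^+ k * normc (pderivs l f x) <= M.

(* These seminorms increase with [N] and generate the Schwartz topology. *)
Definition schwartz_seminorm (N : nat) f : R :=
  sup [set r | exists k l x, [/\ (k <= N)%N, (size l <= N)%N &
                 r = enorm x ^+ k * normc (pderivs l f x)]].

End complex_functions.

Section distributions.
Context {R : realType} {n : nat}.

(* Only the values on Schwartz functions are meaningful. *)
Definition functional : Type := ('rV[R]_n -> R[i]) -> R[i].

Implicit Types (T : functional) (f psi chi : 'rV[R]_n -> R[i]).

Definition temperate T : Prop :=
  (forall (a : R[i]) psi chi, schwartz psi -> schwartz chi ->
     T (fun x => a * psi x + chi x) = a * T psi + T chi) /\
  (forall psi, schwartz psi -> forall e : R, 0 < e ->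
     exists (N : nat) (d : R), 0 < d /\
       forall chi, schwartz chi ->
         schwartz_seminorm N (fun x => chi x - psi x) < d ->
         normc (T chi - T psi) < e).

Definition dfourier T : functional := fun psi => T (fourier psi).

(* A compactly supported smooth function is the same thing as a compactly
   supported Schwartz function. *)
Definition vanishes_on T (U : set 'rV[R]_n) : Prop :=
  forall psi, schwartz psi -> compact (supp psi) -> supp psi `<=` U ->
    T psi = 0.

Definition dsupp T : set 'rV[R]_n :=
  [set x | ~ exists U, [/\ open U, U x & vanishes_on T U]].

(* [f] is the function with which [T] is identified; being continuous, it is
   determined everywhere by [T], so that [f 0] makes sense. *)
Definition represents T f : Prop := ccontinuous f /\
  forall psi, schwartz psi ->
    cintegrable (fun x => f x * psi x) /\ T psi = cint (fun x => f x * psi x).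

End distributions.
Arguments functional : clear implicits.

Section X_space.
Local Open Scope ereal_scope.
Context {R : realType} {n : nat}.
Variables (s : R) (zeta phi : 'rV[R]_n -> R[i]).
Implicit Types f : 'rV[R]_n -> R[i].

(* Meant for [j <= 0] only. *)
Definition sharp f (j : int) : 'rV[R]_n -> R[i] :=
  if j == 0%R then fun x => (f x - convolution f zeta x)%R
  else convolution f (dilate (2 ^ (- j))%R phi).

Definition X_norm f : \bar R :=
  ereal_sup [set (2 `^ (s * j%:~R))%:E * cLnorm +oo (sharp f j)
            | j in [set j : int | (j <= 0)%R]].

Definition in_X (T : functional R n) f : Prop :=
  [/\ temperate T, compact (dsupp (dfourier T)), ~ dsupp (dfourier T) 0%R,
      represents T f & X_norm f < +oo].

End X_space.

Definition delta_minus {R : realType} {n : nat} (rho f : 'rV[R]_n -> R[i]) :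
  R[i] := f 0 - cint (fun x => rho x * f x).

(* Main.v *)
Require Import Defs.
From HB Require Import structures.
From mathcomp Require Import all_boot all_order all_algebra.
From mathcomp Require Import complex ring lra zify.
From mathcomp Require Import all_classical all_reals all_analysis.
From mathcomp Require Import measurable_realfun ess_sup_inf.

Set Implicit Arguments.
Unset Strict Implicit.
Unset Printing Implicit Defensive.

Import Order.TTheory GRing.Theory Num.Theory.
Import numFieldNormedType.Exports.

Local Open Scope classical_set_scope.
Local Open Scope ring_scope.

(* Write N(g) for the L^1 norm of g - g * rho and zeta_t for the dilate of zeta,
   whose frequencies are at most 2/t.  Both properties say that the sum over k
   of 2^(sk) N(zeta_(2^k)) is finite.

   Since zeta_t * zeta_u = zeta_t when 2u <= t, N(zeta_t) is almost decreasing
   in t, so for eta = zeta the integral in (a) is comparable to this sum, with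
   t = 1/e.  A general eta is reduced to zeta by N(zeta_(2^m t)) <= C N(eta_t):
   as zeta - zeta * eta_e is small for small e, the convolution with eta can be
   inverted on low frequencies.

   If f is in X then f is a finite sum of blocks f_k with f_k = f_k * zeta_u for
   u = 2^k / 4, and zeta is even, so (delta - rho)(f_k) is at most the sup norm
   of f_k times N(zeta_u).  Conversely, (b) applied to the sum of the functions
   2^(sk) phi_(2^k) * g_k, where g_k is the conjugate of the sign of
   phi_(2^k) - phi_(2^k) * rho, bounds the sum of 2^(sk) N(phi_(2^k)): these
   functions have bounded norm in X because phi_(2^k) * phi_(2^l) = 0 for
   |k - l| > 1.  As N(zeta_(2^k)) tends to 0, it is recovered by telescoping. *)

(** * Integrals of complex functions *)

(** Three obstacles shape the development. An element [f] of X is given only as a continuous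
    function integrable against Schwartz functions, and its norm is an essential supremum, so
    neither a bound on [f] nor pointwise bounds on its blocks are at hand. The spectral gap of [f]
    at 0 makes the decomposition finite; almost everywhere bounds on the blocks then bound [f],
    which makes the blocks continuous and their bounds valid everywhere. Next, frequency arguments
    become convolution identities, proved by injectivity of the Fourier transform on continuous,
    bounded, integrable functions; inversion up to a nonzero constant suffices for this, hence the
    elementary Fejer kernel. Where a transform has to be a Schwartz function, its support is bounded
    and decay is automatic. Finally, the g_k may be discontinuous; convolutions with them are
    continuous because translations are continuous in L^1 on the other factor. The two directions
    meet in [delta_minus_conv]: for even p, (delta - rho)(p * g) is the pairing of g with p - p *
    rho, whose supremum over |g| <= 1 is N(p). *)

Section normc_theory.
Local Open Scope complex_scope.
Context {R : realType}.
Implicit Types (x y z : R[i]) (a b : R).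

Lemma normcE z : `|z| = (normc z)%:C. Proof. by []. Qed.

Lemma normc_ge0 z : 0 <= normc z.
Proof. by rewrite -lecR -normcE normr_ge0. Qed.

Lemma normc0 : normc 0 = 0 :> R. Proof. exact: ComplexField.Normc.normc0. Qed.

Lemma normc_eq0 z : (normc z == 0) = (z == 0).
Proof.
apply/eqP/eqP => [|->]; last exact: normc0.
exact: ComplexField.Normc.eq0_normc.
Qed.

Lemma normcM x y : normc (x * y) = normc x * normc y.
Proof. exact: ComplexField.Normc.normcM. Qed.

Lemma normcN z : normc (- z) = normc z.
Proof. by apply: complexI; rewrite -!normcE normrN. Qed.

Lemma normcBC x y : normc (x - y) = normc (y - x).
Proof. by rewrite -normcN opprB. Qed.

Lemma ler_normcD x y : normc (x + y) <= normc x + normc y.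
Proof. by rewrite -lecR rmorphD /= -!normcE ler_normD. Qed.

Lemma ler_normcB x y : normc (x - y) <= normc x + normc y.
Proof. by rewrite -(normcN y) ler_normcD. Qed.

Lemma ler_normc_sum I (r : seq I) (P : pred I) (F : I -> R[i]) :
  normc (\sum_(i <- r | P i) F i) <= \sum_(i <- r | P i) normc (F i).
Proof.
elim/big_rec2 : _ => [|i a z _ za]; first by rewrite normc0.
by rewrite (le_trans (ler_normcD _ _))// lerD2l.
Qed.

Lemma normcR a : normc a%:C = `|a|.
Proof. by rewrite /normc/= expr0n/= addr0 sqrtr_sqr. Qed.

Lemma ReD x y : complex.Re (x + y) = complex.Re x + complex.Re y.
Proof. by case: x y => [? ?] []. Qed.

Lemma ImD x y : complex.Im (x + y) = complex.Im x + complex.Im y.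
Proof. by case: x y => [? ?] []. Qed.

Lemma ReN x : complex.Re (- x) = - complex.Re x. Proof. by case: x. Qed.

Lemma ImN x : complex.Im (- x) = - complex.Im x. Proof. by case: x. Qed.

Lemma ReM x y : complex.Re (x * y) =
  complex.Re x * complex.Re y - complex.Im x * complex.Im y.
Proof. by case: x y => [? ?] []. Qed.

Lemma ImM x y : complex.Im (x * y) =
  complex.Re x * complex.Im y + complex.Im x * complex.Re y.
Proof. by case: x y => [? ?] []. Qed.

Lemma complex_eqP x y :
  complex.Re x = complex.Re y -> complex.Im x = complex.Im y -> x = y.
Proof. by case: x y => [? ?] [? ?] /= -> ->. Qed.

Lemma sqr_normc z :
  normc z ^+ 2 = complex.Re z ^+ 2 + complex.Im z ^+ 2.
Proof. by case: z => a b; rewrite sqr_sqrtr// addr_ge0 ?sqr_ge0. Qed.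

Lemma Re_le_normc z : `|complex.Re z| <= normc z.
Proof.
case: z => a b; rewrite -sqrtr_sqr ler_wsqrtr//= lerDl sqr_ge0//.
Qed.

Lemma Im_le_normc z : `|complex.Im z| <= normc z.
Proof.
case: z => a b; rewrite -sqrtr_sqr ler_wsqrtr//= lerDr sqr_ge0//.
Qed.

Lemma normc_le_ReIm z : normc z <= `|complex.Re z| + `|complex.Im z|.
Proof.
case: z => a b; have -> : a +i* b = a%:C + (0 +i* b) by simpc.
rewrite (le_trans (ler_normcD _ _))// normcR.
by rewrite [normc (0 +i* b)]/normc/= expr0n/= !add0r addr0 sqrtr_sqr.
Qed.

Lemma normc_expi a : normc (expi a) = 1.
Proof. by rewrite /normc /expi/= cos2Dsin2 sqrtr1. Qed.

Lemma expiD a b : expi (a + b) = expi a * expi b.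
Proof. by rewrite /expi cosD sinD; simpc; congr (_ +i* _); rewrite addrC. Qed.

Lemma expi0 : expi (0 : R) = 1.
Proof. by rewrite /expi cos0 sin0. Qed.

Lemma normc_conj z : normc (z^*) = normc z.
Proof. by case: z => a b; rewrite /normc/= sqrrN. Qed.

Lemma mul_conjc z : z * z^* = (normc z ^+ 2)%:C.
Proof.
rewrite sqr_normc; case: z => a b; apply: complex_eqP.
  by rewrite ReM/=; ring.
by rewrite ImM/=; ring.
Qed.

End normc_theory.

Section Cmeasurable.
Context {R : realType} d {T : measurableType d}.
Implicit Types f g : T -> R[i].

Definition Cmeasurable f := measurable_fun setT (fun x => complex.Re (f x)) /\
  measurable_fun setT (fun x => complex.Im (f x)).

Lemma Cmeasurable_cst (c : R[i]) : Cmeasurable (fun=> c).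
Proof. by split; exact: measurable_cst. Qed.

Lemma CmeasurableD f g : Cmeasurable f -> Cmeasurable g ->
  Cmeasurable (fun x => f x + g x).
Proof.
move=> [f1 f2] [g1 g2]; split.
- by under eq_fun do rewrite ReD; exact: measurable_funD.
- by under eq_fun do rewrite ImD; exact: measurable_funD.
Qed.

Lemma CmeasurableN f : Cmeasurable f -> Cmeasurable (fun x => - f x).
Proof.
move=> [f1 f2]; split.
- by under eq_fun do rewrite ReN; exact: measurable_funN.
- by under eq_fun do rewrite ImN; exact: measurable_funN.
Qed.

Lemma CmeasurableB f g : Cmeasurable f -> Cmeasurable g ->
  Cmeasurable (fun x => f x - g x).
Proof. by move=> mf mg; exact/CmeasurableD/CmeasurableN. Qed.

Lemma CmeasurableM f g : Cmeasurable f -> Cmeasurable g ->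
  Cmeasurable (fun x => f x * g x).
Proof.
move=> [f1 f2] [g1 g2]; split.
- under eq_fun do rewrite ReM.
  by apply: measurable_funB; exact: measurable_funM.
- under eq_fun do rewrite ImM.
  by apply: measurable_funD; exact: measurable_funM.
Qed.

Lemma measurable_normc f : Cmeasurable f ->
  measurable_fun setT (fun x => normc (f x)).
Proof.
move=> [f1 f2].
rewrite (_ : (fun _ => _) = Num.sqrt \o
  (fun x => complex.Re (f x) ^+ 2 + complex.Im (f x) ^+ 2)); last first.
  by apply/funext => x /=; case: (f x).
apply: measurableT_comp.
  exact: continuous_measurable_fun (@sqrt_continuous R).
by apply: measurable_funD; exact: measurable_funX.
Qed.

End Cmeasurable.

Lemma Cmeasurable_comp {R : realType} d d' {T : measurableType d}
    {T' : measurableType d'} (f : T' -> R[i]) (g : T -> T') :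
  Cmeasurable f -> measurable_fun setT g -> Cmeasurable (fun x => f (g x)).
Proof.
move=> [f1 f2] mg; split.
- exact: (measurableT_comp f1 mg).
- exact: (measurableT_comp f2 mg).
Qed.

Section Rintegral_extra.
Context {R : realType} d {T : measurableType d}.
Variable mu : {measure set T -> \bar R}.

Lemma dominated_cvg_Rintegral0 (h : nat -> T -> R) (g : T -> R) :
  (forall n, measurable_fun setT (h n)) ->
  mu.-integrable setT (EFin \o g) ->
  (forall n x, `|h n x| <= g x) ->
  (forall x, h n x @[n --> \oo] --> 0) ->
  \int[mu]_x h n x @[n --> \oo] --> (0 : R).
Proof.
move=> mh ig hg h0.
have := @dominated_convergence _ _ _ mu setT measurableT
  (fun n x => (h n x)%:E) (cst 0%E) (EFin \o g).
rewrite integral0 => -[] //.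
- by move=> n; exact/measurable_EFinP.
- by apply: aeW => x _; apply: cvg_EFin; [exact: nearW|exact: h0].
- by apply: aeW => x n _; rewrite lee_fin.
by move=> _ _; exact: fine_cvg.
Qed.

Lemma le_integrableR (f g : T -> R) : measurable_fun setT f ->
  mu.-integrable setT (EFin \o g) -> (forall x, `|f x| <= g x) ->
  mu.-integrable setT (EFin \o f).
Proof.
move=> mf ig fg; apply: (le_integrable measurableT _ _ ig).
- exact/measurable_EFinP.
- by move=> x _ /=; rewrite lee_fin (le_trans (fg x))// ler_norm.
Qed.

Lemma integrableDR (f g : T -> R) : mu.-integrable setT (EFin \o f) ->
  mu.-integrable setT (EFin \o g) ->
  mu.-integrable setT (EFin \o (fun x => f x + g x)).
Proof.
move=> fi gi; rewrite (_ : _ \o _ = (EFin \o f) \+ (EFin \o g))%E//.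
exact: integrableD.
Qed.

Lemma integrableZR (c : R) (f : T -> R) : mu.-integrable setT (EFin \o f) ->
  mu.-integrable setT (EFin \o (fun x => c * f x)).
Proof.
move=> fi; rewrite (_ : _ \o _ = fun x => (c%:E * (EFin \o f) x)%E)//.
exact: integrableZl.
Qed.

Lemma integrableNR (f : T -> R) : mu.-integrable setT (EFin \o f) ->
  mu.-integrable setT (EFin \o (fun x => - f x)).
Proof. by move=> /(integrableZR (-1)); under eq_fun do rewrite mulN1r. Qed.

Lemma EFin_Rintegral (f : T -> R) : mu.-integrable setT (EFin \o f) ->
  (\int[mu]_x f x)%:E = (\int[mu]_x (f x)%:E)%E.
Proof. by move=> fi; rewrite fineK//; exact: integrable_fin_num. Qed.

End Rintegral_extra.

Section Cintegral.
Local Open Scope complex_scope.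
Context {R : realType} d {T : measurableType d}.
Variable mu : {measure set T -> \bar R}.
Implicit Types f g : T -> R[i].

Definition Cintegrable f :=
  mu.-integrable setT (fun x => (complex.Re (f x))%:E) /\
  mu.-integrable setT (fun x => (complex.Im (f x))%:E).

Definition Cint f : R[i] :=
  (\int[mu]_x complex.Re (f x)) +i* (\int[mu]_x complex.Im (f x)).

Lemma Cintegrable_meas f : Cintegrable f -> Cmeasurable f.
Proof.
by move=> [f1 f2]; split; apply/measurable_EFinP;
  [exact: measurable_int f1|exact: measurable_int f2].
Qed.

Lemma le_Cintegrable f (g : T -> R) : Cmeasurable f ->
  mu.-integrable setT (EFin \o g) -> (forall x, normc (f x) <= g x) ->
  Cintegrable f.
Proof.
move=> [f1 f2] ig fg; split.
- apply: (le_integrableR f1 ig) => x.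
  exact: le_trans (Re_le_normc _) (fg x).
- apply: (le_integrableR f2 ig) => x.
  exact: le_trans (Im_le_normc _) (fg x).
Qed.

Lemma integrable_normc f : Cintegrable f ->
  mu.-integrable setT (EFin \o (fun x => normc (f x))).
Proof.
move=> If; have [f1 f2] := If.
have ig : mu.-integrable setT
    (EFin \o (fun x => `|complex.Re (f x)| + `|complex.Im (f x)|)).
  by apply: integrableDR; exact: (integrable_norm (mu := mu)).
apply: le_integrableR ig _.
  exact/measurable_normc/Cintegrable_meas.
by move=> x; rewrite ger0_norm ?normc_ge0// normc_le_ReIm.
Qed.

Lemma CintegrableP f : Cmeasurable f ->
  mu.-integrable setT (EFin \o (fun x => normc (f x))) -> Cintegrable f.
Proof. by move=> mf ig; exact: (le_Cintegrable mf ig). Qed.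

Lemma CintegrableD f g : Cintegrable f -> Cintegrable g ->
  Cintegrable (fun x => f x + g x).
Proof.
move=> [f1 f2] [g1 g2]; split.
- under eq_fun do rewrite ReD; exact: integrableDR.
- under eq_fun do rewrite ImD; exact: integrableDR.
Qed.

Lemma CintegrableN f : Cintegrable f -> Cintegrable (fun x => - f x).
Proof.
move=> [f1 f2]; split.
- under eq_fun do rewrite ReN; exact: integrableNR.
- under eq_fun do rewrite ImN; exact: integrableNR.
Qed.

Lemma CintegrableB f g : Cintegrable f -> Cintegrable g ->
  Cintegrable (fun x => f x - g x).
Proof. by move=> fi gi; exact/CintegrableD/CintegrableN. Qed.

Lemma CintegrableMl (M : R) f g : Cmeasurable f ->
  (forall x, normc (f x) <= M) -> Cintegrable g ->
  Cintegrable (fun x => f x * g x).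
Proof.
move=> mf fM gi.
apply: (le_Cintegrable _ (integrableZR M (integrable_normc gi))).
  exact/CmeasurableM/Cintegrable_meas.
by move=> x; rewrite normcM ler_wpM2r// normc_ge0.
Qed.

Lemma CintegrableMr (M : R) f g : Cintegrable f -> Cmeasurable g ->
  (forall x, normc (g x) <= M) -> Cintegrable (fun x => f x * g x).
Proof.
move=> fi mg gM; under eq_fun do rewrite mulrC.
exact: CintegrableMl gM fi.
Qed.

Lemma CintegrableZ (c : R[i]) f : Cintegrable f ->
  Cintegrable (fun x => c * f x).
Proof. by apply: (@CintegrableMl (normc c)) => //; exact: Cmeasurable_cst. Qed.

Lemma Cintegrable_sum I (s : seq I) (F : I -> T -> R[i]) :
  (forall i, Cintegrable (F i)) -> Cintegrable (fun x => \sum_(i <- s) F i x).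
Proof.
move=> iF; elim: s => [|i s IH].
  under eq_fun do rewrite big_nil.
  by split => /=; exact: integrable0.
by under eq_fun do rewrite big_cons; exact: CintegrableD.
Qed.

Lemma eq_Cint f g : f =1 g -> Cint f = Cint g.
Proof. by move=> /funext ->. Qed.

Lemma CintD f g : Cintegrable f -> Cintegrable g ->
  Cint (fun x => f x + g x) = Cint f + Cint g.
Proof.
move=> [f1 f2] [g1 g2]; rewrite /Cint; simpc; congr (_ +i* _).
- by under eq_Rintegral do rewrite ReD; rewrite RintegralD.
- by under eq_Rintegral do rewrite ImD; rewrite RintegralD.
Qed.

Lemma CintZ (c : R[i]) f : Cintegrable f ->
  Cint (fun x => c * f x) = c * Cint f.
Proof.
move=> [f1 f2]; rewrite /Cint; case: c => a b; simpc.
have I1 k := integrableZR k f1; have I2 k := integrableZR k f2.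
congr (_ +i* _).
- under eq_Rintegral do rewrite ReM/=.
  by rewrite RintegralB// ?RintegralZl.
- under eq_Rintegral do rewrite ImM/=.
  by rewrite RintegralD// ?RintegralZl.
Qed.

Lemma CintZr (c : R[i]) f : Cintegrable f ->
  Cint (fun x => f x * c) = Cint f * c.
Proof. by move=> fi; under eq_Cint do rewrite mulrC; rewrite CintZ// mulrC. Qed.

Lemma CintN f : Cintegrable f -> Cint (fun x => - f x) = - Cint f.
Proof.
move=> fi; rewrite -[RHS]mulN1r -CintZ//.
by apply: eq_Cint => x; rewrite mulN1r.
Qed.

Lemma CintB f g : Cintegrable f -> Cintegrable g ->
  Cint (fun x => f x - g x) = Cint f - Cint g.
Proof. by move=> fi gi; rewrite CintD ?CintN//; exact: CintegrableN. Qed.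

Lemma Cint_sum I (s : seq I) (F : I -> T -> R[i]) :
  (forall i, Cintegrable (F i)) ->
  Cint (fun x => \sum_(i <- s) F i x) = \sum_(i <- s) Cint (F i).
Proof.
move=> iF; elim: s => [|i s IH].
  under eq_Cint do rewrite big_nil.
  by rewrite big_nil /Cint/= /Rintegral integral0.
under eq_Cint do rewrite big_cons.
by rewrite big_cons CintD ?IH//; exact: Cintegrable_sum.
Qed.

Lemma CintR (f : T -> R) : Cint (fun x => (f x)%:C) = (\int[mu]_x f x)%:C.
Proof. by rewrite /Cint/= /Rintegral integral0. Qed.

Lemma CintegrableR (f : T -> R) : mu.-integrable setT (EFin \o f) ->
  Cintegrable (fun x => (f x)%:C).
Proof. by move=> fi; split => //=; exact: integrable0. Qed.

(** Rotation reduces this to the real case: if z is the integral, |z|^2 is the integral of the real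
    part of conj(z) f, which is at most |z| |f|. *)
Lemma normc_Cint f : Cintegrable f ->
  normc (Cint f) <= \int[mu]_x normc (f x).
Proof.
move=> fi; set z := Cint f.
have [->|z0] := eqVneq z 0; first by rewrite normc0 Rintegral_ge0// => x _; exact: normc_ge0.
have z_gt0 : 0 < normc z by rewrite lt_def normc_eq0 z0 normc_ge0.
rewrite -(ler_pM2l z_gt0) -RintegralZl//; last exact: integrable_normc.
have -> : normc z * normc z = complex.Re (Cint (fun x => z^* * f x)).
  by rewrite CintZ// -/z [_^* * z]mulrC mul_conjc expr2.
have [c1 _] := CintegrableZ z^* fi.
change (\int[mu]_x complex.Re (z^* * f x) <=
  \int[mu]_x (normc z * normc (f x))).
apply: le_Rintegral => //.
  exact/integrableZR/integrable_normc.
move=> x _; rewrite -(normc_conj z) -normcM.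
by rewrite (le_trans (ler_norm _))// Re_le_normc.
Qed.

Lemma le_normc_Cint f (g : T -> R) : Cmeasurable f ->
  mu.-integrable setT (EFin \o g) -> (forall x, normc (f x) <= g x) ->
  normc (Cint f) <= \int[mu]_x g x.
Proof.
move=> mf ig fg; have fi := le_Cintegrable mf ig fg.
rewrite (le_trans (normc_Cint fi))//.
by apply: le_Rintegral => //; exact: integrable_normc.
Qed.

Lemma dominated_cvg_Cint (F : nat -> T -> R[i]) f (g : T -> R) :
  (forall n, Cmeasurable (F n)) -> Cmeasurable f ->
  mu.-integrable setT (EFin \o g) ->
  (forall n x, normc (F n x) <= g x) -> (forall x, normc (f x) <= g x) ->
  (forall x, normc (F n x - f x) @[n --> \oo] --> 0) ->
  normc (Cint (F n) - Cint f) @[n --> \oo] --> (0 : R).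
Proof.
move=> mF mf ig Fg fg Ff.
have : \int[mu]_x normc (F n x - f x) @[n --> \oo] --> (0 : R).
  apply: (dominated_cvg_Rintegral0 _ (integrableZR 2 ig)) => //.
  - by move=> n; exact/measurable_normc/CmeasurableB.
  - move=> n x; rewrite ger0_norm ?normc_ge0//.
    by rewrite (le_trans (ler_normcB _ _))// mulrDl mul1r lerD.
apply: squeeze_cvgr; last exact: cvg_cst.
apply: nearW => n; apply/andP; split; first exact: normc_ge0.
have iF := le_Cintegrable (mF n) ig (Fg n).
have iff := le_Cintegrable mf ig fg.
by rewrite -CintB//; apply: normc_Cint; exact: CintegrableB.
Qed.

End Cintegral.

(** * Fubini's theorem for real and complex integrands *)

Section Rfubini.
Context {R : realType} d1 d2 {T1 : measurableType d1} {T2 : measurableType d2}.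
Variable m1 : {sigma_finite_measure set T1 -> \bar R}.
Variable m2 : {sigma_finite_measure set T2 -> \bar R}.
Variable f : T1 * T2 -> R.
Hypothesis fi : (m1 \x m2)%E.-integrable setT (EFin \o f).

(** The real inner integral is [fine] of the extended one, hence 0 where the latter is infinite.
    This only lowers the absolute value, so [fubini_F] dominates it; the two differ on a null set
    only, which gives [Rfubini1]. *)
Lemma integrable_Rfubini1 :
  m1.-integrable setT (EFin \o (fun x => \int[m2]_y f (x, y))).
Proof.
have iF := integrable_fubini_F fi.
apply: (le_integrable measurableT _ _ iF).
  apply/measurable_EFinP; apply: measurableT_comp => //.
  exact: measurable_fubini_F fi.
move=> x _ /=; rewrite /Rintegral /fubini_F /=.
by case: (integral _ _ _) => //=; rewrite normr0 leey.
Qed.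

Lemma Rfubini1 : \int[m1]_x \int[m2]_y f (x, y) = \int[(m1 \x m2)%E]_z f z.
Proof.
rewrite {1 3}/Rintegral; congr fine.
rewrite -(integral12_prod_meas1 fi).
have iF := integrable_fubini_F fi.
apply: ae_eq_integral => //.
- exact: measurable_int integrable_Rfubini1.
- exact: measurable_fubini_F fi.
- have := integrable_ae measurableT iF.
  by apply: filterS => x /= h _; rewrite /Rintegral fineK//; exact: h.
Qed.

End Rfubini.

Section Rfubini_swap.
Context {R : realType} d1 d2 {T1 : measurableType d1} {T2 : measurableType d2}.
Variable m1 : {sigma_finite_measure set T1 -> \bar R}.
Variable m2 : {sigma_finite_measure set T2 -> \bar R}.
Variable f : T1 * T2 -> R.
Hypothesis fi : (m1 \x m2)%E.-integrable setT (EFin \o f).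

Let fswap : (m2 \x m1)%E.-integrable setT (EFin \o (fun z => f (z.2, z.1))).
Proof.
have mf : measurable_fun setT (EFin \o f) := measurable_int _ fi.
apply/integrable12ltyP.
  apply: (measurableT_comp mf); exact: measurable_fun_pair.
exact/(integrable21ltyP m1 m2 mf).
Qed.

Lemma integrable_Rfubini2 :
  m2.-integrable setT (EFin \o (fun y => \int[m1]_x f (x, y))).
Proof. exact: integrable_Rfubini1 fswap. Qed.

Lemma Rfubini2 : \int[m2]_y \int[m1]_x f (x, y) = \int[(m1 \x m2)%E]_z f z.
Proof.
rewrite {1 3}/Rintegral; congr fine.
rewrite -(integral21_prod_meas1 fi).
have iG := integrable_fubini_F fswap.
apply: ae_eq_integral => //.
- exact: measurable_int integrable_Rfubini2.
- exact: measurable_fubini_G fi.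
- have := integrable_ae measurableT iG.
  by apply: filterS => x /= h _; rewrite /Rintegral fineK//; exact: h.
Qed.

End Rfubini_swap.

Section Cfubini.
Context {R : realType} d1 d2 {T1 : measurableType d1} {T2 : measurableType d2}.
Variable m1 : {sigma_finite_measure set T1 -> \bar R}.
Variable m2 : {sigma_finite_measure set T2 -> \bar R}.

Lemma Cintegrable_fubini1 (F : T1 * T2 -> R[i]) : Cintegrable (m1 \x m2)%E F ->
  Cintegrable m1 (fun x => Cint m2 (fun y => F (x, y))).
Proof. by move=> [F1 F2]; split; [exact: integrable_Rfubini1 F1|exact: integrable_Rfubini1 F2]. Qed.

Lemma Cfubini (F : T1 -> T2 -> R[i]) :
  Cintegrable (m1 \x m2)%E (fun z => F z.1 z.2) ->
  Cint m1 (fun x => Cint m2 (F x)) = Cint m2 (fun y => Cint m1 (F^~ y)).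
Proof.
move=> [F1 F2]; rewrite /Cint/=; congr Complex.
- by have := Rfubini1 F1; have := Rfubini2 F1 => /= -> ->.
- by have := Rfubini1 F2; have := Rfubini2 F2 => /= -> ->.
Qed.

Lemma integrable_prod2 (f : T1 * T2 -> R) (G : T2 -> R) :
  measurable_fun setT f -> m2.-integrable setT (EFin \o G) ->
  (forall y, (\int[m1]_x `|f (x, y)|%:E <= (G y)%:E)%E) ->
  (m1 \x m2)%E.-integrable setT (EFin \o f).
Proof.
move=> mf iG fG; have mEf : measurable_fun setT (EFin \o f).
  exact/measurable_EFinP.
apply/(integrable21ltyP m1 m2 mEf).
move/integrableP : iG => [mG]; apply: le_lt_trans.
apply: ge0_le_integral => //=.
- by move=> y _; exact: integral_ge0.
- apply: (measurable_fun_fubini_tonelli_G (m1 := m1) (fun z => `|f z|%:E)) => //.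
  exact/measurable_EFinP/measurableT_comp.
- exact/measurable_EFinP/measurableT_comp/measurable_EFinP.
- by move=> y _; rewrite (le_trans (fG y))// lee_fin ler_norm.
Qed.

End Cfubini.

(** * Lebesgue measure on row vectors *)

Section affine_R.
Local Open Scope ereal_scope.
Context {R : realType}.
Implicit Types (a b : R).

Let aff a b (t : measurableTypeR R) : measurableTypeR R := (a * t + b)%R.

Let maff a b : measurable_fun setT (aff a b).
Proof. by apply: measurable_funD => //; exact: measurable_funM. Qed.

(** Uniqueness of Lebesgue measure: [|a|] times the image measure agrees with length on half-open
    intervals. For [a < 0] the preimage is closed at the other end, which does not change its
    length. *)
Let lebesgue_aff a b : a != 0%R -> forall A, measurable A ->
  lebesgue_measure A = `|a|%:E * lebesgue_measure (aff a b @^-1` A).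
Proof.
move=> a0.
pose m := mscale (NngNum (normr_ge0 a))
  (measure_function_pushforward__canonical__measure_function_Measure
    lebesgue_measure (maff a b)).
apply: (@lebesgue_measure_unique R m) => /= _ [[c d]] _ <-.
rewrite /m /mscale /= /pushforward /=.
have [a1|a1|/eqP] := ltgtP a 0%R; last by rewrite (negbTE a0).
- rewrite (_ : _ @^-1` _ = `[((d - b) / a)%R, ((c - b) / a)%R[%classic).
    rewrite !lebesgue_measure_itv/= !lte_fin ltr_ndivrMr// divfK// ltrD2r.
    case: ifPn => cd; last by rewrite mule0.
    rewrite -!EFinD -EFinM ltr0_norm//; congr EFin.
    by field.
  apply/seteqP; split => t /=; rewrite !in_itv/= /aff => /andP[h1 h2];
    by apply/andP; split; rewrite ?ler_ndivrMr ?ltr_ndivlMr in h1 h2 *; nra.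
- rewrite (_ : _ @^-1` _ = `]((c - b) / a)%R, ((d - b) / a)%R]%classic).
    rewrite !lebesgue_measure_itv/= !lte_fin ltr_pdivrMr// divfK ?gt_eqF// ltrD2r.
    case: ifPn => cd; last by rewrite mule0.
    rewrite -!EFinD -EFinM gtr0_norm//; congr EFin.
    by field.
  by apply/seteqP; split => t /=; rewrite !in_itv/= /aff ltr_pdivrMr// ler_pdivlMr//
    ltrBlDr lerBrDr mulrC.
Qed.

Lemma ge0_integral_affine a b (f : measurableTypeR R -> \bar R) : a != 0%R ->
  measurable_fun setT f -> (forall x, 0 <= f x) ->
  \int[lebesgue_measure]_t f (a * t + b)%R =
  (`|a|^-1)%:E * \int[lebesgue_measure]_t f t.
Proof.
move=> a0 mf f0.
rewrite -(@ge0_integral_pushforward _ _ _ _ _ _ (maff a b) lebesgue_measure setT f)//.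
have -> : \int[lebesgue_measure]_t f t = `|a|%:E *
    \int[pushforward lebesgue_measure (aff a b)]_t f t.
  rewrite -(ge0_integral_mscale
    (measure_function_pushforward__canonical__measure_function_Measure
       lebesgue_measure (maff a b)) measurableT (NngNum (normr_ge0 a)))//.
  by apply: eq_measure_integral => A mA _; exact: lebesgue_aff.
by rewrite muleA -EFinM mulVf ?mul1e// normr_eq0.
Qed.

End affine_R.

Section measurable_rV_extra.
Context {R : realType} {n : nat}.

Lemma measurable_rV_affine (a : R) (b : 'rV[R]_n) :
  measurable_fun setT (fun x : 'rV[R]_n => a *: x + b).
Proof.
apply: measurable_fun_coordP => i; under eq_fun do rewrite !mxE.
apply: measurable_funD => //; apply: measurable_funM => //.
exact: measurable_coord.
Qed.

Lemma measurable_rV_sub :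
  measurable_fun setT (fun z : 'rV[R]_n * 'rV[R]_n => z.1 - z.2).
Proof.
apply: measurable_fun_coordP => i; under eq_fun do rewrite !mxE.
by apply: measurable_funB;
  apply: (measurableT_comp (measurable_coord i)).
Qed.

End measurable_rV_extra.

Section integral_rV.
Local Open Scope ereal_scope.
Context {R : realType}.

Lemma ge0_integral_rV_succ n (f : 'rV[R]_n.+1 -> \bar R) :
  measurable_fun setT f -> (forall x, 0 <= f x) ->
  \int[lebesgue_rV n.+1]_x f x =
  \int[lebesgue_measure]_t \int[lebesgue_rV n]_x f (rV_cons (t, x)).
Proof.
move=> mf f0 /=; rewrite /lebesgue_rV_succ.
rewrite (@ge0_integral_pushforward _ _ _ _ _ _ (@measurable_rV_cons R n) _ setT f)//.
rewrite preimage_setT (fubini_tonelli1 (f \o @rV_cons R n))//.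
  exact: measurableT_comp (@measurable_rV_cons R n).
by move=> z; exact: f0.
Qed.

(** Induction on the dimension through Tonelli: the first coordinate contributes one factor
    [|a|^-1], the induction hypothesis the others. *)
Lemma ge0_integral_rV_affine n (a : R) (b : 'rV[R]_n) (f : 'rV[R]_n -> \bar R) :
  a != 0%R -> measurable_fun setT f -> (forall x, 0 <= f x) ->
  \int[lebesgue_rV n]_x f (a *: x + b)%R =
  (`|a| ^- n)%:E * \int[lebesgue_rV n]_x f x.
Proof.
move=> a0; elim: n b f => [|n IH] b f mf f0.
  rewrite expr0 invr1 mul1e; apply: eq_integral => x _.
  by rewrite [x]thinmx0 [b]thinmx0 scaler0 addr0.
rewrite ge0_integral_rV_succ//; last first.
  exact: measurableT_comp (measurable_rV_affine a b).
rewrite (ge0_integral_rV_succ mf f0).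
pose b0 := b ord0 ord0; pose b' := (rV_uncons b).2.
have mc t : measurable_fun setT (fun x : 'rV[R]_n => f (rV_cons (t, x))).
  by apply: (measurableT_comp mf); apply: measurableT_comp; first exact: measurable_rV_cons.
transitivity (\int[lebesgue_measure]_t ((`|a| ^- n)%:E *
    \int[lebesgue_rV n]_x f (rV_cons (a * t + b0, x))%R)).
  apply: eq_integral => t _.
  rewrite -(IH b' (fun x => f (rV_cons (a * t + b0, x))%R))//.
  apply: eq_integral => x _; congr f; apply/rowP => i; rewrite !mxE.
  by case: (unliftP ord0 i) => [j|] -> /=; rewrite ?mxE.
have mF : measurable_fun setT
    (fun t : measurableTypeR R => \int[lebesgue_rV n]_x f (rV_cons (t, x))).
  apply: (measurable_fun_fubini_tonelli_F (m2 := lebesgue_rV n) (f \o @rV_cons R n)) => //.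
    exact: measurableT_comp (@measurable_rV_cons R n).
  by move=> z /=; exact: f0.
rewrite ge0_integralZl//; last 2 first.
- apply: (measurableT_comp mF (g := fun t : measurableTypeR R =>
    (a * t + b0)%R : measurableTypeR R)).
  by apply: measurable_funD => //; exact: measurable_funM.
- by move=> t _; exact: integral_ge0.
rewrite (ge0_integral_affine b0 a0 mF); last by move=> t; exact: integral_ge0.
by rewrite muleA -EFinM -invfM -exprSr.
Qed.

End integral_rV.

Section affine_integral.
Local Open Scope complex_scope.
Context {R : realType} {n : nat}.
Local Notation mu := (lebesgue_rV n).
Variables (a : R) (b : 'rV[R]_n).
Hypothesis a0 : a != 0.

Lemma integrable_rV_affine (f : 'rV[R]_n -> R) :
  mu.-integrable setT (EFin \o f) ->
  mu.-integrable setT (EFin \o (fun x => f (a *: x + b))).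
Proof.
move=> /integrableP[mf fi]; apply/integrableP; split.
  exact: (measurableT_comp mf (measurable_rV_affine a b)).
rewrite (ge0_integral_rV_affine b a0 (f := fun x => `|(f x)%:E|%E))//.
  by rewrite lte_mul_pinfty// ?lee_fin ?invr_ge0 ?exprn_ge0.
exact: measurableT_comp.
Qed.

Lemma Rintegral_rV_affine (f : 'rV[R]_n -> R) :
  mu.-integrable setT (EFin \o f) ->
  \int[mu]_x f (a *: x + b) = `|a| ^- n * \int[mu]_x f x.
Proof.
move=> fi; rewrite /Rintegral -[X in X * _]/(fine (`|a| ^- n)%:E) -fineM//; last first.
  exact: integrable_fin_num.
congr fine; have mf := measurable_int _ fi.
rewrite integralE [in RHS]integralE muleBr//; last first.
  by apply: fin_num_adde_defl; rewrite fin_numN; exact: integrable_neg_fin_num.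
congr (_ - _)%E.
- have P := ge0_integral_rV_affine b a0 (measurable_funepos mf).
  rewrite -[RHS]P => [|x]; last exact: funepos_ge0.
  apply: eq_integral => x _.
  by rewrite !funeposE.
- have P := ge0_integral_rV_affine b a0 (measurable_funeneg mf).
  rewrite -[RHS]P => [|x]; last exact: funeneg_ge0.
  apply: eq_integral => x _.
  by rewrite !funenegE.
Qed.

Lemma Cintegrable_affine (f : 'rV[R]_n -> R[i]) :
  Cintegrable mu f -> Cintegrable mu (fun x => f (a *: x + b)).
Proof.
by move=> [f1 f2]; split;
  [exact: integrable_rV_affine f1|exact: integrable_rV_affine f2].
Qed.

Lemma Cint_affine (f : 'rV[R]_n -> R[i]) : Cintegrable mu f ->
  Cint mu (fun x => f (a *: x + b)) = (`|a| ^- n)%:C * Cint mu f.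
Proof.
move=> [f1 f2]; rewrite /Cint.
rewrite (Rintegral_rV_affine f1) (Rintegral_rV_affine f2).
by apply: complex_eqP; rewrite ?ReM ?ImM/= !mul0r ?subr0 ?addr0.
Qed.

End affine_integral.

Section shift_integral.
Context {R : realType} {n : nat}.
Local Notation mu := (lebesgue_rV n).
Implicit Types (f : 'rV[R]_n -> R[i]) (b : 'rV[R]_n).

Let subE b (x : 'rV[R]_n) : b - x = -1 *: x + b.
Proof. by rewrite scaleN1r addrC. Qed.

Let N1 : -1 != 0 :> R. Proof. by rewrite oppr_eq0 oner_eq0. Qed.

Lemma Cintegrable_sub f b : Cintegrable mu f ->
  Cintegrable mu (fun x => f (b - x)).
Proof.
by under [X in _ -> Cintegrable _ X]eq_fun do rewrite subE; exact: Cintegrable_affine.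
Qed.

Lemma Cint_sub f b : Cintegrable mu f ->
  Cint mu (fun x => f (b - x)) = Cint mu f.
Proof.
move=> fi; under eq_Cint do rewrite subE.
by rewrite Cint_affine// normrN normr1 expr1n invr1 mul1r.
Qed.

Lemma Cintegrable_shift f b : Cintegrable mu f ->
  Cintegrable mu (fun x => f (x + b)).
Proof.
move=> fi; rewrite (_ : (fun x => f (x + b)) = (fun x => f (1 *: x + b))).
  by apply: Cintegrable_affine => //; exact: oner_neq0.
by apply/funext => x; rewrite scale1r.
Qed.

Lemma Cint_shift f b : Cintegrable mu f ->
  Cint mu (fun x => f (x + b)) = Cint mu f.
Proof.
move=> fi; rewrite (@eq_Cint _ _ _ mu _ (fun x : 'rV[R]_n => f (1 *: x + b))) => [|x].
  by rewrite Cint_affine// ?oner_neq0// normr1 expr1n invr1 mul1r.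
by rewrite scale1r.
Qed.

End shift_integral.

(** * Integrals of products of functions of one coordinate *)

Section tensor.
Context {R : realType}.

Lemma Cmeasurable_prod d {T : measurableType d} I (s : seq I)
    (F : I -> T -> R[i]) :
  (forall i, Cmeasurable (F i)) -> Cmeasurable (fun x => \prod_(i <- s) F i x).
Proof.
move=> mF; elim: s => [|i s IH].
  by under eq_fun do rewrite big_nil; exact: Cmeasurable_cst.
by under eq_fun do rewrite big_cons; exact: CmeasurableM.
Qed.

Lemma Cintegrable_prod d1 d2 {T1 : measurableType d1} {T2 : measurableType d2}
    (m1 : {sigma_finite_measure set T1 -> \bar R})
    (m2 : {sigma_finite_measure set T2 -> \bar R})
    (g : T1 -> R[i]) (h : T2 -> R[i]) :
  Cintegrable m1 g -> Cintegrable m2 h ->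
  Cintegrable (m1 \x m2)%E (fun z => g z.1 * h z.2).
Proof.
move=> gi hi.
have mF : Cmeasurable (fun z : T1 * T2 => g z.1 * h z.2).
  by apply: CmeasurableM;
    [apply: (Cmeasurable_comp (Cintegrable_meas gi))|
     apply: (Cmeasurable_comp (Cintegrable_meas hi))].
apply: CintegrableP => //.
apply: (integrable_prod2 (measurable_normc mF)
  (integrableZR (\int[m1]_x normc (g x)) (integrable_normc hi))) => y /=.
rewrite EFinM EFin_Rintegral; last exact: integrable_normc.
rewrite -ge0_integralZr//; first last.
- by rewrite lee_fin normc_ge0.
- by move=> x _; rewrite lee_fin normc_ge0.
- by apply/measurable_EFinP; apply: measurable_normc; exact: Cintegrable_meas gi.
rewrite le_eqVlt; apply/orP; left; apply/eqP; apply: eq_integral => x _.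
by rewrite ger0_norm ?normc_ge0// normcM EFinM.
Qed.

Lemma Cint_prod d1 d2 {T1 : measurableType d1} {T2 : measurableType d2}
    (m1 : {sigma_finite_measure set T1 -> \bar R})
    (m2 : {sigma_finite_measure set T2 -> \bar R})
    (g : T1 -> R[i]) (h : T2 -> R[i]) :
  Cintegrable m1 g -> Cintegrable m2 h ->
  Cint (m1 \x m2)%E (fun z => g z.1 * h z.2) = Cint m1 g * Cint m2 h.
Proof.
move=> gi hi; have [F1 F2] := Cintegrable_prod gi hi.
rewrite -CintZr//.
transitivity (Cint m1 (fun x => Cint m2 (fun y => g x * h y))).
  rewrite {1}/Cint -(Rfubini1 F1) -(Rfubini1 F2)//.
by apply: eq_Cint => x; rewrite CintZ.
Qed.

Lemma Cintegrable_rV_succ n (F : 'rV[R]_n.+1 -> R[i]) : Cmeasurable F ->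
  Cintegrable (lebesgue_measure \x lebesgue_rV n)%E (fun z => F (rV_cons z)) ->
  Cintegrable (lebesgue_rV n.+1) F /\
  Cint (lebesgue_rV n.+1) F =
  Cint (lebesgue_measure \x lebesgue_rV n)%E (fun z => F (rV_cons z)).
Proof.
move=> [/measurable_EFinP mF1 /measurable_EFinP mF2] [F1 F2]; split.
  by split; apply: (integrable_pushforward (@measurable_rV_cons R n)).
by rewrite /Cint /Rintegral /= /lebesgue_rV_succ !(integral_pushforward (@measurable_rV_cons R n)).
Qed.

(** The Fejer kernel and the majorant [weight] are products over the coordinates, so this reduces
    their integrals to dimension one. *)
Lemma Cint_tensor n (g : 'I_n -> measurableTypeR R -> R[i]) :
  (forall i, Cintegrable lebesgue_measure (g i)) ->
  Cintegrable (lebesgue_rV n) (fun x => \prod_(i < n) g i (x ord0 i)) /\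
  Cint (lebesgue_rV n) (fun x => \prod_(i < n) g i (x ord0 i)) =
  \prod_(i < n) Cint lebesgue_measure (g i).
Proof.
elim: n g => [|n IH] g gi.
  have E : (fun x : 'rV[R]_0 => \prod_(i < 0) g i (x ord0 i)) = fun=> 1%:C%C.
    by apply/funext => x; rewrite big_ord0.
  rewrite E big_ord0 CintR; split.
    by apply: CintegrableR; exact: finite_measure_integrable_cst.
  by rewrite /Rintegral /= integral_dirac//= indicE in_setT mulr1.
have [hi hE] := IH (fun i => g (lift ord0 i)) (fun i => gi _).
set h := (fun x => \prod_(i < n) _) in hi hE.
have E z : \prod_(i < n.+1) g i (@rV_cons R n z ord0 i) = g ord0 z.1 * h z.2.
  rewrite big_ord_recl mxE unlift_none; congr (_ * _).
  by apply: eq_bigr => i _; rewrite mxE liftK.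
have ghi := Cintegrable_prod (gi ord0) hi.
have [||i1 e1] := @Cintegrable_rV_succ n (fun x => \prod_(i < n.+1) g i (x ord0 i)).
- apply: Cmeasurable_prod => i.
  exact: (Cmeasurable_comp (Cintegrable_meas (gi i)) (@measurable_coord R n.+1 i)).
- by under eq_fun do rewrite E.
split => //; rewrite e1; under eq_Cint do rewrite E.
by rewrite Cint_prod// hE big_ord_recl.
Qed.

End tensor.

(** * Continuity and measurability on row vectors *)

Section continuous_rV.
Context {R : realType} {n : nat}.

Lemma mx_norm_ltP (x : 'rV[R]_n) (e : R) : 0 < e ->
  reflect (forall i, `|x ord0 i| < e) (`|x| < e).
Proof.
move=> e0; apply: (iffP idP) => [xe i|xe].
  have : mx_norm x < e := xe.
  by rewrite mx_normrE => /bigmax_ltP[_ /(_ (ord0, i))]; exact.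
suff : mx_norm x < e by [].
rewrite mx_normrE; apply/bigmax_ltP; split => // -[i j] _ /=.
by rewrite (ord1 i).
Qed.

Lemma coord_le_norm (x : 'rV[R]_n) i : `|x ord0 i| <= `|x|.
Proof.
rewrite leNgt; apply/negP => h.
have x0 : 0 < `|x ord0 i| by rewrite (le_lt_trans _ h).
by move/(mx_norm_ltP _ x0) : h => /(_ i); rewrite ltxx.
Qed.

(** The sigma-algebra is generated by the coordinates, and an open set is the union of the countably
    many cubes inside it that have a rational centre and radius [p.2.+1%:R^-1]. *)
Lemma open_rV_measurable (U : set 'rV[R]_n) : open U -> measurable U.
Proof.
move=> oU.
pose B (p : 'rV[rat]_n * nat) : set 'rV[R]_n :=
  [set x | forall i, `|x ord0 i - ratr (p.1 ord0 i)| < p.2.+1%:R^-1].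
have mB p : measurable (B p).
  rewrite (_ : B p = \bigcap_(i in [set: 'I_n])
    (fun x : 'rV[R]_n => x ord0 i) @^-1` (ball (ratr (p.1 ord0 i) : R) p.2.+1%:R^-1)).
    apply: fin_bigcap_measurable => // i _.
    rewrite -[X in measurable X]setTI; apply: measurable_coord => //.
    exact: measurable_ball.
  apply/seteqP; split => x /= h i; first by move=> _; rewrite /= /ball/= distrC.
  by have := h i I; rewrite /= /ball/= distrC.
have -> : U = \bigcup_(p in [set p | B p `<=` U]) B p.
  apply/seteqP; split => [x Ux|x [p pU]]; last exact: pU.
  move/open_nbhs_nbhs : (conj oU Ux) => /(nbhs_ballP x)[e /= e0 eU].
  (* The radius is below [e / 2], so that a cube of this radius that contains [x] stays within
     distance [e] of [x]. *)
  pose k := Num.truncn (2 / e).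
  have ke : (k.+1%:R^-1 : R) < e / 2.
    rewrite -[ltRHS]invrK invf_div ltf_pV2 ?posrE ?divr_gt0//.
    by rewrite truncnS_gt.
  have k0 : (0 : R) < k.+1%:R^-1 by rewrite invr_gt0.
  have /choice[q hq] : forall i : 'I_n, exists q : rat,
      `|x ord0 i - ratr q| < (k.+1%:R^-1 : R).
    move=> i; have /rat_in_itvoo[q] :
      x ord0 i - k.+1%:R^-1 < x ord0 i + k.+1%:R^-1 by rewrite ltrD2l gt0_cp.
    rewrite in_itv/= => /andP[h1 h2]; exists q.
    by rewrite distrC ltr_distl h1 h2.
  exists (\row_i q i, k) => /=; last by move=> i; rewrite mxE.
  move=> y /= By; apply: eU; rewrite -ball_normE/=.
  apply/mx_norm_ltP => // i; rewrite !mxE.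
  have := By i; rewrite mxE => h1.
  rewrite -(subrKA (ratr (q i))) (le_lt_trans (ler_normD _ _))//.
  rewrite (splitr e) ltrD// ?(lt_trans _ ke)//.
  by rewrite distrC.
rewrite bigcup_mkcond; apply: countable_bigcupT_measurable => // p.
by case: ifPn.
Qed.

Lemma continuous_rV_measurable (f : 'rV[R]_n -> R) : continuous f ->
  measurable_fun setT f.
Proof.
move=> /continuousP cf.
apply: (measurability _ (RGenOInfty.measurableE R)) => //.
move=> _ [_ [a ->] <-]; rewrite setTI; apply: open_rV_measurable.
by apply: cf; exact: interval_open.
Qed.

Lemma ccontinuous_Cmeasurable (f : 'rV[R]_n -> R[i]) :
  ccontinuous f -> Cmeasurable f.
Proof. by move=> [? ?]; split; exact: continuous_rV_measurable. Qed.

End continuous_rV.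

Section measurable_parametric.
Context {R : realType} d1 d2 {T1 : measurableType d1} {T2 : measurableType d2}.
Variable m2 : {sigma_finite_measure set T2 -> \bar R}.

(** No integrability is assumed: Tonelli handles the positive and negative parts separately, and
    [fine] of their difference is measurable even where it is infinite. *)
Lemma measurable_Rintegral (F : T1 * T2 -> R) : measurable_fun setT F ->
  measurable_fun setT (fun x => \int[m2]_y F (x, y)).
Proof.
move=> /measurable_EFinP mF; apply: measurableT_comp => //.
rewrite (_ : (fun x => _) = fun x =>
  (\int[m2]_y (EFin \o F)^\+ (x, y) - \int[m2]_y (EFin \o F)^\- (x, y)))%E; last first.
  apply/funext => x; rewrite integralE.
  by congr (_ - _)%E; apply: eq_integral => y _; rewrite ?funeposE ?funenegE.
apply: emeasurable_funB.
- exact: (measurable_fun_fubini_tonelli_F (m2 := m2) _ (measurable_funepos mF)).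
- exact: (measurable_fun_fubini_tonelli_F (m2 := m2) _ (measurable_funeneg mF)).
Qed.

End measurable_parametric.

Section sequential_continuity.
Context {R : realType} {n : nat}.

(** Continuity is tested on sequences because dominated convergence is about sequences; balls of
    radius [k.+1%:R^-1] form a countable base at [p]. *)
Lemma continuous_seq (f : 'rV[R]_n -> R) :
  (forall p (u : nat -> 'rV[R]_n), u k @[k --> \oo] --> p ->
    f (u k) @[k --> \oo] --> f p) -> continuous f.
Proof.
move=> H p A /= /nbhs_ballP[e/= e0 eA].
change (nbhs (p : 'rV[R]_n) (f @^-1` A)); apply: contrapT => np.
have /choice[u hu] : forall k : nat, exists x, `|p - x| < k.+1%:R^-1 /\ ~ A (f x).
  move=> k; apply: contrapT => nx; apply: np; apply/nbhs_ballP.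
  exists k.+1%:R^-1 => /=; first by rewrite invr_gt0.
  move=> x; rewrite -ball_normE/= => px; apply: contrapT => fx.
  by apply: nx; exists x.
have up : u k @[k --> \oo] --> p.
  apply/cvgrPdist_lt => d d0; near=> k.
  rewrite (lt_trans (hu k).1)//; near: k.
  exact: (@near_infty_natSinv_lt R (PosNum d0)).
have /(_ A)[|N _ /(_ N (leqnn N))] := H p u up.
  by apply/nbhs_ballP; exists e.
exact: (hu N).2.
Unshelve. all: by end_near. Qed.

Lemma normc_cvg (z : nat -> R[i]) (c : R[i]) :
  normc (z k - c) @[k --> \oo] --> (0 : R) ->
  complex.Re (z k) @[k --> \oo] --> complex.Re c /\
  complex.Im (z k) @[k --> \oo] --> complex.Im c.
Proof.
move=> zc; split; apply/cvgrPdist_le => e e0; near=> k.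
- have : normc (z k - c) <= e.
    near: k; move/cvgrPdist_le : zc => /(_ e e0).
    by apply: filterS => k; rewrite sub0r normrN ger0_norm// normc_ge0.
  by apply: le_trans; rewrite normcBC (le_trans _ (Re_le_normc _))// ReD ReN.
- have : normc (z k - c) <= e.
    near: k; move/cvgrPdist_le : zc => /(_ e e0).
    by apply: filterS => k; rewrite sub0r normrN ger0_norm// normc_ge0.
  by apply: le_trans; rewrite normcBC (le_trans _ (Im_le_normc _))// ImD ImN.
Unshelve. all: by end_near. Qed.

Lemma cvg0Ml (c : R) (u : nat -> R) :
  u k @[k --> \oo] --> (0 : R) -> c * u k @[k --> \oo] --> (0 : R).
Proof.
by move=> u0; rewrite -[X in _ --> X](mulr0 c); apply: cvgM; first exact: cvg_cst.
Qed.

Lemma cvg_normc (z : nat -> R[i]) (c : R[i]) :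
  complex.Re (z k) @[k --> \oo] --> complex.Re c ->
  complex.Im (z k) @[k --> \oo] --> complex.Im c ->
  normc (z k - c) @[k --> \oo] --> (0 : R).
Proof.
move=> z1 z2.
have h1 : `|complex.Re (z k) - complex.Re c| @[k --> \oo] --> `|0 : R|.
  by apply: cvg_norm; exact/subr_cvg0.
have h2 : `|complex.Im (z k) - complex.Im c| @[k --> \oo] --> `|0 : R|.
  by apply: cvg_norm; exact/subr_cvg0.
have := cvgD h1 h2; rewrite normr0 addr0; move=> h.
apply: squeeze_cvgr (h _); last exact: cvg_cst.
apply: nearW => k; rewrite normc_ge0/= (le_trans (normc_le_ReIm _))//.
by rewrite ReD ImD ReN ImN.
Qed.

Lemma ccontinuous_seq (f : 'rV[R]_n -> R[i]) :
  (forall p (u : nat -> 'rV[R]_n), u k @[k --> \oo] --> p ->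
    normc (f (u k) - f p) @[k --> \oo] --> (0 : R)) -> ccontinuous f.
Proof.
by move=> H; split; apply: continuous_seq => p u up;
  have [] := normc_cvg (H p u up).
Qed.

Lemma ccontinuous_cvg (f : 'rV[R]_n -> R[i]) p (u : nat -> 'rV[R]_n) :
  ccontinuous f -> u k @[k --> \oo] --> p ->
  normc (f (u k) - f p) @[k --> \oo] --> (0 : R).
Proof.
move=> [f1 f2] up; apply: cvg_normc.
- exact: (continuous_cvg _ (f1 p) up).
- exact: (continuous_cvg _ (f2 p) up).
Qed.

End sequential_continuity.

Lemma Cmeasurable_expi {R : realType} d {T : measurableType d} (h : T -> R) :
  measurable_fun setT h -> Cmeasurable (fun x => expi (h x)).
Proof.
move=> mh; split => /=; apply: measurableT_comp mh.
- exact: continuous_measurable_fun (@continuous_cos R).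
- exact: continuous_measurable_fun (@continuous_sin R).
Qed.

(** * Convolutions *)

Section convolution_theory.
Local Open Scope complex_scope.
Context {R : realType} {n : nat}.
Local Notation mu := (lebesgue_rV n).
Implicit Types (f g h : 'rV[R]_n -> R[i]) (M : R).

Definition N1 f : R := \int[mu]_x normc (f x).

Lemma N1_ge0 f : 0 <= N1 f.
Proof. by apply: Rintegral_ge0 => x _; exact: normc_ge0. Qed.

Lemma convolutionE f g x :
  convolution f g x = Cint mu (fun y => f (x - y) * g y).
Proof. by []. Qed.

Lemma Cmeasurable_sub f (x : 'rV[R]_n) :
  Cmeasurable f -> Cmeasurable (fun y : 'rV[R]_n => f (x - y)).
Proof.
move=> mf; apply: (Cmeasurable_comp mf).
under eq_fun do rewrite addrC -scaleN1r.
exact: measurable_rV_affine.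
Qed.

Lemma Cintegrable_convolution M f g x : Cmeasurable f ->
  (forall y, normc (f y) <= M) -> Cintegrable mu g ->
  Cintegrable mu (fun y => f (x - y) * g y).
Proof.
by move=> mf fM gi; apply: (CintegrableMl (M := M)) => //; exact: Cmeasurable_sub.
Qed.

Lemma normc_convolution M f g x : Cmeasurable f ->
  (forall y, normc (f y) <= M) -> Cintegrable mu g ->
  normc (convolution f g x) <= M * N1 g.
Proof.
move=> mf fM gi; rewrite -RintegralZl//; last exact: integrable_normc.
apply: le_normc_Cint.
- exact/CmeasurableM/(Cintegrable_meas gi)/Cmeasurable_sub.
- exact/integrableZR/integrable_normc.
- by move=> y; rewrite normcM ler_wpM2r// normc_ge0.
Qed.

Let mFsub f : Cmeasurable f ->
  Cmeasurable (fun z : 'rV[R]_n * 'rV[R]_n => f (z.1 - z.2)).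
Proof. by move=> mf; exact: (Cmeasurable_comp mf measurable_rV_sub). Qed.

Lemma convolutionC M f g : Cmeasurable f -> (forall y, normc (f y) <= M) ->
  Cintegrable mu g -> convolution f g = convolution g f.
Proof.
move=> mf fM gi; apply/funext => x; rewrite !convolutionE.
rewrite -(Cint_sub x (Cintegrable_convolution x mf fM gi)).
by apply: eq_Cint => y; rewrite subKr mulrC.
Qed.

Lemma N1_shift f (b : 'rV[R]_n) : Cintegrable mu f ->
  N1 (fun x => f (x + b)) = N1 f.
Proof.
rewrite /N1 => /integrable_normc/(Rintegral_rV_affine b (oner_neq0 R)).
rewrite normr1 expr1n invr1 mul1r => <-.
by apply: eq_Rintegral => x _; rewrite scale1r.
Qed.

Lemma N1_sub f (b : 'rV[R]_n) : Cintegrable mu f ->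
  N1 (fun x => f (b - x)) = N1 f.
Proof.
have N10 : -1 != 0 :> R by rewrite oppr_eq0 oner_eq0.
rewrite /N1 => /integrable_normc/(Rintegral_rV_affine b N10).
rewrite normrN normr1 expr1n invr1 mul1r => <-.
by apply: eq_Rintegral => x _; rewrite scaleN1r addrC.
Qed.

Lemma integrable_convolution_prod f g : Cintegrable mu f -> Cintegrable mu g ->
  Cintegrable (mu \x mu)%E (fun z => f (z.1 - z.2) * g z.2).
Proof.
move=> fi gi.
have mF : Cmeasurable (fun z : 'rV[R]_n * 'rV[R]_n => f (z.1 - z.2) * g z.2).
  apply: CmeasurableM; first exact/mFsub/(Cintegrable_meas fi).
  exact: (Cmeasurable_comp (Cintegrable_meas gi)).
apply: CintegrableP => //.
apply: (integrable_prod2 (measurable_normc mF)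
  (integrableZR (N1 f) (integrable_normc gi))) => y /=.
rewrite EFinM -(N1_shift (- y) fi) /N1; have fi' := Cintegrable_shift (- y) fi.
rewrite EFin_Rintegral; last exact: integrable_normc fi'.
rewrite -ge0_integralZr//; first last.
- by rewrite lee_fin normc_ge0.
- by move=> x _; rewrite lee_fin normc_ge0.
- by apply/measurable_EFinP; apply: measurable_normc; exact: Cintegrable_meas fi'.
rewrite le_eqVlt; apply/orP; left; apply/eqP; apply: eq_integral => x _.
by rewrite ger0_norm ?normc_ge0// normcM EFinM.
Qed.

Lemma Cintegrable_conv f g : Cintegrable mu f -> Cintegrable mu g ->
  Cintegrable mu (convolution f g).
Proof.
by move=> fi gi; exact: (Cintegrable_fubini1 (integrable_convolution_prod fi gi)).
Qed.

Lemma N1_convolution f g :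
  (forall x, Cintegrable mu (fun y => f (x - y) * g y)) ->
  Cintegrable mu f -> Cintegrable mu g ->
  N1 (convolution f g) <= N1 f * N1 g.
Proof.
move=> fgi fi gi; have Fi := integrable_normc (integrable_convolution_prod fi gi).
have -> : N1 f * N1 g =
    \int[mu]_x \int[mu]_y normc (f (x - y) * g y).
  have := Rfubini1 Fi => /= ->; have := Rfubini2 Fi => /= <-.
  rewrite /N1 -RintegralZl//; last exact: integrable_normc.
  apply: eq_Rintegral => y _.
  under [RHS]eq_Rintegral do rewrite normcM.
  rewrite RintegralZr//; last exact: integrable_normc (Cintegrable_shift (- y) fi).
  by congr (_ * _); exact: esym (N1_shift (- y) fi).
apply: le_Rintegral => //.
- exact/integrable_normc/Cintegrable_conv.
- exact: integrable_Rfubini1 Fi.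
- by move=> x _; exact: normc_Cint.
Qed.

(** Fubini for [f (x - w) * (g (w - y) * h y)]. Since [f] is merely bounded, characters and elements
    of X are allowed. Equality holds at every point, hence the convergence of [g * h] everywhere in
    the hypotheses. *)
Lemma convolutionA M f g h : Cmeasurable f -> (forall y, normc (f y) <= M) ->
  Cintegrable mu g -> Cintegrable mu h ->
  (forall x, Cintegrable mu (fun y => g (x - y) * h y)) ->
  convolution (convolution f g) h = convolution f (convolution g h).
Proof.
move=> mf fM gi hi ghi; apply/funext => x; rewrite !convolutionE.
transitivity (Cint mu (fun y => Cint mu (fun w => f (x - w) * (g (w - y) * h y)))).
  apply: eq_Cint => y; rewrite convolutionE.
  have I1 : Cintegrable mu (fun w => f (x - w) * g (w - y)).
    apply: (CintegrableMl (M := M)) => //; first exact: Cmeasurable_sub.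
    exact: Cintegrable_shift.
  have -> : Cint mu (fun z => f (x - y - z) * g z) =
      Cint mu (fun w => f (x - w) * g (w - y)).
    rewrite -(Cint_shift y I1); apply: eq_Cint => z.
    by rewrite addrK opprD addrA addrAC.
  by rewrite -CintZr//; apply: eq_Cint => w; rewrite mulrA.
transitivity (Cint mu (fun w => Cint mu (fun y => f (x - w) * (g (w - y) * h y)))).
  rewrite (@Cfubini _ _ _ _ _ mu mu (fun w y => f (x - w) * (g (w - y) * h y)))//.
  have Gi := integrable_convolution_prod gi hi.
  apply: (CintegrableMl (M := M) _ _ Gi).
    apply: (Cmeasurable_comp (f := fun w : 'rV[R]_n => f (x - w)) (g := fst)) => //.
    exact: Cmeasurable_sub.
  by move=> z; exact: fM.
by apply: eq_Cint => w; rewrite convolutionE CintZ.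
Qed.

(* The functions for which every convolution below converges everywhere. *)
Definition tame f := [/\ ccontinuous f, Cintegrable mu f &
  exists M, forall x, normc (f x) <= M].

Lemma tame_integrable f : tame f -> Cintegrable mu f. Proof. by case. Qed.

Lemma tame_meas f : tame f -> Cmeasurable f.
Proof. by case=> /ccontinuous_Cmeasurable. Qed.

Lemma ccontinuousB f g : ccontinuous f -> ccontinuous g ->
  ccontinuous (fun x => f x - g x).
Proof.
move=> [f1 f2] [g1 g2]; split => x.
- rewrite (_ : (fun y => _) =
    (fun y => complex.Re (f y)) \- (fun y => complex.Re (g y))).
    exact: (continuousB (f1 x) (g1 x)).
  by apply/funext => y; rewrite ReD ReN.
- rewrite (_ : (fun y => _) =
    (fun y => complex.Im (f y)) \- (fun y => complex.Im (g y))).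
    exact: (continuousB (f2 x) (g2 x)).
  by apply/funext => y; rewrite ImD ImN.
Qed.

Lemma tameB f g : tame f -> tame g -> tame (fun x => f x - g x).
Proof.
move=> [cf fi [M fM]] [cg gi [K gK]]; split.
- exact: ccontinuousB.
- exact: CintegrableB.
- by exists (M + K) => x; rewrite (le_trans (ler_normcB _ _))// lerD.
Qed.

Lemma tame_conv_integrable f g x : tame f -> Cintegrable mu g ->
  Cintegrable mu (fun y => f (x - y) * g y).
Proof.
by move=> tf gi; have [_ _ [M fM]] := tf; exact: Cintegrable_convolution (tame_meas tf) fM gi.
Qed.

Lemma tame_conv f g : tame f -> Cintegrable mu g -> tame (convolution f g).
Proof.
move=> tf gi; have [cf fi [M fM]] := tf; have mf := tame_meas tf; split.
- apply: ccontinuous_seq => p u up; rewrite !convolutionE.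
  apply: (dominated_cvg_Cint (g := fun y => M * normc (g y))).
  + by move=> k; exact: Cintegrable_meas (tame_conv_integrable (u k) tf gi).
  + exact: Cintegrable_meas (tame_conv_integrable p tf gi).
  + exact/integrableZR/integrable_normc.
  + by move=> k y; rewrite normcM ler_wpM2r// normc_ge0.
  + by move=> y; rewrite normcM ler_wpM2r// normc_ge0.
  + move=> y.
    have -> : (fun k => normc (f (u k - y) * g y - f (p - y) * g y)) =
        (fun k => normc (g y) * normc (f (u k - y) - f (p - y))).
      by apply/funext => k; rewrite -mulrBl normcM mulrC.
    apply: cvg0Ml.
    by apply: (ccontinuous_cvg cf); apply: cvgB => //; exact: cvg_cst.
- exact: Cintegrable_conv.
- by exists (M * N1 g) => x; exact: normc_convolution.
Qed.

Lemma N1_conv f g : tame f -> Cintegrable mu g ->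
  N1 (convolution f g) <= N1 f * N1 g.
Proof.
move=> tf gi; apply: N1_convolution => //; last exact: tame_integrable.
by move=> x; exact: tame_conv_integrable.
Qed.

Lemma N1D f g : Cintegrable mu f -> Cintegrable mu g ->
  N1 (fun x => f x + g x) <= N1 f + N1 g.
Proof.
move=> fi gi; rewrite /N1 -RintegralD//; [|exact: integrable_normc..].
apply: le_Rintegral => //.
- exact/integrable_normc/CintegrableD.
- by apply: integrableDR; exact: integrable_normc.
- by move=> x _; exact: ler_normcD.
Qed.

Lemma N1N f : N1 (fun x => - f x) = N1 f.
Proof. by rewrite /N1; congr Rintegral; apply/funext => x; rewrite normcN. Qed.

Lemma convDl f g h x : (forall x, Cintegrable mu (fun y => f (x - y) * h y)) ->
  (forall x, Cintegrable mu (fun y => g (x - y) * h y)) ->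
  convolution (fun x => f x + g x) h x = convolution f h x + convolution g h x.
Proof.
move=> fi gi; rewrite !convolutionE -CintD//.
by apply: eq_Cint => y; rewrite mulrDl.
Qed.

Lemma convBl f g h x : (forall x, Cintegrable mu (fun y => f (x - y) * h y)) ->
  (forall x, Cintegrable mu (fun y => g (x - y) * h y)) ->
  convolution (fun x => f x - g x) h x = convolution f h x - convolution g h x.
Proof.
move=> fi gi; rewrite !convolutionE -CintB//.
by apply: eq_Cint => y; rewrite mulrBl.
Qed.

End convolution_theory.

(** * Dilations *)

Section dilation.
Local Open Scope complex_scope.
Context {R : realType} {n : nat}.
Local Notation mu := (lebesgue_rV n).
Implicit Types (f g h : 'rV[R]_n -> R[i]) (e : R).

Lemma Cintegrable_scale (a : R) f : a != 0 -> Cintegrable mu f ->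
  Cintegrable mu (fun x => f (a *: x)).
Proof.
move=> a0 /(Cintegrable_affine 0 a0).
by under eq_fun do rewrite addr0.
Qed.

Lemma Cint_scale (a : R) f : a != 0 -> Cintegrable mu f ->
  Cint mu (fun x => f (a *: x)) = (`|a| ^- n)%:C * Cint mu f.
Proof.
move=> a0 /(Cint_affine 0 a0) <-.
by apply: eq_Cint => x; rewrite addr0.
Qed.

Lemma normc_dilate e f x : 0 < e ->
  normc (dilate e f x) = e ^- n * normc (f (e^-1 *: x)).
Proof.
by move=> e0; rewrite normcM normcR ger0_norm// invr_ge0 exprn_ge0// ltW.
Qed.

Lemma Cintegrable_dilate e f : 0 < e -> Cintegrable mu f ->
  Cintegrable mu (dilate e f).
Proof.
move=> e0 fi; apply: CintegrableZ; apply: Cintegrable_scale => //.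
by rewrite invr_eq0 gt_eqF.
Qed.

Lemma Cint_dilate e f : 0 < e -> Cintegrable mu f ->
  Cint mu (dilate e f) = Cint mu f.
Proof.
move=> e0 fi; have e1 : e^-1 != 0 by rewrite invr_eq0 gt_eqF.
rewrite CintZ; last exact: Cintegrable_scale.
rewrite Cint_scale// mulrA -rmorphM/= gtr0_norm ?invr_gt0// exprVn invrK.
by rewrite mulVf ?mul1r// expf_neq0// gt_eqF.
Qed.

Lemma N1_dilate e f : 0 < e -> Cintegrable mu f -> N1 (dilate e f) = N1 f.
Proof.
move=> e0 fi; have e1 : e^-1 != 0 by rewrite invr_eq0 gt_eqF.
have := Rintegral_rV_affine 0 e1 (integrable_normc fi).
rewrite gtr0_norm ?invr_gt0// exprVn invrK => E.
rewrite /N1; under eq_Rintegral do rewrite normc_dilate//.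
rewrite RintegralZl//; last first.
  by have := integrable_normc (Cintegrable_scale e1 fi).
under eq_Rintegral do rewrite -[_ *: _]addr0.
by rewrite E mulrA mulVf ?mul1r// expf_neq0// gt_eqF.
Qed.

Lemma dilateK e e' f : dilate e (dilate e' f) = dilate (e * e') f.
Proof.
apply/funext => x; rewrite /dilate mulrA -rmorphM/= scalerA.
by rewrite exprMn !invfM [e'^-1 * _]mulrC.
Qed.

Lemma dilate1 f : dilate 1 f = f.
Proof. by apply/funext => x; rewrite /dilate expr1n invr1 mul1r scale1r. Qed.

Lemma dilateB e f g :
  dilate e (fun x => f x - g x) = (fun x => dilate e f x - dilate e g x).
Proof. by apply/funext => x; rewrite /dilate mulrBr. Qed.

Lemma ccontinuous_dilate e f : ccontinuous f -> ccontinuous (dilate e f).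
Proof.
move=> cf; apply: ccontinuous_seq => p u up; rewrite /dilate.
rewrite (_ : (fun k => normc _) = fun k => normc (e ^- n)%:C *
    normc (f (e^-1 *: u k) - f (e^-1 *: p))); last first.
  by apply/funext => k; rewrite -mulrBr normcM.
apply: cvg0Ml.
by apply: (ccontinuous_cvg cf); exact: cvgZr.
Qed.

Lemma tame_dilate e f : 0 < e -> tame f -> tame (dilate e f).
Proof.
move=> e0 [cf fi [M fM]]; split.
- exact: ccontinuous_dilate.
- exact: Cintegrable_dilate.
- exists (e ^- n * M) => x; rewrite normc_dilate// ler_wpM2l//.
  by rewrite invr_ge0 exprn_ge0// ltW.
Qed.

Lemma conv_dilate e f g : 0 < e -> tame f -> Cintegrable mu g ->
  convolution (dilate e f) (dilate e g) = dilate e (convolution f g).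
Proof.
move=> e0 tf gi; have e1 : e^-1 != 0 by rewrite invr_eq0 gt_eqF.
apply/funext => x; rewrite /dilate !convolutionE.
have I := tame_conv_integrable (e^-1 *: x) tf gi.
have := Cint_scale e1 I; rewrite gtr0_norm ?invr_gt0// exprVn invrK => E.
transitivity ((e ^- n)%:C * (e ^- n)%:C * Cint mu
    (fun y => f (e^-1 *: x - e^-1 *: y) * g (e^-1 *: y))).
  rewrite -CintZ; last exact: (Cintegrable_scale e1 I).
  by apply: eq_Cint => y; rewrite scalerBr; ring.
rewrite E mulrA -[X in X * Cint _ _]mulrA -rmorphM/= mulVf ?mulr1//.
by rewrite expf_neq0// gt_eqF.
Qed.

End dilation.

(** * The Fourier transform *)

Section fourier_theory.
Local Open Scope complex_scope.
Context {R : realType} {n : nat}.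
Local Notation mu := (lebesgue_rV n).
Implicit Types (f g h : 'rV[R]_n -> R[i]) (x y xi : 'rV[R]_n).

Lemma dotpC x y : dotp x y = dotp y x.
Proof. by apply: eq_bigr => i _; rewrite mulrC. Qed.

Lemma dotpDl x y xi : dotp (x + y) xi = dotp x xi + dotp y xi.
Proof. by rewrite -big_split; apply: eq_bigr => i _; rewrite mxE mulrDl. Qed.

Lemma dotpZl (a : R) x xi : dotp (a *: x) xi = a * dotp x xi.
Proof. by rewrite /dotp big_distrr/=; apply: eq_bigr => i _; rewrite mxE mulrA. Qed.

Lemma dotpNl x xi : dotp (- x) xi = - dotp x xi.
Proof. by rewrite -scaleN1r dotpZl mulN1r. Qed.

Lemma dotpBl x y xi : dotp (x - y) xi = dotp x xi - dotp y xi.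
Proof. by rewrite dotpDl dotpNl. Qed.

Lemma dotpZr (a : R) x xi : dotp x (a *: xi) = a * dotp x xi.
Proof. by rewrite dotpC dotpZl dotpC. Qed.

Lemma dotpNr x xi : dotp x (- xi) = - dotp x xi.
Proof. by rewrite dotpC dotpNl dotpC. Qed.

Lemma dotpDr x y xi : dotp xi (x + y) = dotp xi x + dotp xi y.
Proof. by rewrite dotpC dotpDl !(dotpC xi). Qed.

Lemma dotp0l x : dotp 0 x = 0.
Proof. by apply: big1 => i _; rewrite mxE mul0r. Qed.

Lemma continuous_dotp xi : continuous (dotp^~ xi).
Proof.
rewrite /dotp; apply: continuous_big => [|i _ x]; first exact: add_continuous.
exact: (cvgM (@coord_continuous R 1 n ord0 i x) (cvg_cst _)).
Qed.

Lemma ccontinuous_expi (h : 'rV[R]_n -> R) : continuous h ->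
  ccontinuous (fun x => expi (h x)).
Proof.
move=> ch; split => x /=.
- exact: (continuous_comp (ch x) (@continuous_cos R (h x))).
- exact: (continuous_comp (ch x) (@continuous_sin R (h x))).
Qed.

Lemma Cmeasurable_char xi : Cmeasurable (fun x => expi (dotp x xi)).
Proof. exact/ccontinuous_Cmeasurable/ccontinuous_expi/continuous_dotp. Qed.

Lemma fourierE f xi : fourier f xi = Cint mu (fun x => f x * expi (- dotp x xi)).
Proof. by []. Qed.

Lemma Cintegrable_fourier f xi : Cintegrable mu f ->
  Cintegrable mu (fun x => f x * expi (- dotp x xi)).
Proof.
move=> fi; apply: (CintegrableMr (M := 1)) => //.
  by under eq_fun do rewrite -dotpNr; exact: Cmeasurable_char.
by move=> x; rewrite normc_expi.
Qed.

Lemma conv_char f x xi : Cintegrable mu f ->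
  convolution (fun x => expi (dotp x xi)) f x = expi (dotp x xi) * fourier f xi.
Proof.
move=> fi; rewrite convolutionE fourierE -CintZ; last exact: Cintegrable_fourier.
by apply: eq_Cint => y; rewrite dotpBl expiD mulrAC mulrA.
Qed.

(** A character is an eigenfunction of convolution, with the transform as eigenvalue ([conv_char]).
    Associativity applied to a character and evaluated at 0 gives the product. *)
Lemma fourier_conv f g xi : tame f -> Cintegrable mu g ->
  fourier (convolution f g) xi = fourier f xi * fourier g xi.
Proof.
move=> tf gi; have fi := tame_integrable tf.
have mc := Cmeasurable_char xi; have cM x : normc (expi (dotp x xi)) <= 1.
  by rewrite normc_expi.
have := convolutionA mc cM fi gi (fun x => tame_conv_integrable x tf gi).
move=> /(congr1 (fun F => F 0)); rewrite conv_char; last exact: Cintegrable_conv.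
rewrite dotp0l expi0 mul1r => <-; rewrite [RHS]mulrC.
transitivity (Cint mu (fun y => fourier f xi * (expi (- dotp y xi) * g y))).
  by apply: eq_Cint => y; rewrite conv_char// sub0r dotpNl; ring.
have -> : (fun y => fourier f xi * (expi (- dotp y xi) * g y)) =
    (fun y => fourier f xi * (g y * expi (- dotp y xi))).
  by apply/funext => y; ring.
by rewrite CintZ; [rewrite mulrC|exact: Cintegrable_fourier].
Qed.

Lemma fourier_dilate e f xi : 0 < e -> Cintegrable mu f ->
  fourier (dilate e f) xi = fourier f (e *: xi).
Proof.
move=> e0 fi; rewrite !fourierE -(Cint_dilate e0 (Cintegrable_fourier (e *: xi) fi)).
apply: eq_Cint => x; rewrite /dilate mulrA dotpZl dotpZr mulrA mulVf ?mul1r//.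
by rewrite gt_eqF.
Qed.

Lemma fourierB f g xi : Cintegrable mu f -> Cintegrable mu g ->
  fourier (fun x => f x - g x) xi = fourier f xi - fourier g xi.
Proof.
move=> fi gi; rewrite !fourierE -CintB; [|exact: Cintegrable_fourier..].
by apply: eq_Cint => x; rewrite mulrBl.
Qed.

Lemma fourier0 f : fourier f 0 = Cint mu f.
Proof. by apply: eq_Cint => x; rewrite dotpC dotp0l oppr0 expi0 mulr1. Qed.

Lemma normc_fourier f xi : Cintegrable mu f -> normc (fourier f xi) <= N1 f.
Proof.
move=> fi; rewrite (le_trans (normc_Cint (Cintegrable_fourier xi fi)))//.
by rewrite le_eqVlt; apply/orP; left; apply/eqP; apply: eq_Rintegral => x _;
  rewrite normcM normc_expi mulr1.
Qed.

Lemma ccontinuous_fourier f : Cintegrable mu f -> ccontinuous (fourier f).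
Proof.
move=> fi; apply: ccontinuous_seq => p u up; rewrite !fourierE.
apply: (dominated_cvg_Cint (g := fun x => normc (f x))).
- by move=> k; exact: Cintegrable_meas (Cintegrable_fourier (u k) fi).
- exact: Cintegrable_meas (Cintegrable_fourier p fi).
- exact: integrable_normc.
- by move=> k x; rewrite normcM normc_expi mulr1.
- by move=> x; rewrite normcM normc_expi mulr1.
- move=> x; rewrite (_ : (fun k => normc _) = fun k => normc (f x) *
      normc (expi (- dotp x (u k)) - expi (- dotp x p))); last first.
    by apply/funext => k; rewrite -mulrBr normcM.
  apply: cvg0Ml.
  apply: (ccontinuous_cvg (f := fun xi => expi (- dotp x xi)) _ up).
  rewrite (_ : (fun xi => _) = fun xi => expi (dotp xi (- x))).
    exact/ccontinuous_expi/continuous_dotp.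
  by apply/funext => xi; rewrite dotpNr dotpC.
Qed.

Lemma multiplication_formula f g : Cintegrable mu f -> Cintegrable mu g ->
  Cint mu (fun x => fourier f x * g x) = Cint mu (fun x => f x * fourier g x).
Proof.
move=> fi gi.
have Fi : Cintegrable (mu \x mu)%E
    (fun z => expi (- dotp z.1 z.2) * (f z.1 * g z.2)).
  apply: (CintegrableMl (M := 1) _ _ (Cintegrable_prod fi gi)); last first.
    by move=> z; rewrite normc_expi.
  apply: Cmeasurable_expi; apply: measurable_funN; apply: measurable_sum => i.
  by apply: measurable_funM; apply: (measurableT_comp (measurable_coord i)).
transitivity (Cint mu (fun y => Cint mu (fun x =>
    expi (- dotp x y) * (f x * g y)))).
  apply: eq_Cint => y; rewrite fourierE -CintZr; last exact: Cintegrable_fourier.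
  by apply: eq_Cint => x; ring.
rewrite -(@Cfubini _ _ _ _ _ mu mu (fun x y => expi (- dotp x y) * (f x * g y)))//.
apply: eq_Cint => x; rewrite fourierE -CintZ; last exact: Cintegrable_fourier.
by apply: eq_Cint => y; rewrite dotpC; ring.
Qed.

End fourier_theory.

(** * Fourier inversion *)

Section oneDsqr_integral.
Context {R : realType}.
Local Notation mu := (@lebesgue_measure R).

Lemma measurable_oneDsqrV : measurable_fun setT (fun x : R => (oneDsqr x)^-1).
Proof. exact: continuous_measurable_fun continuous_oneDsqrV. Qed.

Lemma integrable_oneDsqrV :
  mu.-integrable setT (EFin \o (fun x : R => (oneDsqr x)^-1)).
Proof.
have mE : measurable_fun setT (fun x : R => (oneDsqr x)^-1%:E).
  apply/measurable_EFinP; exact: measurable_oneDsqrV.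
have h0 (x : R) : 0 <= (oneDsqr x)^-1 by rewrite invr_ge0 (le_trans _ (oneDsqr_ge1 x)).
have he0 (x : R) : (0 <= (oneDsqr x)^-1%:E)%E by rewrite lee_fin.
apply/integrableP; split => //.
under eq_integral do rewrite /= ger0_norm//.
have E : setT = `]-oo, 0%R] `|` `]0%R, +oo[ :> set R.
  by apply/seteqP; split => // x _; rewrite /= !in_itv/= andbT; case: (leP x 0); [left|right].
rewrite E ge0_integral_setU//; last 2 first.
- exact: measurable_funS mE.
- rewrite disj_set2E; apply/eqP/seteqP; split => // x [] /=.
  by rewrite !in_itv/= andbT leNgt => /negP.
have I2 := integral0y_oneDsqr R.
have I1 := ge0_integration_by_substitution0 mE he0.
rewrite I2 in I1.
apply: lte_add_pinfty.
  apply: (@le_lt_trans _ _ (pi / 2)%:E); last exact: ltry.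
  rewrite I1 le_eqVlt; apply/orP; left; apply/eqP; apply: eq_integral => r _.
  by rewrite /oneDsqr sqrrN.
apply: (@le_lt_trans _ _ (\int[mu]_(x in `[0%R, +oo[) (oneDsqr x)^-1%:E)%E).
  apply: ge0_subset_integral => //.
  - exact: measurable_funS mE.
  - by apply: subset_itvr; rewrite bnd_simp.
by rewrite I2 ltry.
Qed.

End oneDsqr_integral.

(** * The triangle function and its transform, the Fejer kernel *)

Section triangle_kernel.
Context {R : realType}.
Local Notation mu := (@lebesgue_measure R).

(** Chosen as summability factor because its transform is elementary, nonnegative and O(1/x^2),
    hence integrable. *)
Definition triangle (t : R) : R := Num.max 0 (1 - `|t|).

Lemma triangle_ge0 t : 0 <= triangle t.
Proof. by rewrite /triangle le_max lexx. Qed.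

Lemma triangle_le1 t : triangle t <= 1.
Proof. by rewrite /triangle ge_max ler01 gerBl normr_ge0. Qed.

Lemma triangle0 : triangle 0 = 1.
Proof. by rewrite /triangle normr0 subr0 max_r. Qed.

Lemma continuous_triangle : continuous triangle.
Proof.
move=> t; apply: (@continuous_max R _ (cst 0 : R -> R^o)
  (fun t : R => (1 - `|t|) : R^o) t); first exact: cvg_cst.
by apply: cvgB; [exact: cvg_cst|exact: norm_continuous].
Qed.

Let within_integrable (h : R -> R) (a b : R) : continuous h ->
  mu.-integrable `[a, b] (EFin \o h).
Proof.
move=> ch; apply: continuous_compact_integrable; first exact: segment_compact.
exact: continuous_subspaceT.
Qed.

Lemma triangleE t : triangle t =
  ((fun t => 1 + t) \_ (`[-1, 0] : set R)) t + ((fun t => 1 - t) \_ (`]0, 1] : set R)) t.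
Proof.
rewrite !patchE !mem_setE !in_itv/= /triangle.
have [t0|t0] := leP t 0.
  rewrite andbT addr0 ler0_norm// opprK.
  by case: (leP (-1) t) => t1; [rewrite max_r//; lra|rewrite max_l//; lra].
rewrite andbF add0r gtr0_norm//=.
by case: (leP t 1) => t1; [rewrite max_r//; lra|rewrite max_l//; lra].
Qed.

Lemma triangle_mul_int (h : R -> R) : continuous h ->
  mu.-integrable setT (EFin \o (fun t => triangle t * h t)) /\
  \int[mu]_t (triangle t * h t) =
  \int[mu]_(t in `[-1, 0]) ((1 + t) * h t) +
  \int[mu]_(t in `[0, 1]) ((1 - t) * h t).
Proof.
move=> ch; pose h1 t := (1 + t) * h t; pose h2 t := (1 - t) * h t.
have i1 : mu.-integrable `[-1, 0] (EFin \o h1).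
  apply: within_integrable => t; apply: cvgM; last exact: ch.
  by apply: cvgD; [exact: cvg_cst|exact: cvg_id].
have i2 : mu.-integrable `[0, 1] (EFin \o h2).
  apply: within_integrable => t; apply: cvgM; last exact: ch.
  by apply: cvgB; [exact: cvg_cst|exact: cvg_id].
have i3 : mu.-integrable `]0, 1] (EFin \o h2).
  apply: integrableS i2 => //.
  by apply: subset_itvr; rewrite bnd_simp.
have E t : triangle t * h t = (h1 \_ `[-1, 0]) t + (h2 \_ `]0, 1]) t.
  rewrite triangleE !patchE mulrDl.
  by congr (_ + _); case: ifP => _; rewrite ?mul0r.
have j1 : mu.-integrable setT (EFin \o (h1 \_ `[-1, 0])).
  by rewrite -restrict_EFin; apply: (integrable_mkcond _ _).1.
have j2 : mu.-integrable setT (EFin \o (h2 \_ `]0, 1])).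
  by rewrite -restrict_EFin; apply: (integrable_mkcond _ _).1.
split; first by under eq_fun do rewrite E; exact: integrableDR.
under eq_Rintegral do rewrite E.
rewrite RintegralD// -!Rintegral_mkcond; congr (_ + _).
exact: Rintegral_itv_obnd_cbnd.
Qed.

Section trig.
Variables f g : R -> R.
Hypothesis df : forall x, is_derive x (1 : R) f (g x).
Hypothesis dg : forall x, is_derive x (1 : R) g (- f x).

Let cg : continuous g.
Proof.
move=> t; apply/differentiable_continuous/derivable1_diffP.
by have [] := dg t.
Qed.

Let cgx x : continuous (fun t : R => g (x * t)).
Proof.
by move=> t; apply: (@continuous_comp _ _ _ ( *%R x) g);
  [exact: mulrl_continuous|exact: cg].
Qed.

Let triangle_half (c a x : R) : c ^+ 2 = 1 -> x != 0 ->
  \int[mu]_(t in `[a, a + 1]) ((1 + c * t) * g (x * t)) =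
  ((1 + c * (a + 1)) * f (x * (a + 1)) / x + c * g (x * (a + 1)) / x ^+ 2)
  - ((1 + c * a) * f (x * a) / x + c * g (x * a) / x ^+ 2).
Proof.
move=> c1 x0.
(* One integration by parts: [f (x t) / x] is a primitive of [g (x t)], and [- g (x t) / x] one of
   [f (x t)]. *)
pose F : R -> R := x^-1 \*: ((cst 1 + c \*: id) * (f \o (x \*: id)))
  + (c * x^-1 ^+ 2) \*: (g \o (x \*: id)).
have dF t : is_derive t (1 : R) F ((1 + c * t) * g (x * t)).
  rewrite /F; apply: is_derive_eq => /=.
  rewrite -[LHS]/(x^-1 * ((1 + c * t) * (g (x * t) * (x * 1)) +
    f (x * t) * (0 + c * 1)) + (c * x^-1 ^+ 2) * (- f (x * t) * (x * 1))).
  by field.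
have cF : continuous F.
  by move=> t; apply/differentiable_continuous/derivable1_diffP; apply: ex_derive.
have Fv t : F t = (1 + c * t) * f (x * t) / x + c * g (x * t) / x ^+ 2.
  rewrite /F/= exprVn -[LHS]/(x^-1 * ((1 + c * t) * f (x * t)) + (c / x ^+ 2) * g (x * t)).
  by rewrite mulrC; congr (_ + _); rewrite mulrAC.
rewrite /Rintegral (@continuous_FTC2 _ _ F)//=.
- by rewrite !Fv.
- by rewrite ltrDl.
- apply: continuous_subspaceT => t; apply: cvgM; last exact: cgx.
  by apply: cvgD; [exact: cvg_cst|exact: mulrl_continuous].
- split.
  + by move=> t _; apply: ex_derive.
  + by apply: cvg_at_right_filter; exact: cF.
  + by apply: cvg_at_left_filter; exact: cF.
- by move=> t _; rewrite derive1E; exact: derive_val.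
Qed.

(** Stated for any pair with f' = g and g' = - f, so as to cover (sin, cos) and (- cos, sin). The
    boundary terms in [f] vanish at the ends and cancel at 0. *)
Lemma triangle_trig x : x != 0 ->
  \int[mu]_t (triangle t * g (x * t)) = (2 * g 0 - g x - g (- x)) / x ^+ 2.
Proof.
move=> x0; have [_ ->] := triangle_mul_int (@cgx x).
have := triangle_half (-1) (expr1n _ 2) x0; rewrite addNr => E1.
have := triangle_half 0 (etrans (sqrrN 1) (expr1n _ 2)) x0; rewrite add0r => E2.
under [X in X + _ = _]eq_Rintegral do rewrite -[X in 1 + X]mul1r.
under [X in _ + X = _]eq_Rintegral do rewrite -[X in 1 + X]mulN1r.
by rewrite E1 E2 !mulr0 !mulrN1 !mulr1; field.
Qed.

End trig.

Lemma triangle_cos x : x != 0 ->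
  \int[mu]_t (triangle t * cos (x * t)) = 2 * (1 - cos x) / x ^+ 2.
Proof.
move=> x0; rewrite (@triangle_trig sin cos)// cosN cos0; first by field.
Qed.

Lemma triangle_sin x : \int[mu]_t (triangle t * sin (x * t)) = 0.
Proof.
have [->|x0] := eqVneq x 0.
  under eq_Rintegral do rewrite mul0r sin0 mulr0.
  by rewrite /Rintegral integral0.
have d1 (y : R) : is_derive y (1 : R) (- cos) (sin y).
  by apply: is_derive_eq; rewrite opprK.
have d2 (y : R) : is_derive y (1 : R) sin (- (- cos) y).
  by apply: is_derive_eq; rewrite /= opprK.
by rewrite (triangle_trig d1 d2 x0) sinN sin0; field.
Qed.

Definition fejer (x : R) : R := \int[mu]_t (triangle t * cos (x * t)).

Lemma integrable_triangle_mul (h : R -> R) : continuous h ->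
  mu.-integrable setT (EFin \o (fun t => triangle t * h t)).
Proof. by move=> /triangle_mul_int[]. Qed.

Lemma integrable_triangle : mu.-integrable setT (EFin \o triangle).
Proof.
have := integrable_triangle_mul (fun=> @cst_continuous R R 1 _).
by under eq_fun do rewrite mulr1.
Qed.

Let ccos (x : R) : continuous (fun t : R => cos (x * t)).
Proof.
by move=> t; apply: (@continuous_comp _ _ _ ( *%R x) cos);
  [exact: mulrl_continuous|exact: continuous_cos].
Qed.

(** The constant adds two bounds: the integral of the triangle bounds [fejer x], and 4 bounds
    [x ^+ 2 * fejer x] by the closed form [triangle_cos]. *)
Lemma fejer_bound : exists C, forall x, `|fejer x| <= C * (oneDsqr x)^-1.
Proof.
pose B := \int[mu]_t (triangle t).
have hB x : `|fejer x| <= B.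
  rewrite (le_trans (le_normr_Rintegral _ (integrable_triangle_mul (@ccos x))))//.
  apply: le_Rintegral => //; first exact: integrable_norm (integrable_triangle_mul (@ccos x)).
    exact: integrable_triangle.
  move=> t _; rewrite normrM (ger0_norm (triangle_ge0 t)) ler_piMr ?triangle_ge0//.
  by rewrite ler_norml cos_geN1 cos_le1.
exists (B + 4) => x; rewrite ler_pdivlMr ?(lt_le_trans _ (oneDsqr_ge1 x))//.
rewrite /oneDsqr mulrDr mulr1 lerD//.
have [->|x0] := eqVneq x 0; first by rewrite expr0n/= mulr0.
rewrite /fejer triangle_cos// normrM normfV (ger0_norm (sqr_ge0 x)) divfK ?sqrf_eq0//.
rewrite ger0_norm; first by have := cos_geN1 x; lra.
by have := cos_le1 x; lra.
Qed.

Lemma fejer_gt0 x : 0 < x <= 1 -> 0 < fejer x.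
Proof.
move=> /andP[x0 x1]; rewrite /fejer triangle_cos ?gt_eqF// divr_gt0 ?exprn_gt0//.
rewrite mulr_gt0// subr_gt0 -cos0; have := pi_ge2 R => pi2.
by rewrite ltr_cos// in_itv/=; lra.
Qed.

Lemma fejer_ge0 x : 0 <= fejer x.
Proof.
have [->|x0] := eqVneq x 0.
  apply: Rintegral_ge0 => t _.
  by rewrite mul0r cos0 mulr1 triangle_ge0.
rewrite /fejer triangle_cos// divr_ge0 ?sqr_ge0//.
Qed.

Lemma measurable_fejer : measurable_fun setT fejer.
Proof.
apply: (measurable_Rintegral mu (F := fun z : measurableTypeR R * measurableTypeR R =>
  triangle z.2 * cos (z.1 * z.2))).
apply: measurable_funM.
  apply: (measurableT_comp (continuous_measurable_fun continuous_triangle)) => //.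
apply: (measurableT_comp (continuous_measurable_fun (@continuous_cos R))).
exact: measurable_funM.
Qed.

Lemma integrable_fejer : mu.-integrable setT (EFin \o fejer).
Proof.
have [C hC] := fejer_bound.
exact: (le_integrableR (T := measurableTypeR R) measurable_fejer (integrableZR C integrable_oneDsqrV) hC).
Qed.

(** A zero integral would make the nonnegative [fejer] vanish almost everywhere, whereas it is
    positive on []0, 1]]. *)
Lemma fejer_int_gt0 : 0 < \int[mu]_x fejer x.
Proof.
rewrite lt_def Rintegral_ge0 ?andbT// => [|x _]; last exact: fejer_ge0.
apply/eqP => I0.
have mf : measurable_fun [set: measurableTypeR R] (EFin \o fejer).
  apply/measurable_EFinP; exact: measurable_fejer.
have : ae_eq mu setT (EFin \o fejer) (cst 0%E).
  apply/(ae_eq_integral_abs mu measurableT mf).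
  rewrite -[RHS]/(0%:E) -I0 EFin_Rintegral; last exact: integrable_fejer.
  by apply: eq_integral => x _ /=; rewrite ger0_norm// fejer_ge0.
move=> [N [mN N0 hN]].
have : (mu `]0%R, 1%R]%classic <= mu N)%E.
  apply: le_measure; rewrite ?inE//.
  move=> x; rewrite /= in_itv/= => x01; apply: hN => /= /(_ Logic.I) [] /eqP.
  by rewrite gt_eqF// fejer_gt0.
by rewrite N0 lebesgue_measure_itv/= lte_fin ltr01 oppr0 adde0 lee_fin ler10.
Qed.

End triangle_kernel.

(** * The inversion formula and the injectivity of the transform *)

Section inversion.
Local Open Scope complex_scope.
Context {R : realType} {n : nat}.
Local Notation mu := (lebesgue_rV n).
Implicit Types (x y xi : 'rV[R]_n) (f g : 'rV[R]_n -> R[i]).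

Definition ntriangle xi : R[i] := (\prod_(i < n) triangle (xi ord0 i))%:C.

Definition nfejer x : R[i] := (\prod_(i < n) fejer (x ord0 i))%:C.

Lemma normc_ntriangle xi : normc (ntriangle xi) <= 1.
Proof.
rewrite normcR ger0_norm; last by apply: prodr_ge0 => i _; exact: triangle_ge0.
apply: (@le_trans _ _ (\prod_(i < n) (1 : R))); last by rewrite big1.
by apply: ler_prod => i _; rewrite triangle_ge0 triangle_le1.
Qed.

Lemma ntriangle0 : ntriangle 0 = 1.
Proof.
by rewrite /ntriangle big1// => i _; rewrite mxE triangle0.
Qed.

Lemma ntriangleE : ntriangle = fun xi => \prod_(i < n) (triangle (xi ord0 i))%:C.
Proof. by apply/funext => xi; exact: rmorph_prod. Qed.

Lemma nfejerE : nfejer = fun x => \prod_(i < n) (fejer (x ord0 i))%:C.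
Proof. by apply/funext => x; exact: rmorph_prod. Qed.

Lemma ccontinuous_ntriangle : ccontinuous ntriangle.
Proof.
split => /=; last by move=> x; exact: cst_continuous.
apply: continuous_big => [|i _ x]; first exact: mul_continuous.
apply: (continuous_comp (@coord_continuous R 1 n ord0 i x)).
exact: continuous_triangle.
Qed.

Let triangle_C_integrable :
  Cintegrable (@lebesgue_measure R) (fun t => (triangle t)%:C).
Proof. exact/CintegrableR/integrable_triangle. Qed.

Lemma Cintegrable_ntriangle : Cintegrable mu ntriangle.
Proof.
rewrite ntriangleE.
by have [] := Cint_tensor (n := n) (fun=> triangle_C_integrable).
Qed.

Lemma expi_sum (I : Type) (r : seq I) (F : I -> R) :
  expi (\sum_(i <- r) F i) = \prod_(i <- r) expi (F i).
Proof.
elim: r => [|i r IH]; first by rewrite !big_nil expi0.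
by rewrite !big_cons expiD IH.
Qed.

Lemma fourier_triangle (a : R) :
  Cintegrable (@lebesgue_measure R) (fun t => (triangle t)%:C * expi (- (t * a))) /\
  Cint (@lebesgue_measure R) (fun t => (triangle t)%:C * expi (- (t * a))) =
  (fejer a)%:C.
Proof.
have E t : (triangle t)%:C * expi (- (t * a)) =
    (triangle t * cos (a * t)) +i* (triangle t * (- sin (a * t))).
  by apply: complex_eqP; rewrite ?ReM ?ImM/= ?mul0r ?subr0 ?addr0 ?cosN ?sinN mulrC// [t * a]mulrC mulrC.
have c1 : continuous (fun t : R => cos (a * t)).
  move=> t; apply: (@continuous_comp _ _ _ ( *%R a) cos).
    exact: mulrl_continuous.
  exact: continuous_cos.
have c2 : continuous (fun t : R => - sin (a * t)).
  move=> t; apply: cvgN; apply: (@continuous_comp _ _ _ ( *%R a) sin).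
    exact: mulrl_continuous.
  exact: continuous_sin.
have i1 := integrable_triangle_mul c1; have i2 := integrable_triangle_mul c2.
under eq_fun do rewrite E.
split; first by split.
rewrite /Cint/=; congr (_ +i* _).
under eq_Rintegral do rewrite mulrN -mulN1r.
rewrite RintegralZl// ?triangle_sin ?mulr0//.
have := integrableZR (-1) i2.
by under eq_fun do rewrite mulrN mulN1r opprK.
Qed.

Lemma fourier_ntriangle x : fourier ntriangle x = nfejer x.
Proof.
have [_] := Cint_tensor (n := n) (fun i => (fourier_triangle (x ord0 i)).1).
under [RHS]eq_bigr do rewrite (fourier_triangle _).2.
rewrite nfejerE => <-; apply: eq_Cint => xi.
by rewrite ntriangleE big_split/= -expi_sum sumrN.
Qed.

Lemma nfejer_int : Cintegrable mu nfejer /\ Cint mu nfejer != 0.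
Proof.
have fi : Cintegrable (@lebesgue_measure R) (fun t => (fejer t)%:C).
  exact/CintegrableR/integrable_fejer.
rewrite nfejerE; have [h1 h2] := Cint_tensor (n := n) (fun=> fi).
split => //; rewrite h2 prodf_seq_neq0.
apply/allP => i _; rewrite CintR -(rmorph0 (real_complex R)).
by rewrite (inj_eq (@complexI R)) gt_eqF// fejer_int_gt0.
Qed.

Lemma fourier_ntriangle_scaled (e : R) y z : 0 < e ->
  fourier (fun xi => expi (dotp y xi) * ntriangle (e *: xi)) z =
  (e ^- n)%:C * nfejer (e^-1 *: (z - y)).
Proof.
move=> e0; rewrite -fourier_ntriangle !fourierE.
rewrite -[X in (X ^- n)%:C](gtr0_norm e0) -Cint_scale ?gt_eqF//; last first.
  exact: Cintegrable_fourier Cintegrable_ntriangle.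
apply: eq_Cint => xi; rewrite dotpZl dotpZr mulrA mulfV ?gt_eqF// mul1r.
by rewrite mulrAC -expiD mulrC (dotpC _ (z - y)) dotpBl opprB (dotpC z).
Qed.

(** The multiplication formula moves the transform from [g] to the modulated triangle, whose
    transform is a Fejer kernel of width [e] centred at [y]; the rest is a change of variables. *)
Let summing_formula (g : 'rV[R]_n -> R[i]) y (e : R) : 0 < e -> tame g ->
  Cint mu (fun xi => fourier g xi * (expi (dotp y xi) * ntriangle (e *: xi))) =
  Cint mu (fun w => g (e *: w + y) * nfejer w).
Proof.
move=> e0 [cg gi [M gM]]; have e1 : e != 0 by rewrite gt_eqF.
have [Pi _] := nfejer_int; have mg := ccontinuous_Cmeasurable cg.
rewrite multiplication_formula//; last first.
  apply: (CintegrableMl (M := 1)).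
  - by under eq_fun do rewrite dotpC; exact: Cmeasurable_char.
  - by move=> xi; rewrite normc_expi.
  - exact: Cintegrable_scale Cintegrable_ntriangle.
under eq_Cint do rewrite fourier_ntriangle_scaled//.
have Fi : Cintegrable mu (fun z => g z * ((e ^- n)%:C * nfejer (e^-1 *: (z - y)))).
  apply: (CintegrableMl (M := M)) => //; apply: CintegrableZ.
  have := Cintegrable_affine (- (e^-1 *: y)) (invr_neq0 e1) Pi.
  by under eq_fun do rewrite -scalerBr.
have := Cint_affine y e1 Fi; rewrite (gtr0_norm e0) => E.
apply: (mulfI (x := (e ^- n)%:C)).
  by rewrite -(rmorph0 (real_complex R)) (inj_eq (@complexI R)) invr_eq0 expf_neq0.
rewrite -E -CintZ; last first.
  apply: (CintegrableMl (M := M)) => //.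
  exact: (Cmeasurable_comp mg (measurable_rV_affine e y)).
by apply: eq_Cint => w; rewrite addrK scalerA mulVf// scale1r; ring.
Qed.

Lemma normc_cvg_unique (u : nat -> R[i]) (a b : R[i]) :
  normc (u k - a) @[k --> \oo] --> (0 : R) ->
  normc (u k - b) @[k --> \oo] --> (0 : R) -> a = b.
Proof.
move=> /normc_cvg[a1 a2] /normc_cvg[b1 b2]; apply: complex_eqP.
- exact: (cvg_unique _ a1 b1).
- exact: (cvg_unique _ a2 b2).
Qed.

(** Both sides are the limit of [summing_formula] as [e] tends to 0, the frequency side being
    dominated by the transform of [g] and the space side by [M] times the Fejer kernel. The usual
    power of 2 pi appears as the integral of [nfejer]. *)
Theorem fourier_inversion g y : tame g -> Cintegrable mu (fourier g) ->
  Cint mu (fun xi => fourier g xi * expi (dotp y xi)) = g y * Cint mu nfejer.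
Proof.
move=> tg Gi; have [cg gi [M gM]] := tg; have [Pi _] := nfejer_int.
have mg := tame_meas tg.
pose e k : R := k.+1%:R^-1; have e0 k : 0 < e k by rewrite invr_gt0.
have ecvg : e k @[k --> \oo] --> (0 : R).
  apply/cvgrPdist_lt => d d0; near=> k.
  rewrite sub0r normrN gtr0_norm//; near: k.
  exact: (@near_infty_natSinv_lt R (PosNum d0)).
have escale (w : 'rV[R]_n) : e k *: w @[k --> \oo] --> (0 : 'rV[R]_n).
  by rewrite -[X in _ --> X](scale0r w); apply: cvgZ => //; exact: cvg_cst.
have mexp : Cmeasurable (fun xi : 'rV[R]_n => expi (dotp y xi)).
  by under eq_fun do rewrite dotpC; exact: Cmeasurable_char.
have mG := Cintegrable_meas Gi.
apply: (normc_cvg_unique (u := fun k => Cint mu (fun xi => fourier g xi *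
    (expi (dotp y xi) * ntriangle (e k *: xi))))).
  apply: (dominated_cvg_Cint (g := fun xi => normc (fourier g xi))).
  - move=> k; apply: CmeasurableM => //; apply: CmeasurableM => //.
    have e1 : e k != 0 by rewrite gt_eqF.
    exact: Cintegrable_meas (Cintegrable_scale e1 Cintegrable_ntriangle).
  - exact: CmeasurableM.
  - exact: integrable_normc.
  - move=> k xi; rewrite !normcM normc_expi mul1r ler_piMr ?normc_ge0//.
    exact: normc_ntriangle.
  - by move=> xi; rewrite normcM normc_expi mulr1.
  - move=> xi; rewrite (_ : (fun k => _) = fun k => normc (fourier g xi) *
        normc (ntriangle (e k *: xi) - ntriangle 0)); last first.
      apply/funext => k; rewrite -mulrBr normcM ntriangle0; congr (_ * _).
      by rewrite -[X in normc (_ - X)]mulr1 -mulrBr normcM normc_expi mul1r.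
    by apply: cvg0Ml; exact: (ccontinuous_cvg ccontinuous_ntriangle).
rewrite -CintZ//.
under eq_fun do rewrite summing_formula//.
apply: (dominated_cvg_Cint (g := fun w => M * normc (nfejer w))).
- move=> k; apply: CmeasurableM; last exact: Cintegrable_meas Pi.
  exact: (Cmeasurable_comp mg (measurable_rV_affine (e k) y)).
- by apply: CmeasurableM; [exact: Cmeasurable_cst|exact: Cintegrable_meas Pi].
- exact/integrableZR/integrable_normc.
- by move=> k w; rewrite normcM ler_wpM2r ?normc_ge0.
- by move=> w; rewrite normcM ler_wpM2r ?normc_ge0.
- move=> w; rewrite (_ : (fun k => _) = fun k => normc (nfejer w) *
      normc (g (e k *: w + y) - g y)); last first.
    by apply/funext => k; rewrite -mulrBl normcM mulrC.
  apply: cvg0Ml; apply: (ccontinuous_cvg cg).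
  by rewrite -[X in _ --> X]add0r; apply: cvgD => //; exact: cvg_cst.
Unshelve. all: by end_near. Qed.

Corollary fourier_inj g : tame g -> (forall xi, fourier g xi = 0) ->
  forall y, g y = 0.
Proof.
move=> tg g0 y; have E : fourier g = fun=> 0 by apply/funext.
have Gi : Cintegrable mu (fourier g).
  by rewrite E; split => /=; exact: integrable0.
have := fourier_inversion y tg Gi; rewrite E.
under eq_Cint do rewrite mul0r.
rewrite {1}/Cint/= /Rintegral integral0/= => /esym/eqP.
by rewrite mulf_eq0 (negbTE nfejer_int.2) orbF => /eqP.
Qed.

Corollary fourier_eq f g : tame f -> tame g -> fourier f =1 fourier g -> f = g.
Proof.
move=> tf tg fg; apply/funext => x; apply/eqP; rewrite -subr_eq0; apply/eqP.
apply: (fourier_inj (tameB tf tg)) => xi.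
by rewrite fourierB ?fg ?subrr//; exact: tame_integrable.
Qed.

End inversion.

(** * Rapid decay *)

Section weight.
Local Open Scope complex_scope.
Context {R : realType} {n : nat}.
Local Notation mu := (lebesgue_rV n).
Implicit Types (x y h : 'rV[R]_n) (f g : 'rV[R]_n -> R[i]).

(** An integrable majorant for functions of rapid decay; the product form reduces its integrability
    to dimension one. *)
Definition weight x : R := \prod_(i < n) (oneDsqr (x ord0 i))^-1.

Lemma oneDsqr_gt0 (a : R) : 0 < oneDsqr a.
Proof. by rewrite (lt_le_trans _ (oneDsqr_ge1 a)). Qed.

Lemma weight_gt0 x : 0 < weight x.
Proof. by apply: prodr_gt0 => i _; rewrite invr_gt0 oneDsqr_gt0. Qed.

Lemma weight_le1 x : weight x <= 1.
Proof.
apply: (@le_trans _ _ (\prod_(i < n) (1 : R))); last by rewrite big1.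
by apply: ler_prod => i _; rewrite invr_ge0 ltW ?oneDsqr_gt0//= oneDsqrV_le1.
Qed.

Lemma integrable_weight : mu.-integrable setT (EFin \o weight).
Proof.
have wi : Cintegrable (@lebesgue_measure R) (fun t => ((oneDsqr t)^-1)%:C).
  exact/CintegrableR/integrable_oneDsqrV.
have [[+ _] _] := Cint_tensor (n := n) (fun=> wi).
rewrite (_ : (fun x => _) = EFin \o weight)//.
apply/funext => x /=; congr EFin.
by rewrite -(rmorph_prod (real_complex R)).
Qed.

Lemma oneDsqr_shift (a b : R) : `|b| <= 1 -> oneDsqr a <= 4 * oneDsqr (a + b).
Proof.
rewrite ler_norml => /andP[b1 b2]; rewrite /oneDsqr.
have b3 : b ^+ 2 <= 1 by nra.
(* The difference of the two sides is [(3 * a + 4 * b) ^+ 2 / 3 + 3 - 4 * b ^+ 2 / 3]. *)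
by have := sqr_ge0 (3 * a + 4 * b); nra.
Qed.

(** One integrable function thus dominates all small translates of a decaying function. *)
Lemma weight_shift x h : `|h| <= 1 -> weight (x + h) <= 4 ^+ n * weight x.
Proof.
move=> h1; rewrite /weight -[X in _ ^+ X](card_ord n) -prodr_const -big_split/=.
apply: ler_prod => i _; rewrite invr_ge0 ltW ?oneDsqr_gt0//= mxE.
rewrite -[leLHS]mul1r ler_pdivrMr ?oneDsqr_gt0// mulrAC.
rewrite ler_pdivlMr ?oneDsqr_gt0// mul1r oneDsqr_shift//.
exact: le_trans (coord_le_norm h i) h1.
Qed.

Definition decays f := ccontinuous f /\
  exists C, forall x, normc (f x) <= C * weight x.

Lemma decays_tame f : decays f -> tame f.
Proof.
move=> [cf [C fC]]; split => //.
- apply: le_Cintegrable fC; first exact: ccontinuous_Cmeasurable.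
  exact/integrableZR/integrable_weight.
- exists `|C| => x; rewrite (le_trans (fC x))//.
  rewrite (le_trans (ler_norm _))// normrM ler_piMr//.
  by rewrite gtr0_norm ?weight_gt0// weight_le1.
Qed.

Lemma sqr_enorm x : enorm x ^+ 2 = dotp x x.
Proof.
rewrite /enorm sqr_sqrtr// /dotp sumr_ge0// => i _.
by rewrite -expr2 sqr_ge0.
Qed.

Lemma enorm_ge0 x : 0 <= enorm x.
Proof. exact: sqrtr_ge0. Qed.

Lemma coord_le_enorm x i : `|x ord0 i| <= enorm x.
Proof.
rewrite -(ler_pXn2r (n := 2))// ?nnegrE ?enorm_ge0// sqr_enorm real_normK ?num_real//.
rewrite /dotp (bigD1 i)//= -expr2 lerDl sumr_ge0// => j _.
by rewrite -expr2 sqr_ge0.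
Qed.

Lemma norm_le_enorm x : `|x| <= enorm x.
Proof.
apply/ler_addgt0Pr => e e0; apply/ltW/mx_norm_ltP => [|i].
  by rewrite ltr_wpDl// enorm_ge0.
by rewrite (le_lt_trans (coord_le_enorm x i))// ltrDl.
Qed.

Lemma enorm_le_norm x : enorm x <= Num.sqrt n%:R * `|x|.
Proof.
rewrite -(ler_pXn2r (n := 2))// ?nnegrE ?enorm_ge0 ?mulr_ge0 ?sqrtr_ge0//.
rewrite sqr_enorm exprMn sqr_sqrtr//.
apply: (@le_trans _ _ (\sum_(i < n) `|x| ^+ 2)); last first.
  by rewrite sumr_const card_ord mulr_natl.
apply: ler_sum => i _; rewrite -expr2 -real_normK ?num_real//.
by rewrite lerXn2r ?nnegrE// coord_le_norm.
Qed.

Lemma enormZ (a : R) x : enorm (a *: x) = `|a| * enorm x.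
Proof.
by rewrite /enorm dotpZl dotpZr mulrA -expr2 sqrtrM ?sqr_ge0// sqrtr_sqr.
Qed.

Lemma weightV_le x : (weight x)^-1 <= 2 ^+ n * (1 + enorm x ^+ (2 * n)).
Proof.
rewrite /weight -prodfV; under eq_bigr do rewrite invrK.
apply: (@le_trans _ _ ((1 + enorm x ^+ 2) ^+ n)).
  rewrite -[X in _ ^+ X](card_ord n) -prodr_const; apply: ler_prod => i _.
  rewrite ltW ?oneDsqr_gt0//= /oneDsqr lerD2l -(real_normK (num_real (x ord0 i))).
  by rewrite lerXn2r ?nnegrE ?enorm_ge0// coord_le_enorm.
rewrite exprM; set a := enorm x ^+ 2; have a0 : 0 <= a by exact: sqr_ge0.
have [a1|a1] := leP a 1.
  apply: (@le_trans _ _ (2 ^+ n)).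
    by apply: lerXn2r; rewrite ?nnegrE; lra.
  by rewrite ler_peMr ?exprn_ge0// lerDl exprn_ge0.
apply: (@le_trans _ _ ((2 * a) ^+ n)).
  by apply: lerXn2r; rewrite ?nnegrE; lra.
by rewrite exprMn ler_wpM2l ?exprn_ge0// lerDr.
Qed.

(** The inverse of [weight] grows like the power [2 * n] of the norm, so the Schwartz bounds of
    orders [k] and [k + 2 * n] suffice. *)
Lemma schwartz_bound f (k : nat) : schwartz f ->
  exists C, forall x, enorm x ^+ k * normc (f x) <= C * weight x.
Proof.
move=> [_ fS]; have [M hM] := fS k [::]; have [M' hM'] := fS (k + 2 * n)%N [::].
exists (2 ^+ n * (M + M')) => x.
have w0 := weight_gt0 x; rewrite -ler_pdivrMr//.
have n0 := normc_ge0 (f x); have e0 : 0 <= enorm x ^+ k by rewrite exprn_ge0// enorm_ge0.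
rewrite (le_trans (ler_wpM2l (mulr_ge0 e0 n0) (weightV_le x)))//.
rewrite mulrCA ler_wpM2l ?exprn_ge0// mulrDr mulr1.
by apply: lerD; [exact: hM|rewrite mulrAC -exprD; exact: hM'].
Qed.

Lemma schwartz_ccontinuous f : schwartz f -> ccontinuous f.
Proof. by move=> [/(_ [::])[]]. Qed.

Lemma schwartz_decays f : schwartz f -> decays f.
Proof.
move=> fS; split; first exact: schwartz_ccontinuous.
by have [C hC] := schwartz_bound 0 fS; exists C => x; have := hC x; rewrite expr0 mul1r.
Qed.

Lemma schwartz_tame f : schwartz f -> tame f.
Proof. by move=> /schwartz_decays/decays_tame. Qed.

End weight.

Section translation_continuity.
Local Open Scope complex_scope.
Context {R : realType} {n : nat}.
Local Notation mu := (lebesgue_rV n).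
Implicit Types (x y v : 'rV[R]_n) (f g h : 'rV[R]_n -> R[i]).

Lemma decays_translation f (v : nat -> 'rV[R]_n) : decays f ->
  v k @[k --> \oo] --> (0 : 'rV[R]_n) ->
  N1 (fun x => f (x + v k) - f x) @[k --> \oo] --> (0 : R).
Proof.
(* [weight_shift] wants shifts of norm at most 1. The shifts tend to 0, so replacing the larger ones
   by 0 changes only finitely many terms. *)
wlog v1 : v / forall k, `|v k| <= 1.
  move=> W df v0; pose v' k := if `|v k| <= 1 then v k else 0.
  have vv' : \forall k \near \oo, v k = v' k.
    move/cvgrPdist_le : v0 => /(_ 1 ltr01); apply: filterS => k.
    by rewrite sub0r normrN /v' => ->.
  have v'0 : v' k @[k --> \oo] --> (0 : 'rV[R]_n).
    apply: cvg_trans v0; apply: near_eq_cvg.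
    by apply: filterS vv' => k ->.
  have v'1 k : `|v' k| <= 1 by rewrite /v'; case: ifP => //; rewrite normr0.
  have := W v' v'1 df v'0; apply: cvg_trans; apply: near_eq_cvg.
  by apply: filterS vv' => k ->.
move=> df v0; have [cf [C fC]] := df; have tf := decays_tame df.
have fi := tame_integrable tf; have mf := tame_meas tf.
have C0 : 0 <= C.
  have := le_trans (normc_ge0 _) (fC 0).
  by rewrite pmulr_lge0// weight_gt0.
apply: (dominated_cvg_Rintegral0 (g := fun x => (C * 4 ^+ n + C) * weight x)).
- move=> k; apply: measurable_normc; apply: CmeasurableB => //.
  exact: Cintegrable_meas (Cintegrable_shift (v k) fi).
- exact/integrableZR/integrable_weight.
- move=> k x; rewrite ger0_norm ?normc_ge0// (le_trans (ler_normcB _ _))//.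
  rewrite mulrDl lerD// (le_trans (fC _))// -mulrA ler_wpM2l//.
  exact: weight_shift.
- move=> x; apply: (ccontinuous_cvg cf).
  by rewrite -[X in _ --> X]addr0; apply: cvgD => //; exact: cvg_cst.
Qed.

(** As [g] may be discontinuous, continuity comes from [f]: two values of the convolution differ by
    at most [M] times the L^1 distance between two translates of [f]. *)
Lemma decays_conv_bounded M f g : decays f -> Cmeasurable g ->
  (forall x, normc (g x) <= M) ->
  [/\ ccontinuous (convolution f g), convolution f g = convolution g f &
      forall x, normc (convolution f g x) <= M * N1 f].
Proof.
move=> df mg gM; have tf := decays_tame df; have fi := tame_integrable tf.
have E : convolution f g = convolution g f.
  by apply/esym; exact: convolutionC gM fi.
split => //; last by move=> x; rewrite E; exact: normc_convolution.
apply: ccontinuous_seq => p u up.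
have up0 : u k - p @[k --> \oo] --> (0 : 'rV[R]_n) by apply/subr_cvg0.
have /(cvg0Ml M) := decays_translation df up0.
apply: squeeze_cvgr; last exact: cvg_cst.
apply: nearW => k; apply/andP; split; first exact: normc_ge0.
have I x : Cintegrable mu (fun y => f (x - y) * g y).
  by apply: (CintegrableMr (M := M)) => //; exact: Cintegrable_sub.
rewrite !convolutionE -CintB//.
have fvi : Cintegrable mu (fun x => f (x + (u k - p)) - f x).
  by apply: CintegrableB => //; exact: Cintegrable_shift.
have -> : N1 (fun x => f (x + (u k - p)) - f x) =
    \int[mu]_y normc (f (u k - y) - f (p - y)).
  rewrite -(N1_sub p fvi); apply: eq_Rintegral => y _.
  by have -> : p - y + (u k - p) = u k - y by rewrite addrC addrA subrK.
have I2 : Cintegrable mu (fun y => f (u k - y) - f (p - y)).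
  by apply: CintegrableB; exact: Cintegrable_sub.
rewrite -RintegralZl//; last exact: integrable_normc.
apply: le_normc_Cint.
- by apply: CmeasurableB; exact: Cintegrable_meas (I _).
- exact/integrableZR/integrable_normc.
- by move=> y; rewrite -mulrBl normcM mulrC ler_wpM2r ?normc_ge0.
Qed.

(** The substitution y = e w turns the small parameter into a small shift of [f]. *)
Lemma conv_dilate_sub f h (e : R) x : 0 < e -> tame f -> Cintegrable mu h ->
  convolution f (dilate e h) x = Cint mu (fun w => f (x - e *: w) * h w).
Proof.
move=> e0 tf hi; have e1 : e != 0 by rewrite gt_eqF.
have I := tame_conv_integrable x tf (Cintegrable_dilate e0 hi).
rewrite convolutionE; have := Cint_scale e1 I; rewrite gtr0_norm// => E.
apply: (mulfI (x := (e ^- n)%:C)).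
  by rewrite -(rmorph0 (real_complex R)) (inj_eq (@complexI R)) invr_eq0 expf_neq0.
rewrite -E -CintZ.
  by apply: eq_Cint => w; rewrite /dilate scalerA mulVf// scale1r; ring.
have [_ fi [M fM]] := tf.
apply: (CintegrableMl (M := M)) => //.
apply: (Cmeasurable_comp (tame_meas tf)).
under eq_fun do rewrite addrC -scaleNr.
exact: measurable_rV_affine.
Qed.

(** By Fubini the error is at most the integral of [om k w * normc (h w)], where [om k w] is the L^1
    distance between [f] and its translate by [e k *: w]. It tends to 0 for each [w] and is at most
    [2 * N1 f], so dominated convergence in [w] concludes. *)
Lemma approximate_identity f h (e : nat -> R) : decays f -> Cintegrable mu h ->
  Cint mu h = 1 -> (forall k, 0 < e k) -> e k @[k --> \oo] --> (0 : R) ->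
  N1 (fun x => f x - convolution f (dilate (e k) h) x) @[k --> \oo] --> (0 : R).
Proof.
move=> df hi h1 e0 ecvg; have tf := decays_tame df; have [cf fi [M fM]] := tf.
have mf := tame_meas tf; have mh := Cintegrable_meas hi.
pose om k w := N1 (fun x => f (x - e k *: w) - f x).
pose F k (z : 'rV[R]_n * 'rV[R]_n) := (f (z.1 - e k *: z.2) - f z.1) * h z.2.
have mF k : Cmeasurable (F k).
  apply: CmeasurableM; last exact: (Cmeasurable_comp mh).
  apply: CmeasurableB; last exact: (Cmeasurable_comp mf).
  apply: (Cmeasurable_comp mf); apply: measurable_fun_coordP => i.
  under eq_fun do rewrite !mxE.
  apply: measurable_funB; first exact: (measurableT_comp (measurable_coord i)).
  apply: measurable_funM => //; exact: (measurableT_comp (measurable_coord i)).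
have fvi k w : Cintegrable mu (fun x => f (x - e k *: w) - f x).
  by apply: CintegrableB => //; exact: Cintegrable_shift.
have omM k w : om k w <= 2 * N1 f.
  have fs := Cintegrable_shift (- (e k *: w)) fi.
  rewrite mulrDl mul1r -{1}(N1_shift (- (e k *: w)) fi) -(N1N f).
  exact: N1D fs (CintegrableN fi).
have omE k w : \int[mu]_x normc (F k (x, w)) = om k w * normc (h w).
  rewrite /om /N1 -RintegralZr//; last exact: integrable_normc.
  by apply: eq_Rintegral => x _; rewrite normcM.
have Fi k : Cintegrable (mu \x mu)%E (F k).
  apply: CintegrableP => //.
  apply: (integrable_prod2 (measurable_normc (mF k))
    (integrableZR (2 * N1 f) (integrable_normc hi))) => y.
  have G : Cintegrable mu (fun x => F k (x, y)).
    apply: (CintegrableMr (M := normc (h y))) => //.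
      exact: fvi.
    exact: (Cmeasurable_cst (h y)).
  rewrite (eq_integral (fun x => (normc (F k (x, y)))%:E)) => [|x _]; last first.
    by rewrite ger0_norm ?normc_ge0.
  rewrite -EFin_Rintegral; last exact: integrable_normc.
  by rewrite omE lee_fin ler_wpM2r ?normc_ge0.
have : \int[mu]_w (om k w * normc (h w)) @[k --> \oo] --> (0 : R).
  apply: (dominated_cvg_Rintegral0 (g := fun w => 2 * N1 f * normc (h w))).
  - move=> k; under eq_fun do rewrite -omE.
    apply: (measurable_Rintegral mu (F := fun z : 'rV[R]_n * 'rV[R]_n => normc (F k (z.2, z.1)))).
    apply: (measurableT_comp (measurable_normc (mF k))).
    exact: measurable_fun_pair.
  - exact/integrableZR/integrable_normc.
  - move=> k w; rewrite ger0_norm ?mulr_ge0 ?normc_ge0 ?N1_ge0//.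
    by rewrite ler_wpM2r ?normc_ge0.
  - move=> w; under eq_fun do rewrite mulrC.
    apply: cvg0Ml; apply: (decays_translation df).
    rewrite -[X in _ --> X]oppr0; apply: cvgN.
    by rewrite -[X in _ --> X](scale0r w); apply: cvgZ => //; exact: cvg_cst.
apply: squeeze_cvgr; last exact: cvg_cst.
apply: nearW => k; apply/andP; split; first exact: N1_ge0.
have -> : \int[mu]_w (om k w * normc (h w)) =
    \int[mu]_x \int[mu]_w normc (F k (x, w)).
  under eq_Rintegral do rewrite -omE.
  by have := Rfubini1 (integrable_normc (Fi k)) => /= ->;
     have := Rfubini2 (integrable_normc (Fi k)) => /= ->.
apply: le_Rintegral => //.
- apply: integrable_normc; apply: CintegrableB => //.
  exact/Cintegrable_conv/Cintegrable_dilate.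
- exact: integrable_Rfubini1 (integrable_normc (Fi k)).
- move=> x _; have I1 : Cintegrable mu (fun w => f (x - e k *: w) * h w).
    apply: (CintegrableMl (M := M)) => //.
    apply: (Cmeasurable_comp mf).
    under eq_fun do rewrite addrC -scaleNr.
    exact: measurable_rV_affine.
  rewrite normcBC conv_dilate_sub// -[X in _ - X]mulr1 -h1 -CintZ// -CintB//; last exact: CintegrableZ.
  rewrite (le_trans (normc_Cint _))//.
    by apply: CintegrableB => //; exact: CintegrableZ.
  rewrite le_eqVlt; apply/orP; left; apply/eqP; apply: eq_Rintegral => w _.
  by rewrite /F/= mulrBl.
Qed.

End translation_continuity.

(** * Littlewood-Paley theory *)

Section defect.
Local Open Scope complex_scope.
Context {R : realType} {n : nat}.
Local Notation mu := (lebesgue_rV n).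
Implicit Types (x xi : 'rV[R]_n) (f g h : 'rV[R]_n -> R[i]) (t u e : R).
Variable rho : 'rV[R]_n -> R[i].
Hypothesis rhoi : Cintegrable mu rho.

(** The quantity N(g) of the overview. *)
Definition defect g : R := N1 (fun x => g x - convolution g rho x).

Lemma defect_ge0 g : 0 <= defect g. Proof. exact: N1_ge0. Qed.

Lemma tame_defect g : tame g -> tame (fun x => g x - convolution g rho x).
Proof. by move=> tg; apply: tameB => //; exact: tame_conv. Qed.

Lemma tame_convC f g : tame f -> Cintegrable mu g ->
  convolution f g = convolution g f.
Proof.
by move=> tf gi; have [_ _ [M fM]] := tf; exact: convolutionC (tame_meas tf) fM gi.
Qed.

Lemma tame_convA f g h : tame f -> tame g -> Cintegrable mu h ->
  convolution (convolution f g) h = convolution f (convolution g h).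
Proof.
move=> tf tg hi; have [_ _ [M fM]] := tf.
apply: (convolutionA (tame_meas tf) fM) => //; first exact: tame_integrable.
by move=> x; exact: tame_conv_integrable.
Qed.

Lemma conv_defect g h : tame g -> tame h ->
  (fun x => convolution g h x - convolution (convolution g h) rho x) =
  convolution (fun x => g x - convolution g rho x) h.
Proof.
move=> tg th; have hi := tame_integrable th; have [_ _ [M gM]] := tg.
have [_ _ [K hK]] := th.
have -> : convolution (convolution g h) rho = convolution (convolution g rho) h.
  rewrite tame_convA// (tame_convC th rhoi).
  apply/esym/(convolutionA (tame_meas tg) gM) => // x.
  apply: (CintegrableMr (M := K)) => //; last exact: tame_meas.
  exact: Cintegrable_sub.
apply/funext => x; rewrite -convBl// => y; apply: tame_conv_integrable => //.
exact: tame_conv.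
Qed.

Lemma defect_conv g h : tame g -> tame h ->
  defect (convolution g h) <= defect g * N1 h.
Proof.
move=> tg th; rewrite {1}/defect conv_defect//.
by apply: N1_conv; [exact: tame_defect|exact: tame_integrable].
Qed.

Lemma defectD f g : tame f -> tame g ->
  defect (fun x => f x + g x) <= defect f + defect g.
Proof.
move=> tf tg; rewrite /defect.
have -> : (fun x => f x + g x - convolution (fun x => f x + g x) rho x) =
    (fun x => (f x - convolution f rho x) + (g x - convolution g rho x)).
  apply/funext => x; rewrite convDl; first by rewrite opprD addrACA.
  - by move=> y; exact: tame_conv_integrable.
  - by move=> y; exact: tame_conv_integrable.
by apply: N1D; exact/tame_integrable/tame_defect.
Qed.

Lemma defect_le g : tame g -> defect g <= N1 g * (1 + N1 rho).
Proof.
move=> tg; have ti := tame_integrable tg; have tc := tame_conv tg rhoi.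
rewrite mulrDr mulr1 /defect.
have := N1D ti (CintegrableN (tame_integrable tc)).
move=> /le_trans; apply; rewrite lerD2l N1N.
exact: N1_conv.
Qed.

(** The L^1 norm is invariant under dilation, so shrinking [rho] by [e] amounts to stretching [g] by
    [e^-1]. *)
Lemma defect_dilate g e : 0 < e -> tame g ->
  N1 (fun x => g x - convolution g (dilate e rho) x) = defect (dilate e^-1 g).
Proof.
move=> e0 tg; have e1 : 0 < e^-1 by rewrite invr_gt0.
have er := Cintegrable_dilate e0 rhoi.
have tc := tame_conv tg er.
rewrite -(N1_dilate e1); last by apply: tame_integrable; exact: tameB.
rewrite /defect dilateB; congr N1; apply/funext => x; congr (_ - _).
by rewrite -conv_dilate// dilateK mulVf ?gt_eqF// dilate1.
Qed.

End defect.

Lemma absorb_half {R : realType} (A B x y : R) :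
  A <= A * x + B * y -> A * x <= A * 2^-1 -> A <= 2 * y * B.
Proof. by move=> h1 h2; lra. Qed.

Section littlewood_paley.
Local Open Scope complex_scope.
Context {R : realType} {n : nat}.
Local Notation mu := (lebesgue_rV n).
Implicit Types (x xi : 'rV[R]_n) (f g h : 'rV[R]_n -> R[i]) (t u e : R).
Variable zeta : 'rV[R]_n -> R[i].
Hypothesis zetaS : schwartz zeta.
Hypothesis hat_zeta0 : forall xi, 2 <= enorm xi -> fourier zeta xi = 0.
Hypothesis hat_zeta1 : forall xi, enorm xi <= 1 -> fourier zeta xi = 1.

Let zt : tame zeta. Proof. exact: schwartz_tame. Qed.

(** Where the transform of the first factor does not vanish, [t *: xi] has norm below 2, so
    [u *: xi] has norm at most 1 and the second transform equals 1. *)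
Lemma conv_zeta t u : 0 < u -> 2 * u <= t ->
  convolution (dilate t zeta) (dilate u zeta) = dilate t zeta.
Proof.
move=> u0 ut; have t0 : 0 < t by lra.
have tt := tame_dilate t0 zt; have tu := tame_dilate u0 zt.
have ti := tame_integrable zt; have ui := tame_integrable tu.
apply: fourier_eq => //; first exact: tame_conv.
move=> xi; rewrite fourier_conv// !fourier_dilate//.
have [h|h] := leP 2 (enorm (t *: xi)); first by rewrite hat_zeta0// mul0r.
rewrite (hat_zeta1 (xi := u *: xi)) ?mulr1//.
move: h; rewrite !enormZ !gtr0_norm// => h.
have := enorm_ge0 xi; nra.
Qed.

Variable phi : 'rV[R]_n -> R[i].
Hypothesis phiE : forall x, phi x = dilate 2^-1 zeta x - zeta x.

Lemma dilate_phi t : dilate t phi =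
  fun x => dilate (t / 2) zeta x - dilate t zeta x.
Proof. by rewrite (funext phiE) dilateB dilateK. Qed.

Lemma tame_phi : tame phi.
Proof.
by rewrite (funext phiE); apply: tameB => //; apply: tame_dilate.
Qed.

(** The factor 4 arises because the dilate of [phi] contains [dilate (t / 2) zeta], to which
    [conv_zeta] applies if [2 * u <= t / 2]. *)
Lemma conv_phi_zeta t u : 0 < u -> 4 * u <= t ->
  convolution (dilate t phi) (dilate u zeta) = dilate t phi.
Proof.
move=> u0 ut; have t0 : 0 < t by lra.
have t20 : 0 < t / 2 by lra.
have ui := tame_integrable (tame_dilate u0 zt).
rewrite dilate_phi; apply/funext => x; rewrite convBl.
- by rewrite !conv_zeta//; lra.
- by move=> y; apply: tame_conv_integrable => //; exact: tame_dilate.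
- by move=> y; apply: tame_conv_integrable => //; exact: tame_dilate.
Qed.

(** Both dilates of [zeta] that make up the second factor act as the identity on the first, so their
    difference annihilates it. *)
Lemma conv_phi_phi t u x : 0 < u -> 4 * u <= t ->
  convolution (dilate t phi) (dilate u phi) x = 0.
Proof.
move=> u0 ut; have t0 : 0 < t by lra.
have u20 : 0 < u / 2 by lra.
have tp := tame_dilate t0 tame_phi.
have zi v : 0 < v -> Cintegrable mu (dilate v zeta).
  by move=> v0; exact/tame_integrable/tame_dilate.
rewrite (dilate_phi u) convolutionE.
under eq_Cint do rewrite mulrBr.
rewrite CintB; [|by apply: tame_conv_integrable => //; exact: zi..].
rewrite -!convolutionE !conv_phi_zeta//; last by lra.
by rewrite subrr.
Qed.

Lemma fourier_phi xi : fourier phi xi =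
  fourier zeta (2^-1 *: xi) - fourier zeta xi.
Proof.
have zi := tame_integrable zt; have h0 : 0 < 2^-1 :> R by rewrite invr_gt0.
rewrite (funext phiE) fourierB//; last exact: Cintegrable_dilate.
by rewrite fourier_dilate.
Qed.

Lemma fourier_phi0 xi : enorm xi <= 1 \/ 4 <= enorm xi -> fourier phi xi = 0.
Proof.
rewrite fourier_phi => -[h|h].
- rewrite !hat_zeta1 ?subrr// enormZ gtr0_norm ?invr_gt0//.
  by have := enorm_ge0 xi; lra.
- rewrite !hat_zeta0 ?subrr//; first by lra.
  by rewrite enormZ gtr0_norm ?invr_gt0//; lra.
Qed.

(** Evenness is given for [phi], but bounding (delta - rho) on a block moves a dilate of [zeta]
    across the pairing, which requires [zeta] to be even. *)
Lemma zeta_even : (0 < n)%N -> (forall x, phi (- x) = phi x) ->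
  forall x, zeta (- x) = zeta x.
Proof.
move=> n0 pe x; have [->|x0] := eqVneq x 0; first by rewrite oppr0.
pose d y := zeta (- y) - zeta y.
(* Evenness of [phi] makes [d] homogeneous of degree [-n], which the decay of
   [zeta] only allows for [d = 0]. *)
have dhom y : d y = (2 ^+ n)%:C * d (2 *: y).
  have := pe y; rewrite !phiE /dilate -exprVn !invrK scalerN.
  set A' := _ * zeta (- _); set A := _ * zeta (2 *: y) => h.
  rewrite /d mulrBr -/A -/A' -[A'](subrK (zeta (- y))) h; ring.
have diter k : d x = (2 ^+ (n * k))%:C * d (2 ^+ k *: x).
  elim: k => [|k IH]; first by rewrite muln0 !expr0 mul1r scale1r.
  rewrite IH dhom scalerA -exprS mulrA -rmorphM/= -exprD.
  by rewrite mulnS addnC.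
(* One order of decay more than the degree of homogeneity, so that a factor [2 ^+ k] survives and
   contradicts boundedness. *)
have [C hC] := schwartz_bound n.+1 zetaS.
have hd y : enorm y ^+ n.+1 * normc (d y) <= 2 * `|C|.
  have hz z : enorm z ^+ n.+1 * normc (zeta z) <= `|C|.
    rewrite (le_trans (hC z))// (le_trans (ler_norm _))// normrM.
    by rewrite (gtr0_norm (weight_gt0 z)) ler_piMr// weight_le1.
  have eN : enorm (- y) = enorm y by rewrite -scaleN1r enormZ normrN normr1 mul1r.
  have := hz (- y); rewrite eN => h1; have h2 := hz y.
  have e0 : 0 <= enorm y ^+ n.+1 by rewrite exprn_ge0// enorm_ge0.
  rewrite (le_trans (ler_wpM2l e0 (ler_normcB _ _)))// mulrDr.
  by rewrite mulrDl mul1r lerD.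
have ex0 : 0 < enorm x.
  rewrite lt_def enorm_ge0 andbT; apply: contra x0 => /eqP e0.
  apply/eqP/rowP => i; rewrite mxE; apply/eqP; rewrite -normr_le0 -e0.
  exact: coord_le_enorm.
have [/eqP|d0] := eqVneq (d x) 0; first by rewrite subr_eq0 => /eqP.
have nd0 : 0 < normc (d x) by rewrite lt_def normc_eq0 d0 normc_ge0.
pose p := enorm x ^+ n.+1 * normc (d x).
have p0 : 0 < p by rewrite mulr_gt0// exprn_gt0.
have hp (k : nat) : 2 ^+ k * p <= 2 * `|C|.
  apply: le_trans (hd (2 ^+ k *: x)).
  rewrite /p (diter k) normcM normcR enormZ !ger0_norm ?exprn_ge0//.
  rewrite exprMn -exprM mulnS exprD (mulnC k n).
  by rewrite le_eqVlt; apply/orP; left; apply/eqP; ring.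
pose k := Num.truncn (2 * `|C| / p).
have := hp k.+1; rewrite leNgt => /negP; case.
rewrite -ltr_pdivrMr// (lt_trans (truncnS_gt _))// -/k.
by rewrite -natrX ltr_nat ltn_expl.
Qed.

Variable rho : 'rV[R]_n -> R[i].
Hypothesis rhoi : Cintegrable mu rho.

Lemma defect_zeta_mono t u : 0 < u -> 2 * u <= t ->
  defect rho (dilate t zeta) <= defect rho (dilate u zeta) * N1 zeta.
Proof.
move=> u0 ut; have t0 : 0 < t by lra.
have tt := tame_dilate t0 zt; have tu := tame_dilate u0 zt.
rewrite -(conv_zeta u0 ut) (tame_convC tt (tame_integrable tu)).
rewrite -(N1_dilate t0 (tame_integrable zt)).
exact: defect_conv.
Qed.

(* A local Wiener lemma: since [zeta * eta_e] is close to [zeta] for small [e],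
   the term on the left can be absorbed. *)
Lemma defect_zeta_le eta : tame eta -> Cint mu eta = 1 ->
  exists m : nat, forall t, 0 < t ->
  defect rho (dilate (2 ^+ m * t) zeta) <= 2 * N1 zeta * defect rho (dilate t eta).
Proof.
move=> te eta1.
have ei := tame_integrable te.
pose e (k : nat) : R := 2^-1 ^+ k; have e0 k : 0 < e k by rewrite exprn_gt0.
have ecvg : e k @[k --> \oo] --> (0 : R).
  by apply: cvg_expr; rewrite ger0_norm//; lra.
have := approximate_identity (schwartz_decays zetaS) ei eta1 e0 ecvg.
move=> /cvgrPdist_le/(_ 2^-1)[|k _ /(_ k (leqnn k))]; first by rewrite invr_gt0.
rewrite sub0r normrN ger0_norm ?N1_ge0// => hk.
exists k.+1 => t t0.
(* [T] is chosen so that [T * e k = t]: dilating the approximation of [zeta] by [T] makes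
   [dilate t eta] appear. The additional factor 2 lets [a] absorb [b]. *)
pose T := 2 ^+ k * t; have T0 : 0 < T by rewrite mulr_gt0 ?exprn_gt0.
have -> : 2 ^+ k.+1 * t = 2 * T by rewrite exprS mulrA.
have TT0 : 0 < 2 * T by lra.
pose a := dilate (2 * T) zeta; pose b := dilate T zeta.
pose c := dilate t eta.
have ta : tame a by exact: tame_dilate.
have tb : tame b by exact: tame_dilate.
have tc : tame c by exact: tame_dilate.
have ab : convolution a b = a by exact: conv_zeta.
have tbc := tame_conv tb (tame_integrable tc).
pose h := fun x => b x - convolution b c x.
have th : tame h by exact: tameB.
have hN : N1 h <= 2^-1.
  apply: le_trans hk; rewrite le_eqVlt; apply/orP; left; apply/eqP.
  rewrite -[RHS](N1_dilate T0); last first.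
    apply: tame_integrable; apply: tameB => //; apply: tame_conv => //.
    exact: Cintegrable_dilate.
  have E := conv_dilate T0 zt (Cintegrable_dilate (e0 k) ei).
  rewrite dilateB -E dilateK.
  have -> : T * e k = t.
    by rewrite /T mulrAC /e exprVn mulfV ?mul1r// expf_neq0.
  by [].
(* From a = a * b and b = h + b * c follows a = a * h + a * c. As [h] has L^1 norm at most 1/2, the
   defect of the first term is at most half that of [a], a real number that can be subtracted. *)
have aE : a = fun x => convolution a h x + convolution c a x.
  apply/funext => x; rewrite (tame_convC tc (tame_integrable ta)).
  rewrite -{1 3}ab (tame_convA ta tb (tame_integrable tc)) !convolutionE.
  rewrite -CintD; first by apply: eq_Cint => y; rewrite -mulrDr subrK.
  - exact: tame_conv_integrable (tame_integrable th).
  - exact: tame_conv_integrable (tame_integrable tbc).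
have N1a : N1 a = N1 zeta by rewrite N1_dilate//; exact: tame_integrable.
have := defectD rhoi (tame_conv ta (tame_integrable th)) (tame_conv tc (tame_integrable ta)).
rewrite -aE => /le_trans/(_ (lerD (defect_conv rhoi ta th) (defect_conv rhoi tc ta))).
rewrite N1a; set A := defect rho a; set B := defect rho c => h1.
have A0 : 0 <= A by exact: defect_ge0.
have : A * N1 h <= A * 2^-1 := ler_wpM2l A0 hN.
exact: absorb_half h1.
Qed.

End littlewood_paley.

(** * From integrals to dyadic sums *)

Section integral_monotone.
Local Open Scope ereal_scope.
Import HBNNSimple.

(* Unlike [ge0_le_integral], no measurability is required. *)
Lemma le_ge0_integral d (T : measurableType d) (R : realType)
    (mu : {measure set T -> \bar R}) (D : set T) (f g : T -> \bar R) :
  (forall x, D x -> 0 <= f x) -> (forall x, D x -> f x <= g x) ->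
  \int[mu]_(x in D) f x <= \int[mu]_(x in D) g x.
Proof.
move=> f0 fg; have g0 x : D x -> 0 <= g x.
  by move=> Dx; rewrite (le_trans (f0 _ Dx))// fg.
rewrite !ge0_integralE//; apply: ereal_sup_le => _ [h hf <-].
by exists h => // x; rewrite (le_trans (hf x))//; exact: lee_restrict.
Qed.

End integral_monotone.

Lemma powR2_gt1 {R : realType} (s : R) : 0 < s -> 1 < 2 `^ s.
Proof.
move=> s0; rewrite /powR (negbTE (_ : 2 != 0 :> R))// expR_gt1 mulr_gt0// ln_gt0//.
by rewrite ltrDl.
Qed.

(** A discrete Hardy inequality. Telescoping to infinity, where [B] vanishes, gives
    [r ^+ k * B k <= K]. Multiplying the sum by [r] shifts it by one term: r S <= K + S + r^N B_N <=
    2 K + S, and r > 1 concludes. *)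
Lemma sum_telescope_le {R : realType} (B D : nat -> R) (K r : R) : 1 < r -> (forall k, 0 <= B k) ->
  (forall k, 0 <= D k) ->
  (forall k, B k <= D k.+1 + B k.+1) -> B k @[k --> \oo] --> (0 : R) ->
  (forall N, \sum_(k < N) r ^+ k.+1 * D k.+1 <= K) ->
  forall N, \sum_(k < N) r ^+ k * B k <= 2 * K / (r - 1).
Proof.
move=> r1 B0 D0 BD Bcvg DK N; have r0 : 0 < r by lra.
have tele k M : r ^+ k * B k <= K + r ^+ k * B (k + M)%N.
  apply: (@le_trans _ _ (r ^+ k * (\sum_(j < M) D (k + j).+1) + r ^+ k * B (k + M)%N)).
    rewrite -mulrDr ler_pM2l ?exprn_gt0//.
    elim: M => [|M IH]; first by rewrite big_ord0 add0r addn0.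
    apply: (le_trans IH); rewrite big_ord_recr/= -addrA lerD2l addnS; exact: BD.
  rewrite lerD2r; apply: le_trans (DK (k + M)%N).
  rewrite big_split_ord/= ler_wpDl//.
    by apply: sumr_ge0 => i _; rewrite mulr_ge0// exprn_ge0// ltW.
  rewrite mulr_sumr; apply: ler_sum => j _; rewrite ler_wpM2r//.
  by rewrite ler_weXn2l ?ltW// leqW// leq_addr.
have BK k : r ^+ k * B k <= K.
  have h : (K + r ^+ k * B (k + M)%N) @[M --> \oo] --> K + r ^+ k * 0.
    apply: cvgD; first exact: cvg_cst.
    apply: cvgM; first exact: cvg_cst.
    rewrite (_ : (fun M => _) = (fun M => B (M + k)%N)); last first.
      by apply/funext => M; rewrite addnC.
    by rewrite (cvg_shiftn k B).
  have := limr_ge (x := r ^+ k * B k) (cvgP _ h).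
  rewrite (cvg_lim _ h)// mulr0 addr0; apply.
  by apply: nearW => M; exact: tele.
pose SN := \sum_(k < N) r ^+ k * B k; rewrite -/SN.
have h : r * SN <= K + K + SN.
  rewrite /SN mulr_sumr.
  apply: (@le_trans _ _ (\sum_(k < N) (r ^+ k.+1 * D k.+1 + r ^+ k.+1 * B k.+1))).
    by apply: ler_sum => k _; rewrite -mulrDr exprS mulrA ler_wpM2l ?mulr_ge0 ?exprn_ge0// ltW.
  rewrite big_split/= -addrA; apply: lerD; first exact: DK.
  have : \sum_(k < N.+1) r ^+ k * B k = SN + r ^+ N * B N by rewrite big_ord_recr.
  rewrite big_ord_recl/= => E.
  have := BK N; have := B0 0%N; rewrite -/SN; move: E; rewrite expr0 mul1r.
  by rewrite (eq_bigr (fun i : 'I_N => r ^+ i.+1 * B i.+1))//; first lra.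
by rewrite ler_pdivlMr ?subr_gt0//; lra.
Qed.

Section dyadic.
Context {R : realType}.
Variable s : R.
Hypothesis s0 : 0 < s.
Implicit Types (e S K : R) (F : R -> R) (a A B D : nat -> R) (k N : nat).
Local Notation leb := (@lebesgue_measure R).

Let half_gt0 k : 0 < 2^-1 ^+ k :> R.
Proof. by rewrite exprn_gt0 ?invr_gt0. Qed.

Definition dyadic k : set R := `[2^-1 ^+ k.+1, 2^-1 ^+ k[%classic.

Lemma dyadicE k e : dyadic k e = (2^-1 ^+ k.+1 <= e < 2^-1 ^+ k) :> Prop.
Proof. by rewrite /dyadic /= in_itv. Qed.

Lemma measurable_dyadic k : measurable (dyadic k).
Proof. exact: measurable_itv. Qed.

Lemma dyadic01 k e : dyadic k e -> 0 < e < 1.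
Proof.
rewrite dyadicE => /andP[h1 h2]; rewrite (lt_le_trans _ h1)//=.
by rewrite (lt_le_trans h2)// exprn_ile1//; lra.
Qed.

Lemma dyadic_inv k e : dyadic k e -> 2 ^+ k <= e^-1 <= 2 ^+ k.+1.
Proof.
move=> De; have /andP[e0 _] := dyadic01 De.
move: De; rewrite dyadicE => /andP[h1 h2].
rewrite -[2 ^+ k]invrK -[2 ^+ k.+1]invrK !lef_pV2 ?posrE ?invr_gt0 ?exprn_gt0//.
by rewrite -!exprVn h1 ltW.
Qed.

Lemma dyadic_trivIset j k e : dyadic j e -> dyadic k e -> j = k.
Proof.
rewrite !dyadicE => /andP[j1 j2] /andP[k1 k2].
have W (l m : nat) (p : 2^-1 ^+ l.+1 <= e) (q : e < 2^-1 ^+ m) : (m < l.+1)%N.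
  rewrite ltnNge; apply/negP => lm; have := le_lt_trans p q; rewrite ltNge => /negP; apply.
  by apply: ler_wiXn2l => //; lra.
by apply/eqP; rewrite eqn_leq; apply/andP; split; rewrite -ltnS;
  [exact: W k1 j2|exact: W j1 k2].
Qed.

Lemma dyadic_cover e : 0 < e < 1 -> exists k, dyadic k e.
Proof.
move=> /andP[e0 e1].
have ex : exists k, 2^-1 ^+ k.+1 <= e.
  exists (Num.truncn e^-1); rewrite -[leRHS]invrK exprVn lef_pV2 ?posrE ?invr_gt0 ?exprn_gt0//.
  rewrite ltW// (lt_le_trans (truncnS_gt _))// -natrX ler_nat ltnW// ltn_expl//.
case: (ex_minnP ex) => k hk kmin; exists k; rewrite dyadicE hk/=.
case: k hk kmin => [_ _|k hk kmin]; first by rewrite expr0.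
by rewrite ltNge; apply/negP => /kmin; rewrite ltnn.
Qed.

Lemma lebesgue_dyadic k : leb (dyadic k) = (2^-1 ^+ k.+1)%:E.
Proof.
rewrite /dyadic lebesgue_measure_itv/= lte_fin ifT.
  by rewrite -EFinB; congr EFin; rewrite exprS; lra.
by rewrite exprS; have := half_gt0 k; lra.
Qed.

Lemma powR_dyadic k :
  ((2^-1 ^+ k) `^ (s + 1))^-1 = (2 `^ s) ^+ k * 2 ^+ k.
Proof.
have -> : (2^-1 ^+ k : R) = 2 `^ (- k%:R) by rewrite powR_invn// exprVn.
rewrite -powRrM -powRN -mulNr opprK mulrDr mulr1 powRD; last first.
  by rewrite pnatr_eq0 implybT.
by rewrite powR_mulrn// mulrC [_ * s]mulrC powRrM powR_mulrn ?powR_ge0// mulrC.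
Qed.

Lemma powR_dyadic_le k e : dyadic k e ->
  (2 `^ s) ^+ k * 2 ^+ k <= (e `^ (s + 1))^-1 <= (2 `^ s) ^+ k.+1 * 2 ^+ k.+1.
Proof.
move=> De; have /andP[e0 _] := dyadic01 De.
move: De; rewrite dyadicE => /andP[h1 h2]; rewrite -!powR_dyadic.
have p1 : 0 <= s + 1 by rewrite addr_ge0// ltW.
rewrite !lef_pV2 ?posrE ?powR_gt0//.
by rewrite !ge0_ler_powR ?nnegrE//; first [exact: ltW | rewrite ltW].
Qed.

Definition dstep a k (e : measurableTypeR R) : \bar R := (a k * \1_(dyadic k) e)%:E.

Let dstep_meas a k (E : set (measurableTypeR R)) : measurable_fun E (dstep a k).
Proof.
apply/measurable_EFinP/measurable_funM; first exact: measurable_cst.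
by apply: measurable_indic; exact: measurable_dyadic.
Qed.

Let dstep_ge0 a k e : (forall k, 0 <= a k) -> (0 <= dstep a k e)%E.
Proof. by move=> a0; rewrite lee_fin mulr_ge0// indicE. Qed.

Let dstep_int a k : (forall k, 0 <= a k) ->
  (\int[leb]_(e in `]0%R, 1%R[) dstep a k e = (a k * 2^-1 ^+ k.+1)%:E)%E.
Proof.
move=> a0; rewrite /dstep; under eq_integral do rewrite EFinM.
rewrite ge0_integralZl//=; last 2 first.
- by apply/measurable_EFinP; apply: measurable_indic; exact: measurable_dyadic.
- by rewrite lee_fin.
rewrite integral_indic//; last exact: measurable_dyadic.
rewrite (_ : _ `&` _ = dyadic k) ?lebesgue_dyadic//; last first.
  apply/seteqP; split => [e []//|e De]; split => //.
  by rewrite /= in_itv/=; exact: dyadic01 De.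
by rewrite EFinM; congr (_ * _)%E; exact: lebesgue_dyadic.
Qed.

(** [F] is not assumed measurable, so the integrand is compared from below with a step function,
    constant on each dyadic interval; only the latter is integrated term by term. *)
Lemma sum_le_integral F a K : (forall k, 0 <= a k) -> 0 <= K ->
  (forall e, 0 <= F e) -> (forall k e, dyadic k e -> a k <= K * F e) ->
  (\int[leb]_(e in `]0%R, 1%R[) ((e `^ (s + 1))^-1 * F e)%:E < +oo)%E ->
  exists S, forall N, \sum_(k < N) (2 `^ s) ^+ k * a k <= S.
Proof.
move=> a0 K0 F0 aF Foo.
have K1 : 0 < K + 1 by lra.
(* [K + 1] replaces [K], which may be 0, as a divisor. Multiplied by the length [2^-1 ^+ k.+1] of
   the interval, [b k] is the k-th term of the sum over [2 * (K + 1)]. *)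
pose b k := (K + 1)^-1 * (2 `^ s) ^+ k * 2 ^+ k * a k.
have b0 k : 0 <= b k.
  by rewrite !mulr_ge0 ?exprn_ge0 ?powR_ge0 ?invr_ge0// ltW.
set I := (\int[_]_(_ in _) _)%E in Foo.
have I0 : (0 <= I)%E.
  by apply: integral_ge0 => e _; rewrite lee_fin mulr_ge0 ?invr_ge0 ?powR_ge0.
exists (2 * (K + 1) * fine I) => N.
have : ((\sum_(k < N) b k * 2^-1 ^+ k.+1)%:E <= I)%E.
  rewrite -sumEFin; under eq_bigr do rewrite -(dstep_int _ b0).
  have <- : (\int[leb]_(e in `]0%R, 1%R[) \sum_(k < N) dstep b k e =
      \sum_(k < N) \int[leb]_(e in `]0%R, 1%R[) dstep b k e)%E.
    by rewrite ge0_integral_sum// => *; first [exact: dstep_meas|exact: dstep_ge0].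
  apply: le_ge0_integral => e /=; first by move=> _; apply: sume_ge0 => k _; exact: dstep_ge0.
  rewrite in_itv/= => e01; have [k De] := dyadic_cover e01.
  have Dj j : j != k -> dstep b j e = 0%E.
    move=> jk; rewrite /dstep indicE memNset ?mulr0// => Dj.
    by move: jk; rewrite (dyadic_trivIset Dj De) eqxx.
  have R0 : (0 <= ((e `^ (s + 1))^-1 * F e)%:E)%E.
    by rewrite lee_fin mulr_ge0 ?invr_ge0 ?powR_ge0.
  have [kN|Nk] := ltnP k N; last first.
    rewrite big1// => i _; apply: Dj; apply: contraTneq (ltn_ord i) => ->.
    by rewrite -leqNgt.
  rewrite (bigD1 (Ordinal kN))//= big1 ?adde0; last by move=> i ik; exact: Dj.
  rewrite /dstep indicE mem_set//= mulr1 lee_fin /b.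
  have /andP[h _] := powR_dyadic_le De.
  have h2 : (K + 1)^-1 * a k <= F e.
    rewrite ler_pdivrMl//; apply: (le_trans (aF _ _ De)).
    by rewrite ler_wpM2r// lerDl.
  rewrite -!mulrA mulrCA (mulrCA (K + 1)^-1) mulrA.
  apply: ler_pM => //; rewrite ?mulr_ge0 ?exprn_ge0 ?powR_ge0 ?invr_ge0//.
  exact: ltW.
have If : I \is a fin_num by rewrite ge0_fin_numE.
rewrite -[X in (_ <= X)%E](fineK If) lee_fin => h.
apply: le_trans (ler_wpM2l (_ : 0 <= 2 * (K + 1)) h); last by lra.
rewrite mulr_sumr; apply: ler_sum => k _; rewrite le_eqVlt; apply/orP; left; apply/eqP.
rewrite /b exprS exprVn; field.
by rewrite expf_neq0// gt_eqF.
Qed.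

Lemma integral_le_sum F a S : (forall k, 0 <= a k) -> (forall e, 0 <= F e) ->
  (forall k e, dyadic k e -> F e <= a k) ->
  (forall N, \sum_(k < N) (2 `^ s) ^+ k * a k <= S) ->
  (\int[leb]_(e in `]0%R, 1%R[) ((e `^ (s + 1))^-1 * F e)%:E < +oo)%E.
Proof.
move=> a0 F0 Fa aS.
pose b k := (2 `^ s) ^+ k.+1 * 2 ^+ k.+1 * a k.
have b0 k : 0 <= b k by rewrite !mulr_ge0 ?exprn_ge0 ?powR_ge0.
apply: (@le_lt_trans _ _ (\int[leb]_(e in `]0%R, 1%R[) \sum_(k <oo) dstep b k e)%E).
  apply: le_ge0_integral => e /=.
    by move=> _; rewrite lee_fin mulr_ge0 ?invr_ge0 ?powR_ge0.
  rewrite in_itv/= => e01; have [k De] := dyadic_cover e01.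
  apply: (@le_trans _ _ (dstep b k e)).
    rewrite /dstep indicE mem_set//= mulr1 lee_fin /b.
    have /andP[_ h] := powR_dyadic_le De.
    by apply: ler_pM => //; [rewrite invr_ge0 powR_ge0|exact: Fa].
  apply: le_trans (nneseries_lim_ge k.+1 _); last by move=> *; exact: dstep_ge0.
  by rewrite big_mkord big_ord_recr/= leeDr// sume_ge0// => *; exact: dstep_ge0.
rewrite integral_nneseries//; last by move=> *; exact: dstep_ge0.
apply: (@le_lt_trans _ _ (2 `^ s * S)%:E); last exact: ltry.
apply: lime_le.
  by apply: is_cvg_nneseries => k _ _; rewrite dstep_int// lee_fin mulr_ge0// ltW.
apply: nearW => N; rewrite big_mkord; under eq_bigr do rewrite dstep_int//.
rewrite sumEFin lee_fin.
apply: le_trans (ler_wpM2l (powR_ge0 2 s) (aS N)).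
rewrite mulr_sumr; apply: ler_sum => k _; rewrite le_eqVlt; apply/orP; left; apply/eqP.
rewrite /b !exprS exprVn; field.
by rewrite expf_neq0.
Qed.

End dyadic.

(** * Property (a) in terms of dyadic sums of defects *)

Section criterion.
Local Open Scope complex_scope.
Context {R : realType} {n : nat}.
Local Notation mu := (lebesgue_rV n).
Implicit Types (f g : 'rV[R]_n -> R[i]) (e : R).

Lemma cLnorm1 f : Cintegrable mu f -> cLnorm 1 f = (N1 f)%:E.
Proof.
move=> fi; rewrite /cLnorm Lnorm1 (EFin_Rintegral (integrable_normc fi)).
by apply: eq_integral => x _; rewrite /= ger0_norm ?normc_ge0.
Qed.

Lemma tameZ (c : R[i]) f : tame f -> tame (fun x => c * f x).
Proof.
move=> [cf fi [M fM]]; split.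
- apply: ccontinuous_seq => p u up.
  rewrite (_ : (fun k => _) = fun k => normc c * normc (f (u k) - f p)); last first.
    by apply/funext => k; rewrite -mulrBr normcM.
  exact/cvg0Ml/ccontinuous_cvg.
- exact: CintegrableZ.
- by exists (normc c * M) => x; rewrite normcM ler_wpM2l// normc_ge0.
Qed.

Variable rho : 'rV[R]_n -> R[i].
Hypothesis rhoi : Cintegrable mu rho.

Lemma defectZ (c : R[i]) f : tame f ->
  defect rho (fun x => c * f x) = normc c * defect rho f.
Proof.
move=> tf; rewrite /defect /N1 -RintegralZl//; last first.
  exact/integrable_normc/tame_integrable/tame_defect.
apply: eq_Rintegral => x _; rewrite -normcM mulrBr !convolutionE -CintZ.
  by congr (normc (_ - _)); apply: eq_Cint => y; rewrite mulrA.
exact: tame_conv_integrable.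
Qed.

Lemma dilateZ e (c : R[i]) f :
  dilate e (fun x => c * f x) = fun x => c * dilate e f x.
Proof. by apply/funext => x; rewrite /dilate mulrCA. Qed.

Variable s : R.
Hypothesis s0 : 0 < s.
Local Notation r := (2 `^ s).

Lemma integral_defectE g : tame g ->
  (\int[lebesgue_measure]_(e in `]0%R, 1%R[) ((e `^ (s + 1))^-1%:E *
     cLnorm 1 (fun x => g x - convolution g (dilate e rho) x)%R))%E =
  (\int[lebesgue_measure]_(e in `]0%R, 1%R[)
     ((e `^ (s + 1))^-1 * defect rho (dilate e^-1 g))%:E)%E.
Proof.
move=> tg; apply: eq_integral => e; rewrite inE/= in_itv/= => /andP[e0 _].
rewrite cLnorm1 ?defect_dilate//.
apply: CintegrableB; first exact: tame_integrable.
by apply: tame_integrable; apply: tame_conv => //; exact: Cintegrable_dilate.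
Qed.

Variables zeta phi : 'rV[R]_n -> R[i].
Hypothesis zetaS : schwartz zeta.
Hypothesis hat_zeta0 : forall xi, 2 <= enorm xi -> fourier zeta xi = 0.
Hypothesis hat_zeta1 : forall xi, enorm xi <= 1 -> fourier zeta xi = 1.
Hypothesis phiE : forall x, phi x = dilate 2^-1 zeta x - zeta x.

Let zt : tame zeta. Proof. exact: schwartz_tame. Qed.

Lemma sum_defect_zeta eta : tame eta -> Cint mu eta != 0 ->
  (\int[lebesgue_measure]_(e in `]0%R, 1%R[) ((e `^ (s + 1))^-1%:E *
     cLnorm 1 (fun x => eta x - convolution eta (dilate e rho) x)%R) < +oo)%E ->
  exists S, forall N,
    \sum_(k < N) r ^+ k * defect rho (dilate (2 ^+ k / 4) zeta) <= S.
Proof.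
move=> te eta0; rewrite integral_defectE// => Foo.
set c := (Cint mu eta)^-1.
have eta1 : Cint mu (fun x => c * eta x) = 1.
  by rewrite CintZ ?mulVf//; exact: tame_integrable.
have [m hm] := defect_zeta_le zetaS hat_zeta0 hat_zeta1 rhoi (tameZ c te) eta1.
pose A k := defect rho (dilate (2 ^+ k / 4) zeta).
pose K := N1 zeta * (2 * N1 zeta) * normc c.
have K0 : 0 <= K by rewrite !mulr_ge0 ?N1_ge0// normc_ge0.
(* [defect_zeta_le] leads to the dilate [2 ^+ m * e^-1] of [zeta]. Since [e^-1 <= 2 ^+ k.+1], twice
   this is at most [2 ^+ (k + m + 4) / 4], so the shift by 4 is what [defect_zeta_mono] requires.
   The first [m + 4] terms of the sum are put into the constant [S0]. *)
have AK k e : dyadic k e -> A (k + (m + 4))%N <= K * defect rho (dilate e^-1 eta).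
  move=> De; have /andP[e0 _] := dyadic01 De.
  have ei0 : 0 < e^-1 by rewrite invr_gt0.
  have /andP[_ ek] := dyadic_inv De.
  have t0 : 0 < 2 ^+ m * e^-1 by rewrite mulr_gt0// exprn_gt0.
  apply: le_trans (defect_zeta_mono zetaS hat_zeta0 hat_zeta1 rhoi t0 _) _.
    rewrite !exprD [2 ^+ 4](_ : _ = 2 * 2 * 4 :> R); last by rewrite !exprS; ring.
    move: ek; rewrite exprS; set a := 2 ^+ k; set b := 2 ^+ m => ek.
    have b0 : 0 <= b by rewrite exprn_ge0.
    rewrite !mulrA mulfK// -mulrA (mulrC 2); apply: le_trans (_ : b * (2 * a) * 2 <= _).
      by rewrite ler_pM2r// ler_wpM2l.
    by rewrite le_eqVlt; apply/orP; left; apply/eqP; ring.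
  rewrite mulrC /K -!mulrA ler_wpM2l ?N1_ge0// mulrA.
  by rewrite -defectZ -?dilateZ ?hm//; exact: tame_dilate.
have [S hS] := sum_le_integral s0 (fun k => defect_ge0 _ _) K0
  (fun e => defect_ge0 _ _) AK Foo.
pose S0 := \sum_(j < m + 4) r ^+ j * A j.
have rA0 k : 0 <= r ^+ k * A k by rewrite mulr_ge0 ?defect_ge0// exprn_ge0// powR_ge0.
exists (S0 + r ^+ (m + 4) * S) => N.
apply: (@le_trans _ _ (\sum_(k < m + 4 + N) r ^+ k * A k)).
  rewrite addnC big_split_ord/= lerDl; apply: sumr_ge0 => i _; exact: rA0.
rewrite big_split_ord/= lerD2l.
apply: le_trans (ler_wpM2l (exprn_ge0 _ (powR_ge0 _ _)) (hS N)).
rewrite mulr_sumr; apply: ler_sum => k _.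
by rewrite exprD -mulrA (addnC (m + 4)%N).
Qed.

(** By [defect_dilate], this is the error made when [zeta] is convolved with [rho] dilated by
    [2^-1 ^+ k], an approximate identity because [rho] has integral 1. *)
Lemma defect_zeta_cvg : Cint mu rho = 1 ->
  defect rho (dilate (2 ^+ k) zeta) @[k --> \oo] --> (0 : R).
Proof.
move=> rho1; pose e (k : nat) : R := 2^-1 ^+ k.
have e0 k : 0 < e k by rewrite exprn_gt0// invr_gt0.
have ecvg : e k @[k --> \oo] --> (0 : R).
  by apply: cvg_expr; rewrite ger0_norm ?invr_ge0//; lra.
have := approximate_identity (schwartz_decays zetaS) rhoi rho1 e0 ecvg.
apply: cvg_trans; apply: near_eq_cvg; apply: nearW => k.
have E := defect_dilate rhoi (e0 k) zt.
apply: etrans E _; congr (defect rho (dilate _ zeta)).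
by rewrite /e exprVn invrK.
Qed.

Lemma integral_defect_zeta (K : R) : Cint mu rho = 1 ->
  (forall N, \sum_(k < N) r ^+ k.+1 * defect rho (dilate (2 ^+ k.+1) phi) <= K) ->
  (\int[lebesgue_measure]_(e in `]0%R, 1%R[) ((e `^ (s + 1))^-1%:E *
     cLnorm 1 (fun x => zeta x - convolution zeta (dilate e rho) x)%R) < +oo)%E.
Proof.
move=> rho1 hK; rewrite integral_defectE//.
have r1 : 1 < r := powR2_gt1 s0.
pose B k := defect rho (dilate (2 ^+ k) zeta).
pose D k := defect rho (dilate (2 ^+ k) phi).
have p0 k : 0 < 2 ^+ k :> R by rewrite exprn_gt0.
have BD k : B k <= D k.+1 + B k.+1.
  have t1 : tame (dilate (2 ^+ k.+1) phi).
    by apply: tame_dilate => //; exact: tame_phi phiE.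
  have t2 : tame (dilate (2 ^+ k.+1) zeta) by exact: tame_dilate.
  apply: le_trans (defectD rhoi t1 t2).
  rewrite /B le_eqVlt; apply/orP; left; apply/eqP; congr defect; apply/funext => x.
  by rewrite (dilate_phi phiE) subrK exprS mulrAC mulfV ?mul1r.
have Bs := sum_telescope_le r1 (fun k => defect_ge0 _ _) (fun k => defect_ge0 _ _)
  BD (defect_zeta_cvg rho1) hK.
(* On the interval of index [j.+1], [e^-1] is at least [2 * 2 ^+ j], so [defect_zeta_mono] applies
   with [B j]. The interval next to 1 has no predecessor and receives the trivial bound. *)
pose a k := if k is j.+1 then B j * N1 zeta else N1 zeta * (1 + N1 rho).
have a0 k : 0 <= a k.
  by case: k => [|k]; rewrite mulr_ge0 ?N1_ge0 ?defect_ge0// addr_ge0 ?N1_ge0.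
apply: (integral_le_sum s0 (a := a) (S := a 0%N + r * (N1 zeta * (2 * K / (r - 1))))) => //.
- by move=> e; exact: defect_ge0.
- move=> k e De; have /andP[e0 _] := dyadic01 De.
  have ei0 : 0 < e^-1 by rewrite invr_gt0.
  case: k De => [|k] De /=.
    rewrite -(N1_dilate ei0 (tame_integrable zt)); apply: defect_le => //.
    exact: tame_dilate.
  apply: defect_zeta_mono => //; have /andP[+ _] := dyadic_inv De.
  by rewrite exprS.
- move=> N; apply: (@le_trans _ _ (\sum_(k < N.+1) r ^+ k * a k)).
    by rewrite big_ord_recr/= lerDl mulr_ge0// exprn_ge0// powR_ge0.
  rewrite big_ord_recl/= expr0 mul1r lerD2l.
  apply: le_trans (ler_wpM2l (powR_ge0 2 s) (ler_wpM2l (N1_ge0 zeta) (Bs N))).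
  rewrite !mulr_sumr; apply: ler_sum => k _ /=.
  have -> : bump 0 k = k.+1 by [].
  by rewrite exprS add0n le_eqVlt; apply/orP; left; apply/eqP; rewrite /B; ring.
Qed.

End criterion.

(** * Schwartz functions *)

Section smooth_closure.
Local Open Scope complex_scope.
Context {R : realType} {n : nat}.
Implicit Types (x v b : 'rV[R]_n) (f g : 'rV[R]_n -> R[i]) (a : R).

Lemma is_derive_lin (u w z : 'rV[R]_n -> R) (p q du dw dz : R) x v :
  is_derive x v u du -> is_derive x v w dw -> is_derive x v z dz ->
  is_derive x v (fun y => p * u y + q * w y + z y) (p * du + q * dw + dz).
Proof.
move=> hu hw hz.
exact: (is_deriveD (is_deriveD (is_deriveZ p hu) (is_deriveZ q hw)) hz).
Qed.

(** The difference quotient at [h] is [a] times that of [u] at [a * h], and [a != 0] keeps [a * h]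
    away from 0. *)
Lemma is_derive_affine (u : 'rV[R]_n -> R) (du a : R) b x v : a != 0 ->
  is_derive (a *: x + b) v u du ->
  is_derive x v (fun y => u (a *: y + b)) (a * du).
Proof.
move=> a0 hu; have ud : derivable u (a *: x + b) v by exact: ex_derive.
pose G (h : R) := h^-1 *: ((u \o shift (a *: x + b)) (h *: v) - u (a *: x + b)).
have Gcvg : G h @[h --> 0^'] --> du.
  by rewrite -(@derive_val _ _ _ _ _ _ _ hu); exact: ud.
have acvg : a * h @[h --> (0 : R)^'] --> (0 : R)^'.
  move=> P P0.
  have acont : a * h @[h --> (0 : R)] --> (0 : R).
    by rewrite -[X in _ --> X](mulr0 a); apply: cvgM; [exact: cvg_cst|exact: cvg_id].
  have P1 : nbhs (0 : R) (fun y : R => y != 0 -> P y) by exact: P0.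
  have P2 : nbhs (0 : R) (fun h : R => a * h != 0 -> P (a * h)) := acont _ P1.
  suff : nbhs (0 : R) (fun h : R => h != 0 -> P (a * h)) by [].
  by apply: filterS P2 => h /= Ph h0; apply: Ph; rewrite mulf_neq0.
have F : (fun h : R => h^-1 *: (((fun y => u (a *: y + b)) \o shift x) (h *: v) -
    u (a *: x + b))) = fun h => a * G (a * h).
  apply/funext => h; rewrite /G /=.
  have -> : a *: (h *: v + x) + b = (a * h) *: v + (a *: x + b).
    by rewrite scalerDr scalerA addrA.
  set Y : R := u _ - u _; change (h^-1 * Y = a * ((a * h)^-1 * Y)).
  by rewrite invfM !mulrA mulfV ?mul1r.
have cv : a * G (a * h) @[h --> 0^'] --> a * du.
  apply: cvgM; first exact: cvg_cst.
  exact: (cvg_comp _ _ acvg Gcvg).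
apply: DeriveDef; rewrite /derivable /derive F; first exact: (cvgP _ cv).
exact: (cvg_lim _ cv).
Qed.

Lemma pderiv_lin (c : R[i]) f g x i :
  cderivable f x (delta_mx ord0 i) -> cderivable g x (delta_mx ord0 i) ->
  cderivable (fun y => c * f y + g y) x (delta_mx ord0 i) /\
  pderiv i (fun y => c * f y + g y) x = c * pderiv i f x + pderiv i g x.
Proof.
move=> [/derivableP f1 /derivableP f2] [/derivableP g1 /derivableP g2].
have h1 : is_derive x (delta_mx ord0 i)
    (fun y => complex.Re (c * f y + g y)) (complex.Re (c * pderiv i f x + pderiv i g x)).
  have := is_derive_lin (complex.Re c) (- complex.Im c) f1 f2 g1.
  rewrite ReD ReM /= mulNr.
  by under eq_fun do rewrite mulNr -ReM -ReD.
have h2 : is_derive x (delta_mx ord0 i)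
    (fun y => complex.Im (c * f y + g y)) (complex.Im (c * pderiv i f x + pderiv i g x)).
  have := is_derive_lin (complex.Re c) (complex.Im c) f2 f1 g2.
  rewrite ImD ImM /=.
  by under eq_fun do rewrite -ImM -ImD.
split; first by split; exact: ex_derive.
by apply: complex_eqP; [exact: (@derive_val _ _ _ _ _ _ _ h1)|exact: (@derive_val _ _ _ _ _ _ _ h2)].
Qed.

Lemma pderiv_affine f a b x i : a != 0 ->
  cderivable f (a *: x + b) (delta_mx ord0 i) ->
  cderivable (fun y => f (a *: y + b)) x (delta_mx ord0 i) /\
  pderiv i (fun y => f (a *: y + b)) x = a%:C * pderiv i f (a *: x + b).
Proof.
move=> a0 [/derivableP f1 /derivableP f2].
have h1 := is_derive_affine a0 f1; have h2 := is_derive_affine a0 f2.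
split; first by split; exact: ex_derive.
apply: complex_eqP.
- by rewrite ReM /= mul0r subr0; exact: (@derive_val _ _ _ _ _ _ _ h1).
- by rewrite ImM /= mul0r addr0; exact: (@derive_val _ _ _ _ _ _ _ h2).
Qed.

Lemma pderivs_lin (c : R[i]) f g l : smooth f -> smooth g ->
  pderivs l (fun x => c * f x + g x) = fun x => c * pderivs l f x + pderivs l g x.
Proof.
move=> sf sg; elim: l => [//|i l /= ->]; apply/funext => x.
by have [_ ->//] := pderiv_lin c ((sf l).2 i x) ((sg l).2 i x).
Qed.

Lemma pderivs_affine f a b l : a != 0 -> smooth f ->
  pderivs l (fun x => f (a *: x + b)) =
  fun x => (a ^+ size l)%:C * pderivs l f (a *: x + b).
Proof.
move=> a0 sf; elim: l => [|i l /= ->]; first by apply/funext => x; rewrite mul1r.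
apply/funext => x.
have [h1 h2] := pderiv_affine a0 ((sf l).2 i (a *: x + b)).
have h0 : cderivable (fun=> 0 : R[i]) x (delta_mx ord0 i) by split; exact: derivable_cst.
have [_] := pderiv_lin (a ^+ size l)%:C h1 h0.
rewrite (_ : (fun y => _ + _) = fun y => (a ^+ size l)%:C * pderivs l f (a *: y + b)); last first.
  by apply/funext => y; rewrite addr0.
move=> ->; rewrite h2 mulrA -rmorphM/= -exprSr.
rewrite (_ : pderiv i (fun=> 0) x = 0) ?addr0//.
by rewrite /pderiv /= !derive_cst.
Qed.

Lemma ccontinuous_lin (c : R[i]) f g : ccontinuous f -> ccontinuous g ->
  ccontinuous (fun x => c * f x + g x).
Proof.
move=> cf cg; apply: ccontinuous_seq => p u up.
have Z : normc c * normc (f (u k) - f p) + normc (g (u k) - g p) @[k --> \oo] --> (0 : R).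
  rewrite -[X in _ --> X]addr0; apply: cvgD; last exact: ccontinuous_cvg.
  exact/cvg0Ml/ccontinuous_cvg.
apply: (squeeze_cvgr _ (cvg_cst 0) Z); apply: nearW => k.
apply/andP; split; first exact: normc_ge0.
by rewrite opprD addrACA -mulrBr (le_trans (ler_normcD _ _))// normcM.
Qed.

Lemma ccontinuous_affine f a b : ccontinuous f ->
  ccontinuous (fun x => f (a *: x + b)).
Proof.
move=> cf; apply: ccontinuous_seq => p u up.
apply: (ccontinuous_cvg (f := f) (p := a *: p + b) (u := fun k => a *: u k + b)) => //.
by apply: cvgD; [apply: cvgZr|exact: cvg_cst].
Qed.

Lemma smooth_lin (c : R[i]) f g : smooth f -> smooth g ->
  smooth (fun x => c * f x + g x).
Proof.
move=> sf sg l; rewrite pderivs_lin//; split.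
  by apply: ccontinuous_lin; [exact: (sf l).1|exact: (sg l).1].
by move=> i x; exact: (pderiv_lin c ((sf l).2 i x) ((sg l).2 i x)).1.
Qed.

Lemma smooth_affine f a b : a != 0 -> smooth f -> smooth (fun x => f (a *: x + b)).
Proof.
move=> a0 sf l; rewrite pderivs_affine//.
rewrite (_ : (fun y => _) = fun y => (a ^+ size l)%:C * pderivs l f (a *: y + b) + 0); last first.
  by apply/funext => y; rewrite addr0.
split.
  apply: ccontinuous_lin; first exact/ccontinuous_affine/(sf l).1.
  by split => x; exact: cst_continuous.
move=> i x; apply: (pderiv_lin _ _ _).1; last by split; exact: derivable_cst.
exact: (pderiv_affine a0 ((sf l).2 i (a *: x + b))).1.
Qed.

Lemma schwartz_lin (c : R[i]) f g : schwartz f -> schwartz g ->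
  schwartz (fun x => c * f x + g x).
Proof.
move=> [sf hf] [sg hg]; split; first exact: smooth_lin.
move=> k l; have [M hM] := hf k l; have [K hK] := hg k l.
exists (normc c * M + K) => x; rewrite pderivs_lin//.
have e0 : 0 <= enorm x ^+ k by rewrite exprn_ge0// enorm_ge0.
rewrite (le_trans (ler_wpM2l e0 (ler_normcD _ _)))// mulrDr lerD//.
by rewrite normcM mulrCA ler_wpM2l// normc_ge0.
Qed.

Lemma enorm_affine a b x : a != 0 ->
  enorm x <= Num.sqrt n%:R / `|a| * (enorm (a *: x + b) + `|b|).
Proof.
move=> a0; apply: le_trans (enorm_le_norm _) _.
rewrite -mulrA ler_wpM2l ?sqrtr_ge0// ler_pdivlMl ?normr_gt0//.
rewrite -normrZ -[X in `|X| <= _](addrK b) (le_trans (ler_normB _ _))//.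
by rewrite lerD2r norm_le_enorm.
Qed.

Lemma exprD_le (p q : R) k : 0 <= p -> 0 <= q ->
  (p + q) ^+ k <= 2 ^+ k * (p ^+ k + q ^+ k).
Proof.
move=> p0 q0; wlog pq : p q p0 q0 / p <= q.
  move=> W; have [/W|/ltW/W] := leP p q; first exact.
  by rewrite addrC [X in _ * X]addrC; exact.
apply: (@le_trans _ _ ((2 * q) ^+ k)).
  by rewrite lerXn2r ?nnegrE ?addr_ge0 ?mulr_ge0//; lra.
by rewrite exprMn ler_wpM2l ?exprn_ge0// lerDr exprn_ge0.
Qed.

Lemma schwartz_affine f a b : a != 0 -> schwartz f ->
  schwartz (fun x => f (a *: x + b)).
Proof.
move=> a0 [sf hf]; split; first exact: smooth_affine.
move=> k l; have [M hM] := hf k l; have [M0 hM0] := hf 0%N l.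
pose D := Num.sqrt n%:R / `|a|.
have D0 : 0 <= D by rewrite divr_ge0// sqrtr_ge0.
exists (D ^+ k * 2 ^+ k * `|a| ^+ size l * (M + `|b| ^+ k * M0)) => x.
rewrite pderivs_affine// normcM normcR normrX.
set y := a *: x + b; set N := normc _.
have N0 : 0 <= N by exact: normc_ge0.
have h1 : enorm x ^+ k <= D ^+ k * (2 ^+ k * (enorm y ^+ k + `|b| ^+ k)).
  apply: (@le_trans _ _ ((D * (enorm y + `|b|)) ^+ k)).
    rewrite lerXn2r ?nnegrE ?enorm_ge0//; last exact: enorm_affine.
    by rewrite mulr_ge0// addr_ge0// enorm_ge0.
  by rewrite exprMn ler_wpM2l ?exprn_ge0// exprD_le// enorm_ge0.
have P0 : 0 <= `|a| ^+ size l * N by rewrite mulr_ge0// exprn_ge0.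
apply: (le_trans (ler_wpM2r P0 h1)).
have -> : D ^+ k * (2 ^+ k * (enorm y ^+ k + `|b| ^+ k)) * (`|a| ^+ size l * N) =
  D ^+ k * 2 ^+ k * `|a| ^+ size l * (enorm y ^+ k * N + `|b| ^+ k * N) by ring.
have h2 : enorm y ^+ k * N <= M by exact: hM.
have h3 : `|b| ^+ k * N <= `|b| ^+ k * M0.
  by rewrite ler_wpM2l ?exprn_ge0//; have := hM0 y; rewrite expr0 mul1r.
by apply: ler_wpM2l; [rewrite !mulr_ge0 ?exprn_ge0|exact: lerD].
Qed.

Lemma schwartz0 : schwartz (fun _ : 'rV[R]_n => 0 : R[i]).
Proof.
have P l : pderivs l (fun _ : 'rV[R]_n => 0 : R[i]) = fun=> 0.
  elim: l => [//|i l /= ->]; apply/funext => x.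
  by rewrite /pderiv /= !derive_cst.
split=> [l|k l]; rewrite P.
  split; first by split => x; exact: cst_continuous.
  by move=> i x; split; exact: derivable_cst.
by exists 0 => x; rewrite normc0 mulr0.
Qed.

Lemma schwartz_dilate (e : R) f b : 0 < e -> schwartz f ->
  schwartz (fun x => dilate e f (x + b)).
Proof.
move=> e0 fS; have e1 : e^-1 != 0 by rewrite invr_eq0 gt_eqF.
have := schwartz_lin (e ^- n)%:C (schwartz_affine (e^-1 *: b) e1 fS) schwartz0.
rewrite (_ : (fun x => _) = fun x => dilate e f (x + b))//.
by apply/funext => x; rewrite addr0 /dilate scalerDr.
Qed.

End smooth_closure.

Section seminorm.
Local Open Scope complex_scope.
Context {R : realType} {n : nat}.
Local Notation mu := (lebesgue_rV n).
Implicit Types (x : 'rV[R]_n) (f : 'rV[R]_n -> R[i]).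

(** Finitely many bounds are involved, as lists of a given length over ['I_n] are tuples of a finite
    type; the sum of all of them serves. This makes the [sup] in [schwartz_seminorm] a genuine upper
    bound. *)
Lemma schwartz_uniform_bound f N : schwartz f -> exists M, forall k l x,
  (k <= N)%N -> (size l <= N)%N -> enorm x ^+ k * normc (pderivs l f x) <= M.
Proof.
move=> [_ hf].
have [M hM] : {M : nat -> seq 'I_n -> R | forall k l x,
    enorm x ^+ k * normc (pderivs l f x) <= M k l}.
  exists (fun k l => projT1 (cid (hf k l))) => k l x.
  exact: (projT2 (cid (hf k l))).
exists (\sum_(k < N.+1) \sum_(m < N.+1) \sum_(t : m.-tuple 'I_n) `|M k t|).
move=> k l x kN lN.
apply: (le_trans (hM k l x)); apply: (le_trans (ler_norm _)).
have kN1 : (k < N.+1)%N by []. have lN1 : (size l < N.+1)%N by [].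
rewrite (bigD1 (Ordinal kN1))//= (bigD1 (Ordinal lN1))//= (bigD1 (in_tuple l))//=.
by rewrite -!addrA lerDl !addr_ge0// ?sumr_ge0// => i _; rewrite ?sumr_ge0// => j _; rewrite sumr_ge0.
Qed.

Lemma le_schwartz_seminorm f N k l x : schwartz f -> (k <= N)%N ->
  (size l <= N)%N -> enorm x ^+ k * normc (pderivs l f x) <= schwartz_seminorm N f.
Proof.
move=> fS kN lN; have [M hM] := schwartz_uniform_bound N fS.
apply: sup_ubound; last by exists k, l, x.
by exists M => _ [k' [l' [x' [h1 h2 ->]]]]; exact: hM.
Qed.

Lemma seminorm_weight f x : schwartz f ->
  normc (f x) <= 2 ^+ n * (2 * schwartz_seminorm (2 * n) f) * weight x.
Proof.
move=> fS; have w0 := weight_gt0 x; rewrite -ler_pdivrMr//.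
have h0 := le_schwartz_seminorm (l := [::]) x fS (leq0n (2 * n)) (leq0n _).
have h1 := le_schwartz_seminorm (l := [::]) x fS (leqnn (2 * n)) (leq0n _).
rewrite mulrC; apply: (le_trans (ler_wpM2r (normc_ge0 (f x)) (weightV_le x))).
rewrite -mulrA ler_wpM2l ?exprn_ge0// mulrDl mulr2n mulrDl !mul1r lerD//.
by move: h0; rewrite expr0 mul1r.
Qed.

Lemma N1_le_seminorm : exists C : R, 0 < C /\ forall g : 'rV[R]_n -> R[i],
  schwartz g -> N1 g <= C * schwartz_seminorm (2 * n) g.
Proof.
pose W : R := \int[mu]_x weight x.
have W0 : 0 <= W by apply: Rintegral_ge0 => x _; exact/ltW/weight_gt0.
(* The [+ 1] makes the constant positive, so that [temperate_regular] can divide by it. *)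
exists (2 ^+ n * 2 * W + 1); split.
  by rewrite ltr_wpDl// !mulr_ge0// exprn_ge0.
move=> g gS; set S := schwartz_seminorm _ _.
have S0 : 0 <= S.
  have := le_schwartz_seminorm (l := [::]) 0 gS (leq0n (2 * n)) (leq0n _).
  by apply: le_trans; rewrite expr0 mul1r normc_ge0.
apply: (@le_trans _ _ (2 ^+ n * 2 * W * S)); last by rewrite ler_wpM2r// lerDl.
rewrite mulrAC -RintegralZl//; last exact: integrable_weight.
apply: le_Rintegral => //.
- exact/integrable_normc/tame_integrable/schwartz_tame.
- exact/integrableZR/integrable_weight.
- by move=> x _; rewrite -mulrA mulrA -(mulrA _ 2) seminorm_weight.
Qed.

End seminorm.

(** * From (b) to (a) *)

Section pairing.
Local Open Scope complex_scope.
Context {R : realType} {n : nat}.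
Local Notation mu := (lebesgue_rV n).
Implicit Types (x y xi : 'rV[R]_n) (f g p q h : 'rV[R]_n -> R[i]).

(** Convolution with an even function is symmetric for the bilinear pairing. *)
Lemma pairing_conv p q g M : tame p -> (forall x, p (- x) = p x) ->
  Cintegrable mu q -> Cmeasurable g -> (forall x, normc (g x) <= M) ->
  Cint mu (fun x => q x * convolution p g x) =
  Cint mu (fun y => convolution p q y * g y).
Proof.
move=> tp pe qi mg gM; have pi := tame_integrable tp.
pose G y x := g y * (p (y - x) * q x).
have Gi : Cintegrable (mu \x mu)%E (fun z => G z.1 z.2).
  apply: (CintegrableMl (M := M) _ _ (integrable_convolution_prod pi qi)) => //.
  exact: (Cmeasurable_comp mg).
have -> : Cint mu (fun y => convolution p q y * g y) =
    Cint mu (fun y => Cint mu (G y)).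
  apply: eq_Cint => y; rewrite /G CintZ 1?mulrC//.
  exact: tame_conv_integrable.
rewrite (Cfubini Gi); apply: eq_Cint => x.
rewrite convolutionE -CintZ; last first.
  by apply: (CintegrableMr (M := M)) => //; exact: Cintegrable_sub.
by apply: eq_Cint => y; rewrite /G -pe opprB; ring.
Qed.

Lemma normc_conv_tame p g M : tame p -> Cmeasurable g ->
  (forall x, normc (g x) <= M) -> forall x, normc (convolution p g x) <= M * N1 p.
Proof.
move=> tp mg gM x; rewrite -(convolutionC mg gM (tame_integrable tp)).
exact: normc_convolution gM (tame_integrable tp).
Qed.

(** Evenness acts twice: it rewrites the value at 0 as the integral of [p y * g y], and it moves [p]
    onto [rho] in the pairing. *)
Lemma delta_minus_conv rho p g M : Cintegrable mu rho -> tame p ->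
  (forall x, p (- x) = p x) -> Cmeasurable g -> (forall x, normc (g x) <= M) ->
  delta_minus rho (convolution p g) =
  Cint mu (fun y => (p y - convolution p rho y) * g y).
Proof.
move=> ri tp pe mg gM; have tc := tame_conv tp ri.
change (convolution p g 0 - Cint mu (fun x => rho x * convolution p g x) =
  Cint mu (fun y => (p y - convolution p rho y) * g y)).
rewrite (pairing_conv tp pe ri mg gM) convolutionE -CintB.
- by apply: eq_Cint => y; rewrite sub0r pe mulrBl.
- apply: (CintegrableMr (M := M)) => //; exact: Cintegrable_sub (tame_integrable tp).
- apply: (CintegrableMr (M := M)) => //; exact: tame_integrable.
Qed.

Lemma conv_swap p q g M : tame p -> tame q -> Cmeasurable g ->
  (forall x, normc (g x) <= M) ->
  convolution (convolution p g) q = convolution (convolution p q) g.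
Proof.
move=> tp tq mg gM; have pi := tame_integrable tp; have qi := tame_integrable tq.
rewrite -(convolutionC mg gM pi) (convolutionA mg gM pi qi); last first.
  by move=> x; exact: tame_conv_integrable.
exact: convolutionC gM (tame_integrable (tame_conv tp qi)).
Qed.

Lemma fourier_sub p y xi : Cintegrable mu p ->
  fourier (fun x => p (y - x)) xi = expi (- dotp y xi) * fourier p (- xi).
Proof.
move=> pi; rewrite !fourierE -CintZ; last exact: Cintegrable_fourier.
rewrite -[RHS](Cint_sub y); last exact/CintegrableZ/Cintegrable_fourier.
apply: eq_Cint => x; rewrite mulrCA -expiD; congr (_ * expi _).
by rewrite dotpNr opprK dotpBl; ring.
Qed.

(* Vanishes where [h] does, since [0^-1 = 0]. *)
Definition conj_sign h x : R[i] := (h x)^* * ((normc (h x))^-1)%:C.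

Lemma conj_signE h x : h x * conj_sign h x = (normc (h x))%:C.
Proof.
rewrite /conj_sign mulrA mul_conjc -rmorphM/=; congr (_%:C).
have [->|h0] := eqVneq (normc (h x)) 0; first by rewrite invr0 mulr0.
by rewrite expr2 mulfK.
Qed.

Lemma conj_sign_le1 h x : normc (conj_sign h x) <= 1.
Proof.
rewrite normcM normc_conj normcR ger0_norm ?invr_ge0 ?normc_ge0//.
have [->|h0] := eqVneq (normc (h x)) 0; first by rewrite invr0 mulr0.
by rewrite mulfV.
Qed.

Lemma Cmeasurable_conj_sign h : Cmeasurable h -> Cmeasurable (conj_sign h).
Proof.
move=> mh; have [m1 m2] := mh; apply: CmeasurableM.
  split.
    rewrite (_ : (fun x => _) = fun x => complex.Re (h x))//.
    by apply/funext => x; case: (h x).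
  rewrite (_ : (fun x => _) = fun x => - complex.Im (h x)).
    exact: measurable_funN.
  by apply/funext => x; case: (h x).
split; last exact: measurable_cst.
rewrite (_ : (fun x => _) = (fun a : R => a `^ (-1)) \o (fun x => normc (h x))).
  by apply: measurableT_comp; [exact: measurable_powR|exact: measurable_normc].
by apply/funext => x /=; rewrite powR_inv1// normc_ge0.
Qed.

Lemma cLnorm_oo_le f (M : R) : 0 <= M -> (forall x, normc (f x) <= M) ->
  (cLnorm +oo f <= M%:E)%E.
Proof.
move=> M0 fM; rewrite /cLnorm unlock; case: ifPn => _; last by rewrite lee_fin.
apply/ess_supP; apply: nearW => x /=.
by rewrite lee_fin ger0_norm ?normc_ge0.
Qed.

End pairing.

(** * Bounded continuous functions as temperate distributions *)

Section bounded_distribution.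
Local Open Scope complex_scope.
Context {R : realType} {n : nat}.
Local Notation mu := (lebesgue_rV n).
Implicit Types (x y xi : 'rV[R]_n) (f g psi : 'rV[R]_n -> R[i]).

(* Evaluated on Fourier transforms that are not known to be integrable, hence
   the junk value. *)
Definition regular f : functional R n := fun psi =>
  if `[< Cintegrable mu psi >] then Cint mu (fun x => f x * psi x) else 0.

Variable f : 'rV[R]_n -> R[i].
Variable M : R.
Hypothesis cf : ccontinuous f.
Hypothesis fM : forall x, normc (f x) <= M.

Let mf : Cmeasurable f. Proof. exact: ccontinuous_Cmeasurable. Qed.

Let fi psi : Cintegrable mu psi -> Cintegrable mu (fun x => f x * psi x).
Proof. exact: CintegrableMl fM. Qed.

Lemma regularE psi : Cintegrable mu psi ->
  regular f psi = Cint mu (fun x => f x * psi x).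
Proof. by move=> pi; rewrite /regular asboolT. Qed.

Lemma represents_regular : represents (regular f) f.
Proof.
split=> // psi /schwartz_tame/tame_integrable pi; split; first exact: fi.
exact: regularE.
Qed.

Lemma temperate_regular : temperate (regular f).
Proof.
have SI psi : schwartz psi -> Cintegrable mu psi.
  by move=> /schwartz_tame/tame_integrable.
have lin (a : R[i]) psi chi : schwartz psi -> schwartz chi ->
    regular f (fun x => a * psi x + chi x) = a * regular f psi + regular f chi.
  move=> /SI pi /SI ci; rewrite !regularE//; last first.
    by apply: CintegrableD => //; exact: CintegrableZ.
  rewrite -(CintZ a (fi pi)) -(CintD (CintegrableZ a (fi pi)) (fi ci)).
  by apply: eq_Cint => x; ring.
split=> // psi psiS e e0.
have [C [C0 hC]] := @N1_le_seminorm R n.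
have M0 : 0 <= M by apply: le_trans (fM 0); exact: normc_ge0.
pose M1 := M + 1; have M1p : 0 < M1 by rewrite /M1; lra.
exists (2 * n)%N, (e / (M1 * C)); split; first by rewrite divr_gt0// mulr_gt0.
move=> chi chiS.
have dS : schwartz (fun x => chi x - psi x).
  have := schwartz_lin (-1) psiS chiS.
  by under eq_fun do rewrite mulN1r addrC.
move=> hd.
have -> : regular f chi - regular f psi = Cint mu (fun x => f x * (chi x - psi x)).
  rewrite (regularE (SI _ chiS)) (regularE (SI _ psiS)).
  rewrite -(CintB (fi (SI _ chiS)) (fi (SI _ psiS))).
  by apply: eq_Cint => x; rewrite mulrBr.
apply: (@le_lt_trans _ _ (M1 * N1 (fun x => chi x - psi x))).
  rewrite -RintegralZl//; last exact/integrable_normc/SI.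
  apply: le_normc_Cint.
  - exact/CmeasurableM/Cintegrable_meas/SI.
  - exact/integrableZR/integrable_normc/SI.
  - move=> x; rewrite normcM ler_wpM2r ?normc_ge0// (le_trans (fM x))//.
    by rewrite lerDl.
rewrite -ltr_pdivlMl// (le_lt_trans (hC _ dS))// -ltr_pdivlMl//.
by rewrite (lt_le_trans hd)// le_eqVlt; apply/orP; left; apply/eqP; rewrite invfM; ring.
Qed.

End bounded_distribution.

Section dsupp.
Context {R : realType} {n : nat}.
Implicit Types (T : functional R n).

Lemma closed_dsupp T : closed (dsupp T).
Proof.
rewrite (_ : dsupp T = ~` \bigcup_(U in [set U | open U /\ vanishes_on T U]) U).
  by apply: open_closedC; apply: bigcup_open => U [].
apply/seteqP; split=> [x nx [U [oU vU] Ux]|x nx [U [oU Ux vU]]].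
  by apply: nx; exists U.
by apply: nx; exists U.
Qed.

End dsupp.

(** * The elements of X on which property (b) is tested *)

Section test_function.
Local Open Scope complex_scope.
Context {R : realType} {n : nat}.
Local Notation mu := (lebesgue_rV n).
Implicit Types (x y xi : 'rV[R]_n) (psi q : 'rV[R]_n -> R[i]).
Variables (s : R) (zeta phi : 'rV[R]_n -> R[i]).
Hypotheses (s0 : 0 < s) (zetaS : schwartz zeta) (phiS : schwartz phi).
Hypothesis hat_zeta0 : forall xi, 2 <= enorm xi -> fourier zeta xi = 0.
Hypothesis hat_zeta1 : forall xi, enorm xi <= 1 -> fourier zeta xi = 1.
Hypothesis phiE : forall x, phi x = dilate 2^-1 zeta x - zeta x.
Hypothesis phi_even : forall x, phi (- x) = phi x.
Variable N : nat.
Variable g : nat -> 'rV[R]_n -> R[i].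
Hypotheses (mg : forall i, Cmeasurable (g i)) (g1 : forall i x, normc (g i x) <= 1).
Local Notation r := (2 `^ s).

Let p i := dilate (2 ^+ i.+1) phi.
Let c i : R[i] := (r ^+ i.+1)%:C.

(** The i-th term lives around the block of index j = -(i+1), which the norm of X weighs by 2^(sj);
    the coefficient [c i] is the inverse of this weight. *)
Definition test_function x : R[i] :=
  \sum_(i < N) c i * convolution (p i) (g i) x.

Local Notation f := test_function.

Let t0 i : 0 < 2 ^+ i.+1 :> R. Proof. exact: exprn_gt0. Qed.

Let r_ge1 : 1 <= r.
Proof. exact/ltW/powR2_gt1. Qed.

Let rk0 k : 0 <= r ^+ k. Proof. by rewrite exprn_ge0// powR_ge0. Qed.

Let dp i : decays (p i).
Proof.
apply: schwartz_decays; have := schwartz_dilate 0 (t0 i) phiS.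
by under eq_fun do rewrite addr0.
Qed.

Let tp i : tame (p i). Proof. exact: decays_tame. Qed.

Let pE i x : p i (- x) = p i x.
Proof. by rewrite /p /dilate scalerN phi_even. Qed.

Let N1p i : N1 (p i) = N1 phi.
Proof. by apply: N1_dilate => //; exact/tame_integrable/schwartz_tame. Qed.

Let fi_bound i x : normc (convolution (p i) (g i) x) <= N1 phi.
Proof. by have := normc_conv_tame (tp i) (mg i) (g1 i) x; rewrite mul1r N1p. Qed.

Let cfi i : ccontinuous (convolution (p i) (g i)).
Proof. by have [] := decays_conv_bounded (dp i) (mg i) (g1 i). Qed.

Let mfi i : Cmeasurable (convolution (p i) (g i)).
Proof. exact: ccontinuous_Cmeasurable. Qed.

Lemma ccontinuous_test_function : ccontinuous f.
Proof.
rewrite /f; elim: N => [|k IH].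
  by rewrite (_ : (fun x => _) = fun=> 0); [split => x; exact: cst_continuous|apply/funext => x; rewrite big_ord0].
rewrite (_ : (fun x => _) = fun x => c k * convolution (p k) (g k) x +
   \sum_(i < k) c i * convolution (p i) (g i) x); last first.
  by apply/funext => x; rewrite big_ord_recr/= addrC.
exact: ccontinuous_lin.
Qed.

Lemma test_function_bounded : exists M, forall x, normc (f x) <= M.
Proof.
exists (\sum_(i < N) normc (c i) * N1 phi) => x.
apply: le_trans (ler_normc_sum _ _ _) _; apply: ler_sum => i _.
by rewrite normcM ler_wpM2l ?normc_ge0.
Qed.

Lemma test_function_pairing q : Cintegrable mu q ->
  Cint mu (fun x => q x * f x) =
  \sum_(i < N) c i * Cint mu (fun y => convolution (p i) q y * g i y).
Proof.
move=> qi.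
have I i : Cintegrable mu (fun x => q x * convolution (p i) (g i) x).
  exact: (CintegrableMr qi (mfi i) (fi_bound i)).
have -> : Cint mu (fun x => q x * f x) =
   Cint mu (fun x => \sum_(i < N) c i * (q x * convolution (p i) (g i) x)).
  by apply: eq_Cint => x; rewrite mulr_sumr; apply: eq_bigr => i _; rewrite mulrCA.
rewrite (Cint_sum _ (fun i : 'I_N => CintegrableZ (c i) (I i))).
apply: eq_bigr => i _; rewrite (CintZ (c i) (I i)); congr (_ * _).
exact: pairing_conv (tp i) (pE i) qi (mg i) (g1 i).
Qed.

Lemma test_function_conv q x : tame q ->
  convolution f q x =
  \sum_(i < N) c i * convolution (convolution (p i) q) (g i) x.
Proof.
move=> tq; have qi := tame_integrable tq.
have I i : Cintegrable mu (fun y => convolution (p i) (g i) (x - y) * q y).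
  apply: (CintegrableMl (M := N1 phi)) => //.
  exact: Cmeasurable_sub.
rewrite convolutionE.
have -> : Cint mu (fun y => f (x - y) * q y) = Cint mu (fun y =>
    \sum_(i < N) c i * (convolution (p i) (g i) (x - y) * q y)).
  by apply: eq_Cint => y; rewrite mulr_suml; apply: eq_bigr => i _; rewrite mulrA.
rewrite (Cint_sum _ (fun i : 'I_N => CintegrableZ (c i) (I i))).
apply: eq_bigr => i _; rewrite (CintZ (c i) (I i)); congr (_ * _).
by rewrite -(conv_swap (tp i) tq (mg i) (g1 i)).
Qed.

(** The multiplication formula turns the pairing with the transform of [psi] into integrals of [psi]
    against dilates of the transform of [phi], up to a character; the hypothesis makes these vanish
    wherever [psi] does not. *)
Lemma test_function_vanishes (U : set 'rV[R]_n) :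
  (forall i xi, (i < N)%N -> U xi -> fourier phi (- (2 ^+ i.+1 *: xi)) = 0) ->
  vanishes_on (dfourier (regular f)) U.
Proof.
(* If the transform of [psi] is not integrable, the junk value 0 is already the claim. *)
move=> hU psi psiS _ sU; rewrite /dfourier /regular; case: asboolP => // Fi.
have pi := tame_integrable (schwartz_tame psiS).
have -> : Cint mu (fun x => f x * fourier psi x) =
    Cint mu (fun x => fourier psi x * f x) by apply: eq_Cint => x; rewrite mulrC.
rewrite test_function_pairing// big1// => i _.
rewrite (_ : (fun y => _) = fun=> 0); last first.
  apply/funext => y; rewrite convolutionE.
  have -> : Cint mu (fun x => p i (y - x) * fourier psi x) =
      Cint mu (fun x => fourier psi x * p i (y - x)).
    by apply: eq_Cint => x; rewrite mulrC.
  have pyi := Cintegrable_sub y (tame_integrable (tp i)).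
  rewrite (multiplication_formula pi pyi).
  rewrite (_ : (fun x => _) = fun=> 0); first by rewrite /Cint /= /Rintegral integral0 mul0r.
  apply/funext => xi; have [->|px] := eqVneq (psi xi) 0; first by rewrite mul0r.
  rewrite fourier_sub; last exact: tame_integrable.
  rewrite fourier_dilate//; last exact/tame_integrable/schwartz_tame.
  by rewrite scalerN hU ?mulr0//; apply: sU; exact: subset_closure.
by rewrite /Cint /= /Rintegral integral0 mulr0.
Qed.

Let hat_phi0 xi : enorm xi <= 1 \/ 4 <= enorm xi -> fourier phi (- xi) = 0.
Proof.
move=> h; apply: (fourier_phi0 zetaS hat_zeta0 hat_zeta1 phiE).
by rewrite -scaleN1r enormZ normrN normr1 mul1r.
Qed.

Lemma test_function_dsupp0 : ~ dsupp (dfourier (regular f)) 0.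
Proof.
(* For [xi] of sup norm below [D^-1] and [i < N], the Euclidean norm of [2 ^+ i.+1 *: xi] is at most
   1, where the transform of [phi] vanishes; [+ 1] keeps [D] positive. *)
pose D : R := Num.sqrt n%:R * 2 ^+ N + 1.
have D0 : 0 < D by rewrite ltr_wpDl// mulr_ge0 ?sqrtr_ge0 ?exprn_ge0.
apply; exists (ball (0 : 'rV[R]_n) D^-1); split.
- exact: ball_open.
- by apply: ballxx; rewrite invr_gt0.
apply: test_function_vanishes => i xi iN.
rewrite -ball_normE/= sub0r normrN => xiD; apply: hat_phi0; left.
rewrite enormZ gtr0_norm//.
apply: (@le_trans _ _ (2 ^+ N * (Num.sqrt n%:R * D^-1))).
  apply: ler_pM; [exact: ltW|exact: enorm_ge0| |].
    by rewrite ler_weXn2l// ler1n.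
  by rewrite (le_trans (enorm_le_norm xi))// ler_wpM2l ?sqrtr_ge0// ltW.
by rewrite mulrA ler_pdivrMr// mul1r /D mulrC lerDl.
Qed.

Lemma test_function_dsupp_compact : compact (dsupp (dfourier (regular f))).
Proof.
apply: bounded_closed_compact; last exact: closed_dsupp.
(* The transform of [phi] vanishes from norm 4 on, and dilating by [2 ^+ i.+1] only shrinks its
   support. *)
exists 4; split; first exact: num_real.
move=> M M4 xi hxi; rewrite /= leNgt; apply/negP => Mxi; apply: hxi.
exists [set y | M < `|y|]; split => //.
  exact: (open_comp (fun x _ => @norm_continuous _ _ x) (@open_gt _ M)).
apply: test_function_vanishes => i y _ /= My; apply: hat_phi0; right.
rewrite enormZ gtr0_norm//.
have h1 : 1 <= 2 ^+ i.+1 :> R by rewrite exprn_ege1//; lra.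
have h2 := norm_le_enorm y.
have h3 : 4 <= enorm y by lra.
by rewrite -[4]mul1r ler_pM.
Qed.

Lemma sharp0_bound x :
  normc (sharp zeta phi f 0 x) <= r * (N1 phi * (1 + N1 zeta)).
Proof.
have tz := schwartz_tame zetaS; have zi := tame_integrable tz.
rewrite /sharp eqxx test_function_conv// /f -sumrB.
apply: le_trans (ler_normc_sum _ _ _) _.
(* For [i > 0], [4 <= 2 ^+ i.+1], so convolution with [zeta] leaves [p i] unchanged and the two
   terms cancel. *)
apply: (@le_trans _ _ (\sum_(i < N) if i == 0%N :> nat then r * (N1 phi * (1 + N1 zeta)) else 0)).
  apply: ler_sum => i _; rewrite -mulrBr normcM.
  case: ifPn => [/eqP i0|i0].
    rewrite /c i0 expr1 normcR ger0_norm ?powR_ge0// ler_wpM2l ?powR_ge0//.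
    rewrite (le_trans (ler_normcB _ _))// mulrDr mulr1 lerD//.
    have := normc_conv_tame (tame_conv (tp 0) zi) (mg 0) (g1 0) x.
    rewrite mul1r -(N1p 0) => /le_trans; apply.
    exact: N1_conv.
  have := conv_phi_zeta zetaS hat_zeta0 hat_zeta1 phiE (t := 2 ^+ i.+1) (u := 1) ltr01.
  rewrite dilate1 /p => ->; first by rewrite subrr normc0 mulr0.
  rewrite mulr1; case: (nat_of_ord i) i0 => // k _.
  by rewrite !exprS; have : 1 <= 2 ^+ k :> R; [rewrite exprn_ege1//|]; lra.
have B0 : 0 <= r * (N1 phi * (1 + N1 zeta)).
  by rewrite !mulr_ge0 ?powR_ge0 ?N1_ge0// addr_ge0// N1_ge0.
case: {+}N => [|k]; first by rewrite big_ord0.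
by rewrite big_ord_recl/= big1// addr0.
Qed.

Lemma sharpN_bound k x :
  normc (convolution f (dilate (2 ^+ k.+1) phi) x) <=
  r ^+ k.+1 * (3 * r * (N1 phi * N1 phi)).
Proof.
rewrite test_function_conv; last exact: tp.
apply: le_trans (ler_normc_sum _ _ _) _.
(* [r ^+ k.+2] is the largest coefficient among the indices [k.-1], [k] and [k.+1] that can
   contribute. *)
pose B := r ^+ k.+2 * (N1 phi * N1 phi).
have B0 : 0 <= B := mulr_ge0 (rk0 _) (mulr_ge0 (N1_ge0 _) (N1_ge0 _)).
pose e (j : nat) (i : 'I_N) : R := if i == j :> nat then B else 0.
have e0 j i : 0 <= e j i by rewrite /e; case: ifP.
have e1 j : \sum_(i < N) e j i <= B.
  have [jN|Nj] := ltnP j N; last first.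
    rewrite big1// => i _; rewrite /e ifF//; apply/negbTE.
    by apply: contraTneq (ltn_ord i) => ->; rewrite -leqNgt.
  rewrite (bigD1 (Ordinal jN))//= /e eqxx big1 ?addr0// => i ij.
  by rewrite ifF//; apply: contraNF ij => /eqP h; apply/eqP/val_inj.
(* For [k = 0] the index [k.-1] is [k] again and is counted twice, which an upper bound allows. *)
apply: (@le_trans _ _ (\sum_(i < N) (e k.-1 i + e k i + e k.+1 i))); last first.
  rewrite !big_split/=; apply: le_trans (lerD (lerD (e1 _) (e1 _)) (e1 _)) _.
  by rewrite /B exprS le_eqVlt; apply/orP; left; apply/eqP; ring.
have four a b : (a.+2 <= b)%N -> 4 * 2 ^+ a <= 2 ^+ b :> R.
  move=> ab; rewrite [4](_ : _ = 2 ^+ 2) ?expr2 -?exprD; last by rewrite -natrM.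
  by rewrite -expr2 -exprD ler_weXn2l ?ler1n.
apply: ler_sum => i _.
(* [near_] says that [i] is none of the three indices: the dilations then differ by a factor of at
   least 4, so [conv_phi_phi] applies. [far] is the opposite case. *)
have [far|near_] := boolP [|| i == k.-1 :> nat, i == k :> nat | i == k.+1 :> nat]; last first.
  rewrite (_ : convolution _ _ _ = 0) ?mulr0 ?normc0 ?addr_ge0//.
  rewrite (_ : convolution (p i) _ = fun=> 0); last first.
    apply/funext => y.
    have [ik|ki] := leqP i k.
      rewrite (tame_convC (tp i) (tame_integrable (tp k))).
      apply: (conv_phi_phi zetaS hat_zeta0 hat_zeta1 phiE) => //.
      have : (i.+2 <= k)%N by case: (k) ik near_ => [|k'] /=; lia.
      exact: (four i.+1 k.+1).
    apply: (conv_phi_phi zetaS hat_zeta0 hat_zeta1 phiE) => //.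
    have : (k.+2 <= i)%N by lia.
    exact: (four k.+1 i.+1).
  rewrite convolutionE; under eq_Cint do rewrite mul0r.
  by rewrite /Cint /= /Rintegral integral0.
have : normc (c i * convolution (convolution (p i) (p k)) (g i) x) <= B.
  rewrite normcM normcR ger0_norm//; apply: ler_pM => //; first exact: normc_ge0.
    by rewrite ler_weXn2l//; lia.
  have tc := tame_conv (tp i) (tame_integrable (tp k)).
  have := normc_conv_tame tc (mg i) (g1 i) x; rewrite mul1r => /le_trans; apply.
  by rewrite -{1}(N1p i) -(N1p k); apply: N1_conv => //; exact: tame_integrable.
move=> /le_trans; apply.
have := e0 k.-1 i; have := e0 k i; have := e0 k.+1 i; move: far.
by rewrite /e => /or3P[] -> ; lra.
Qed.

Lemma X_norm_ge0 h : (0 <= X_norm s zeta phi h)%E.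
Proof.
apply: (@le_trans _ _ ((2 `^ (s * 0%:~R))%:E * cLnorm +oo (sharp zeta phi h 0))%E).
  by rewrite mule_ge0 ?lee_fin ?powR_ge0// Lnorm_ge0.
by apply: ereal_sup_ubound; exists 0.
Qed.

(** It depends neither on the number of terms nor on the functions [g]: this uniformity lets (b)
    bound all partial sums at once. *)
Definition test_bound : R :=
  r * (N1 phi * (1 + N1 zeta)) + 3 * r * (N1 phi * N1 phi).

Lemma test_function_X_norm : (X_norm s zeta phi f <= test_bound%:E)%E.
Proof.
have b1 : 0 <= r * (N1 phi * (1 + N1 zeta)).
  by rewrite !mulr_ge0 ?powR_ge0 ?N1_ge0// addr_ge0// N1_ge0.
have b2 : 0 <= 3 * r * (N1 phi * N1 phi).
  by rewrite !mulr_ge0 ?powR_ge0 ?N1_ge0.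
apply: ge_ereal_sup => _ [[[|//]|k] /= _ <-].
  rewrite mulr0 powRr0 mul1e (le_trans (cLnorm_oo_le b1 sharp0_bound))//.
  by rewrite lee_fin lerDl.
have b3 : 0 <= r ^+ k.+1 * (3 * r * (N1 phi * N1 phi)) by rewrite mulr_ge0.
have h := cLnorm_oo_le b3 (sharpN_bound k).
have -> : 2 `^ (s * (Negz k)%:~R) = (r ^+ k.+1)^-1.
  by rewrite NegzE mulrNz mulrN powRN powRrM powR_mulrn// powR_ge0.
have rk : 0 <= (r ^+ k.+1)^-1 by rewrite invr_ge0.
have := lee_wpmul2l (x := ((r ^+ k.+1)^-1)%:E) _ h; rewrite lee_fin => /(_ rk) => h'.
apply: le_trans h' _; rewrite -EFinM lee_fin mulKf; first by rewrite lerDr.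
by rewrite expf_neq0// gt_eqF// (lt_le_trans ltr01).
Qed.

Lemma test_function_in_X : in_X s zeta phi (regular f) f.
Proof.
have [M fM] := test_function_bounded; have cf := ccontinuous_test_function.
split.
- exact: temperate_regular fM.
- exact: test_function_dsupp_compact.
- exact: test_function_dsupp0.
- exact: represents_regular fM.
- exact: le_lt_trans test_function_X_norm (ltry _).
Qed.

Lemma delta_minus_test_function rho : Cintegrable mu rho ->
  delta_minus rho f =
  \sum_(i < N) c i * Cint mu (fun y => (p i y - convolution (p i) rho y) * g i y).
Proof.
move=> ri; change (f 0 - Cint mu (fun x => rho x * f x) =
  \sum_(i < N) c i * Cint mu (fun y => (p i y - convolution (p i) rho y) * g i y)).
rewrite test_function_pairing// /f -sumrB; apply: eq_bigr => i _.
rewrite -mulrBr -(delta_minus_conv ri (tp i) (pE i) (mg i) (g1 i)).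
rewrite -(pairing_conv (tp i) (pE i) ri (mg i) (g1 i)).
by [].
Qed.

End test_function.

Section necessity.
Local Open Scope complex_scope.
Context {R : realType} {n : nat}.
Local Notation mu := (lebesgue_rV n).
Variables (s : R) (zeta phi rho : 'rV[R]_n -> R[i]).
Hypotheses (s0 : 0 < s) (zetaS : schwartz zeta) (phiS : schwartz phi).
Hypothesis hat_zeta0 : forall xi, 2 <= enorm xi -> fourier zeta xi = 0.
Hypothesis hat_zeta1 : forall xi, enorm xi <= 1 -> fourier zeta xi = 1.
Hypothesis phiE : forall x, phi x = dilate 2^-1 zeta x - zeta x.
Hypothesis phi_even : forall x, phi (- x) = phi x.
Hypothesis rhoi : Cintegrable mu rho.

Lemma sum_defect_phi (C : R) :
  (forall (T : functional R n) f, in_X s zeta phi T f ->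
    ((normc (delta_minus rho f))%:E <= C%:E * X_norm s zeta phi f)%E) ->
  forall N, \sum_(k < N) (2 `^ s) ^+ k.+1 * defect rho (dilate (2 ^+ k.+1) phi) <=
    `|C| * test_bound s zeta phi.
Proof.
move=> hC N; pose p i := dilate (2 ^+ i.+1) phi.
pose h i x := p i x - convolution (p i) rho x.
pose g i := conj_sign (h i).
have ti i : tame (h i).
  by apply: tame_defect => //; apply: tame_dilate; [exact: exprn_gt0|exact: schwartz_tame].
have mg i : Cmeasurable (g i) by exact/Cmeasurable_conj_sign/tame_meas.
have g1 i x : normc (g i x) <= 1 by exact: conj_sign_le1.
have fX := test_function_in_X s0 zetaS phiS hat_zeta0 hat_zeta1 phiE phi_even N mg g1.
have := hC _ _ fX.
rewrite (delta_minus_test_function s phiS phi_even N mg g1 rhoi).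
set S := \sum_(i < N) _; set S' := \sum_(k < N) _.
have S0 : 0 <= S'.
  by apply: sumr_ge0 => i _; rewrite mulr_ge0 ?defect_ge0// exprn_ge0// powR_ge0.
have -> : S = S'%:C.
  rewrite /S' rmorph_sum; apply: eq_bigr => i _; rewrite rmorphM/=; congr (_ * _).
  by rewrite /defect /N1 -CintR; apply: eq_Cint => y; rewrite -(conj_signE (h i) y).
rewrite normcR ger0_norm// => hS.
have hX : (X_norm s zeta phi (test_function s phi N g) <= (test_bound s zeta phi)%:E)%E.
  exact: test_function_X_norm.
rewrite -lee_fin; apply: (le_trans hS).
(* [C] may be negative; its absolute value allows the norm to be replaced by the larger
   [test_bound]. *)
rewrite EFinM; apply: (@le_trans _ _ (`|C|%:E * X_norm s zeta phi (test_function s phi N g))%E).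
  by rewrite lee_wpmul2r ?lee_fin ?ler_norm// X_norm_ge0.
by rewrite lee_wpmul2l// lee_fin.
Qed.

End necessity.

(** * Fourier transforms of rapidly decaying functions *)

Section derive_Cint.
Local Open Scope complex_scope.
Context {R : realType} d {T : measurableType d}.
Variable mu : {measure set T -> \bar R}.
Implicit Types (g : T -> R[i]) (z : R[i]).

Lemma is_derive_expi_Re z (b c h : R) :
  is_derive h 1 (fun h => complex.Re (z * expi (b * h + c)))
    (complex.Re ((0 +i* b) * (z * expi (b * h + c)))).
Proof.
have hl : is_derive h 1 (fun h : R => b * h + c) b.
  have := is_deriveD (is_deriveZ b (is_derive_id h (1 : R))) (is_derive_cst c h 1).
  by rewrite addr0 /GRing.scale/= mulr1.
have hc := is_derive1_comp (g := fun h : R => b * h + c) (is_derive_cos (b * h + c)) hl.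
have hs := is_derive1_comp (g := fun h : R => b * h + c) (is_derive_sin (b * h + c)) hl.
have := is_deriveB (is_deriveZ (complex.Re z) hc) (is_deriveZ (complex.Im z) hs).
rewrite (_ : complex.Re z *: _ - _ = fun h => complex.Re (z * expi (b * h + c))).
  move=> H; apply: (is_derive_eq H); rewrite /GRing.scale/= ReM ImM /=; ring.
by apply/funext => k; rewrite ReM.
Qed.

(** Differentiation under the integral sign: the derivative in [h] of the integrand is bounded by
    the modulus of [b x * g x], whatever [h]. *)
Lemma derive_Cint_Re g (b c : T -> R) : measurable_fun setT b ->
  measurable_fun setT c -> Cintegrable mu g ->
  Cintegrable mu (fun x => (0 +i* b x) * g x) ->
  h^-1 *: (complex.Re (Cint mu (fun x => g x * expi (b x * h + c x))) -
     complex.Re (Cint mu (fun x => g x * expi (c x)))) @[h --> 0^'] -->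
  complex.Re (Cint mu (fun x => (0 +i* b x) * (g x * expi (c x)))).
Proof.
move=> mb mc gi bgi.
pose f h x := complex.Re (g x * expi (b x * h + c x)).
pose G x := normc ((0 +i* b x) * g x).
have fi h : mu.-integrable setT (EFin \o f h).
  apply: (proj1 (_ : Cintegrable mu (fun x => g x * expi (b x * h + c x)))).
  apply: (CintegrableMr (M := 1) gi).
    apply: Cmeasurable_expi; apply: measurable_funD => //.
    exact: measurable_funM.
  by move=> x; rewrite normc_expi.
have D h x : (partial1of2 f) h x = complex.Re ((0 +i* b x) * (g x * expi (b x * h + c x))).
  rewrite partial1of2E.
  exact: (@derive_val _ _ _ _ _ _ _ (is_derive_expi_Re (g x) (b x) (c x) h)).
have := @cvg_differentiation_under_integral R _ _ mu f setT measurableT 0 (-1) 1 _ _ _ G.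
move=> /(_ _ (fun x _ => fi x)) => H.
have : h^-1 *: (\int[mu]_(y in setT) f (h + 0) y - \int[mu]_(y in setT) f 0 y) @[h --> 0^'] -->
    \int[mu]_(y in setT) partial1of2 f 0 y.
  apply: H.
  - by rewrite /= in_itv/=; lra.
  - move=> h x _ _.
    exact: (@ex_derive _ _ _ _ _ _ _ (is_derive_expi_Re (g x) (b x) (c x) h)).
  - by move=> x; exact: normc_ge0.
  - exact: integrable_normc.
  - move=> h x _ _; rewrite D (le_trans (Re_le_normc _))//.
    by rewrite mulrA normcM normc_expi mulr1.
have -> : \int[mu]_y partial1of2 f 0 y =
    complex.Re (Cint mu (fun x => (0 +i* b x) * (g x * expi (c x)))).
  by apply: eq_Rintegral => x _; rewrite D mulr0 add0r.
apply: cvg_trans; apply: near_eq_cvg; apply: nearW => h /=.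
rewrite addr0; congr (_ *: (_ - _)).
by apply: eq_Rintegral => x _; rewrite /f mulr0 add0r.
Qed.

End derive_Cint.

Section rapid.
Local Open Scope complex_scope.
Context {R : realType} {n : nat}.
Local Notation mu := (lebesgue_rV n).
Implicit Types (x y xi : 'rV[R]_n) (f g : 'rV[R]_n -> R[i]).

(** Decay of every order but no derivatives: stable under multiplication by coordinates without a
    Leibniz rule, and enough for the transform to be smooth. *)
Definition rapid g := ccontinuous g /\
  forall k, exists C : R, forall x, enorm x ^+ k * normc (g x) <= C * weight x.

Lemma rapid_tame g : rapid g -> tame g.
Proof.
move=> [cg hg]; apply: decays_tame; split => //.
by have [C hC] := hg 0%N; exists C => x; have := hC x; rewrite expr0 mul1r.
Qed.

Lemma schwartz_rapid g : schwartz g -> rapid g.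
Proof.
move=> gS; split; first exact: schwartz_ccontinuous.
by move=> k; exact: schwartz_bound.
Qed.

(** Multiplication by - i x_j, which the Fourier transform turns into the j-th partial
    derivative. *)
Definition mulX (j : 'I_n) g x : R[i] := (0 +i* (- x ord0 j)) * g x.

Lemma normc_mulX j g x : normc (mulX j g x) = `|x ord0 j| * normc (g x).
Proof.
rewrite normcM; congr (_ * _).
by rewrite /normc/= expr0n/= add0r sqrrN sqrtr_sqr.
Qed.

Lemma rapid_mulX j g : rapid g -> rapid (mulX j g).
Proof.
move=> [cg hg]; split.
  have [g1 g2] := cg; have cj := @coord_continuous R 1 n ord0 j.
  split.
    rewrite (_ : (fun x => _) = fun x => x ord0 j * complex.Im (g x)).
      by move=> x; exact: (cvgM (cj x) (g2 x)).
    by apply/funext => x; rewrite /mulX ReM /=; ring.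
  rewrite (_ : (fun x => _) = fun x => - (x ord0 j * complex.Re (g x))).
    by move=> x; exact: (cvgN (cvgM (cj x) (g1 x))).
  by apply/funext => x; rewrite /mulX ImM /=; ring.
move=> k; have [C hC] := hg k.+1; exists C => x.
apply: le_trans (hC x); rewrite normc_mulX exprSr -mulrA.
rewrite ler_wpM2l ?exprn_ge0 ?enorm_ge0// ler_wpM2r ?normc_ge0//.
exact: coord_le_enorm.
Qed.

Lemma fourier_deriv_cvg g j xi : rapid g ->
  h^-1 *: (complex.Re (fourier g (h *: delta_mx ord0 j + xi)) -
     complex.Re (fourier g xi)) @[h --> 0^'] -->
  complex.Re (fourier (mulX j g) xi).
Proof.
move=> rg; have gi := tame_integrable (rapid_tame rg).
have bgi := tame_integrable (rapid_tame (rapid_mulX j rg)).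
have mb : measurable_fun setT (fun x : 'rV[R]_n => - x ord0 j).
  by apply: measurable_funN; exact: measurable_coord.
have mc : measurable_fun setT (fun x : 'rV[R]_n => - dotp x xi).
  apply: measurable_funN; exact: (continuous_rV_measurable (continuous_dotp (xi := xi))).
have := derive_Cint_Re mb mc gi bgi.
rewrite (_ : Cint mu (fun x => _ * (g x * _)) = fourier (mulX j g) xi); last first.
  by apply: eq_Cint => x; rewrite /mulX mulrA.
apply: cvg_trans; apply: near_eq_cvg; apply: nearW => h.
congr (_ *: (complex.Re _ - _)); apply: eq_Cint => x.
congr (_ * expi _); rewrite dotpDr dotpZr.
have -> : dotp x (delta_mx ord0 j) = x ord0 j.
  rewrite /dotp (bigD1 j)//= mxE !eqxx mulr1 big1 ?addr0// => i ij.
  by rewrite mxE (negbTE ij) andbF mulr0.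
ring.
Qed.

Lemma fourier_pderiv g j xi : rapid g ->
  cderivable (fourier g) xi (delta_mx ord0 j) /\
  pderiv j (fourier g) xi = fourier (mulX j g) xi.
Proof.
move=> rg; have h1 := @fourier_deriv_cvg g j xi rg.
(* As Im z = Re (- i z), the imaginary part for [g] is the real part for [g']. *)
pose g' x := (0 +i* (-1)) * g x.
have rg' : rapid g'.
  have [cg hg] := rg; split.
    have := ccontinuous_lin (0 +i* (-1)) cg (proj1 (schwartz_rapid (@schwartz0 R n))).
    by under [X in ccontinuous X -> _]eq_fun do rewrite addr0.
  move=> k; have [C hC] := hg k; exists C => x.
  by rewrite /g' normcM [normc (0 +i* _)]/normc/= expr0n/= add0r sqrrN expr1n sqrtr1 mul1r.
have Im_fourier f eta : Cintegrable mu f ->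
    complex.Im (fourier f eta) = complex.Re (fourier (fun x => (0 +i* (-1)) * f x) eta).
  move=> fi; have -> : fourier (fun x => (0 +i* (-1)) * f x) eta = (0 +i* (-1)) * fourier f eta.
    rewrite !fourierE -CintZ; last exact: Cintegrable_fourier.
    by apply: eq_Cint => x; rewrite mulrA.
  by rewrite ReM /=; ring.
have gi := tame_integrable (rapid_tame rg).
have bgi := tame_integrable (rapid_tame (rapid_mulX j rg)).
have h2 : h^-1 *: (complex.Im (fourier g (h *: delta_mx ord0 j + xi)) -
     complex.Im (fourier g xi)) @[h --> 0^'] --> complex.Im (fourier (mulX j g) xi).
  have := @fourier_deriv_cvg g' j xi rg'.
  rewrite (Im_fourier _ xi bgi) (_ : mulX j g' = fun x => (0 +i* (-1)) * mulX j g x).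
    apply: cvg_trans; apply: near_eq_cvg; apply: nearW => h.
    by congr (_ *: (_ - _)); rewrite (Im_fourier _ _ gi).
  by apply/funext => x; rewrite /mulX /g' mulrCA.
split; first by split; [exact: (cvgP _ h1)|exact: (cvgP _ h2)].
by apply: complex_eqP; rewrite /pderiv /=; [exact: (cvg_lim _ h1)|exact: (cvg_lim _ h2)].
Qed.

Lemma rapid_foldr g l : rapid g -> rapid (foldr mulX g l).
Proof. by move=> rg; elim: l => [//|j l IH] /=; exact: rapid_mulX. Qed.

Lemma fourier_pderivs g l : rapid g ->
  pderivs l (fourier g) = fourier (foldr mulX g l).
Proof.
move=> rg; elim: l => [//|j l /= ->]; apply/funext => xi.
exact: (fourier_pderiv j xi (rapid_foldr l rg)).2.
Qed.

Lemma smooth_fourier g : rapid g -> smooth (fourier g).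
Proof.
move=> rg l; rewrite fourier_pderivs//; split.
  exact/ccontinuous_fourier/tame_integrable/rapid_tame/rapid_foldr.
by move=> i x; exact: (fourier_pderiv i x (rapid_foldr l rg)).1.
Qed.

Lemma pderivs_eq0 f (U : set 'rV[R]_n) l : open U -> (forall x, U x -> f x = 0) ->
  forall x, U x -> pderivs l f x = 0.
Proof.
move=> oU f0; elim: l => [//|j l IH] /= x Ux.
have N : \near x, pderivs l f x = 0.
  by apply: filterS IH _; exact: open_nbhs_nbhs.
rewrite /pderiv; apply: complex_eqP => /=.
- rewrite (near_eq_derive _ (g := fun=> 0)) ?derive_cst//.
  by apply: filterS N => y ->.
- rewrite (near_eq_derive _ (g := fun=> 0)) ?derive_cst//.
  by apply: filterS N => y ->.
Qed.

(** Vanishing outside a ball makes decay automatic: there the derivatives are 0, and inside they are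
    bounded by L^1 norms. The split by sup norm makes the outer region open, as [pderivs_eq0]
    requires. *)
Lemma schwartz_fourier g (rad : R) : rapid g ->
  (forall xi, rad <= enorm xi -> fourier g xi = 0) -> schwartz (fourier g).
Proof.
move=> rg g0; split; first exact: smooth_fourier.
move=> k l; have ri := tame_integrable (rapid_tame (rapid_foldr l rg)).
exists ((Num.sqrt n%:R * `|rad|) ^+ k * N1 (foldr mulX g l)) => xi.
have [h|h] := leP (`|xi|) `|rad|.
  apply: ler_pM; rewrite ?exprn_ge0 ?enorm_ge0 ?normc_ge0//.
    rewrite lerXn2r ?nnegrE ?enorm_ge0// ?mulr_ge0 ?sqrtr_ge0//.
    by rewrite (le_trans (enorm_le_norm xi))// ler_wpM2l// sqrtr_ge0.
  by rewrite fourier_pderivs//; exact: normc_fourier.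
rewrite (pderivs_eq0 (U := [set xi | `|rad| < `|xi|])) ?normc0 ?mulr0//.
- by rewrite mulr_ge0 ?N1_ge0// exprn_ge0// mulr_ge0// sqrtr_ge0.
- exact: (open_comp (fun x _ => @norm_continuous _ _ x) (@open_gt _ _)).
- move=> eta /= he; apply: g0.
  by rewrite (le_trans (ler_norm _))// (le_trans (ltW he))// norm_le_enorm.
Qed.

(** By inversion, a band-limited Schwartz function is, up to reflection, the transform of a
    compactly supported one; the support of a transformed distribution gives information on such
    functions only. *)
Lemma fourier_preimage g (rad : R) : schwartz g -> 0 <= rad ->
  (forall xi, rad <= enorm xi -> fourier g xi = 0) ->
  exists psi, [/\ schwartz psi, compact (supp psi),
    supp psi `<=` [set xi | `|xi| <= rad] &
    forall y, fourier psi y = g (- y)].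
Proof.
move=> gS rad0 g0; have rg := schwartz_rapid gS.
have FS := schwartz_fourier rg g0.
have Fi := tame_integrable (schwartz_tame FS).
have [_ c0] := @nfejer_int R n; set c := Cint mu nfejer in c0.
pose psi xi := c^-1 * fourier g xi.
have sp : supp psi `<=` [set xi | `|xi| <= rad].
  have cl : closed [set xi : 'rV[R]_n | `|xi| <= rad].
    exact: (closed_comp (fun x _ => @norm_continuous _ _ x) (@closed_le _ _)).
  rewrite /supp [X in _ `<=` X](closure_id _).1//; apply: closureS => xi /=.
  rewrite leNgt; apply: contra_neqN => h; rewrite /psi g0 ?mulr0//.
  by rewrite (le_trans (ltW h))// norm_le_enorm.
exists psi; split => //.
- have := schwartz_lin c^-1 FS (@schwartz0 R n).
  by under eq_fun do rewrite addr0.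
- apply: bounded_closed_compact; last exact: closed_closure.
  exists rad; split; first exact: num_real.
  by move=> M hM xi /sp /= h; rewrite (le_trans h)// ltW.
- move=> y; have := fourier_inversion (- y) (schwartz_tame gS) Fi.
  rewrite -/c => E; rewrite fourierE.
  have -> : (fun x => psi x * expi (- dotp x y)) =
      (fun xi => c^-1 * (fourier g xi * expi (dotp (- y) xi))).
    by apply/funext => xi; rewrite /psi dotpNl dotpC mulrA.
  have I : Cintegrable mu (fun xi => fourier g xi * expi (dotp (- y) xi)).
    apply: (CintegrableMr (M := 1)) => //.
      by under eq_fun do rewrite dotpC; exact: Cmeasurable_char.
    by move=> xi; rewrite normc_expi.
  by rewrite (CintZ c^-1 I) E mulrC mulfK.
Qed.

End rapid.

(** * From (a) to (b) *)

Section ae_continuous.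
Local Open Scope complex_scope.
Context {R : realType} {n : nat}.
Local Notation mu := (lebesgue_rV n).
Implicit Types (x : 'rV[R]_n) (f : 'rV[R]_n -> R[i]).

Lemma open_lebesgue_gt0 (U : set 'rV[R]_n) x : open U -> U x -> (0 < mu U)%E.
Proof.
move=> oU Ux; have [d/= d0 dU] : nbhs_ball x U.
  by apply/nbhs_ballP; exact: open_nbhs_nbhs.
pose a : 'rV[R]_n := \row_i (x ord0 i - d / 2).
pose b : 'rV[R]_n := \row_i (x ord0 i + d / 2).
have ab i : a ord0 i <= b ord0 i by rewrite !mxE; lra.
pose B : set 'rV[R]_n := [set y | forall i, y ord0 i \in `]a ord0 i, b ord0 i]].
have muB : mu B = (\prod_i (b ord0 i - a ord0 i))%:E := lebesgue_rV_box ab.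
have BU : B `<=` U.
  move=> y yB; apply: dU; rewrite -ball_normE /=; apply/mx_norm_ltP => // i.
  by have := yB i; rewrite in_itv/= !mxE ltr_norml => /andP[h1 h2]; lra.
have mB : measurable B.
  rewrite (_ : B = \bigcap_(i in [set: 'I_n])
      (fun y : 'rV[R]_n => y ord0 i) @^-1` `]a ord0 i, b ord0 i]%classic).
    apply: fin_bigcap_measurable => // i _.
    by rewrite -[X in measurable X]setTI; exact: measurable_coord.
  by apply/seteqP; split => y /= h i; [move=> _|]; exact: h.
apply: (@lt_le_trans _ _ (mu B)); last first.
  by apply: le_measure => //; rewrite inE//; exact: open_rV_measurable.
rewrite [X in (_ < X)%E]muB lte_fin; apply: prodr_gt0 => i _.
by rewrite !mxE; lra.
Qed.

(** The set where the bound fails is open, and a nonempty open set has positive measure. *)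
Lemma ae_le_continuous f M : ccontinuous f ->
  (\forall x \ae mu, normc (f x) <= M) -> forall x, normc (f x) <= M.
Proof.
move=> cf [A [mA A0 fA]] x; rewrite leNgt; apply/negP => Mx.
have cn : continuous (fun x => normc (f x)).
  apply: continuous_seq => p u up.
  have := ccontinuous_cvg cf up => h.
  apply/cvgrPdist_le => e e0; move/cvgrPdist_le: h => /(_ _ e0).
  apply: filterS => k; rewrite sub0r normrN ger0_norm ?normc_ge0// => h.
  apply: le_trans h.
  have t1 : normc (f p) <= normc (f (u k) - f p) + normc (f (u k)).
    rewrite -[X in X + _]normcN opprB.
    by rewrite -[X in normc X <= _](subrK (f (u k))) ler_normcD.
  have t2 : normc (f (u k)) <= normc (f (u k) - f p) + normc (f p).
    by rewrite -[X in normc X <= _](subrK (f p)) ler_normcD.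
  by rewrite ler_norml; apply/andP; split; lra.
have oV : open [set x | M < normc (f x)].
  exact: (open_comp (fun x _ => cn x) (@open_gt _ M)).
have := open_lebesgue_gt0 oV Mx; rewrite ltNge => /negP; apply.
rewrite -A0; apply: le_measure; rewrite ?inE//.
  exact: open_rV_measurable.
by move=> y /= My; apply: fA => /=; apply/negP; rewrite -ltNge.
Qed.

Lemma cLnorm_ooP f (M : R) : (cLnorm +oo f <= M%:E)%E ->
  \forall x \ae mu, normc (f x) <= M.
Proof.
(* The norm at exponent [+oo] is an essential supremum only if the whole space has positive measure,
   and 0 by convention otherwise. *)
rewrite /cLnorm unlock ifT; last exact: open_lebesgue_gt0 openT (I : setT (0 : 'rV[R]_n)).
move=> /ess_supP; apply: filterS => x /=.
by rewrite lee_fin ger0_norm ?normc_ge0.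
Qed.

End ae_continuous.

Section sufficiency.
Local Open Scope complex_scope.
Context {R : realType} {n : nat}.
Local Notation mu := (lebesgue_rV n).
Implicit Types (x y xi : 'rV[R]_n) (t u : R).
Variables (s : R) (zeta phi rho : 'rV[R]_n -> R[i]).
Hypotheses (s0 : 0 < s) (zetaS : schwartz zeta).
Hypothesis hat_zeta0 : forall xi, 2 <= enorm xi -> fourier zeta xi = 0.
Hypothesis hat_zeta1 : forall xi, enorm xi <= 1 -> fourier zeta xi = 1.
Hypothesis phiE : forall x, phi x = dilate 2^-1 zeta x - zeta x.
Hypothesis zetaE : forall x, zeta (- x) = zeta x.
Hypothesis rhoi : Cintegrable mu rho.
Variables (T : functional R n) (f : 'rV[R]_n -> R[i]).
Hypothesis fX : in_X s zeta phi T f.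
Local Notation r := (2 `^ s).

Let zt t : 0 < t -> tame (dilate t zeta).
Proof. by move=> t0; apply: tame_dilate => //; exact: schwartz_tame. Qed.

Let ztE t x : dilate t zeta (- x) = dilate t zeta x.
Proof. by rewrite /dilate scalerN zetaE. Qed.

Let cf : ccontinuous f. Proof. by case: fX => _ _ _ []. Qed.

Let mf : Cmeasurable f. Proof. exact: ccontinuous_Cmeasurable. Qed.

Let shiftS t x : 0 < t -> schwartz (fun y => dilate t zeta (x - y)).
Proof.
move=> t0; have := schwartz_dilate (- x) t0 zetaS.
rewrite (_ : (fun y => _) = fun y => dilate t zeta (x - y))//.
by apply/funext => y; rewrite -ztE opprD opprK addrC.
Qed.

Let fzi t x : 0 < t -> Cintegrable mu (fun y => f (x - y) * dilate t zeta y).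
Proof.
move=> t0; have [_ _ _ [_ hf] _] := fX; have [fi _] := hf _ (shiftS x t0).
have := Cintegrable_sub x fi.
by under [X in Cintegrable _ X -> _]eq_fun do rewrite subKr.
Qed.

Let conv_fz t x : 0 < t ->
  convolution f (dilate t zeta) x = T (fun y => dilate t zeta (x - y)).
Proof.
move=> t0; have [_ _ _ [_ hf] _] := fX; have [fi ->] := hf _ (shiftS x t0).
rewrite convolutionE -[RHS](Cint_sub x fi).
by apply: eq_Cint => y; rewrite subKr.
Qed.

(** The convolution at [x] is [T] applied to a translate of [dilate t zeta], which has frequencies
    at most [2 / t] and so is the transform of a function supported near 0, outside the support of
    the transform of [T]. *)
Lemma low_frequency_vanish : exists d : R, 0 < d /\
  forall t x, 0 < t -> 2 / t < d -> convolution f (dilate t zeta) x = 0.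
Proof.
have [_ _ h0 _ _] := fX.
have [U [oU U0 vU]] := contrapT h0.
have [d/= d0 dU] : nbhs_ball (0 : 'rV[R]_n) U.
  by apply/nbhs_ballP; exact: open_nbhs_nbhs.
exists d; split => // t x t0 td; rewrite conv_fz//.
have gS := schwartz_dilate x t0 zetaS.
have g0 xi : 2 / t <= enorm xi -> fourier (fun y => dilate t zeta (y + x)) xi = 0.
  move=> h.
  have -> : (fun y => dilate t zeta (y + x)) = fun y => dilate t zeta (- x - y).
    by apply/funext => y; rewrite -ztE opprD addrC.
  rewrite fourier_sub; last exact/tame_integrable/zt.
  rewrite fourier_dilate//; last exact/tame_integrable/schwartz_tame.
  rewrite hat_zeta0 ?mulr0// enormZ gtr0_norm// -scaleN1r enormZ normrN normr1 mul1r.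
  by rewrite mulrC -ler_pdivrMr.
have t20 : 0 <= 2 / t by rewrite divr_ge0// ltW.
have [psi [psiS cpsi spsi Fpsi]] := fourier_preimage gS t20 g0.
have -> : (fun y => dilate t zeta (x - y)) = fourier psi.
  by apply/funext => y; rewrite Fpsi addrC.
apply: vU => //; apply: subset_trans dU => xi /spsi /= h.
by rewrite -ball_normE/= sub0r normrN (le_lt_trans h).
Qed.

Let X := fine (X_norm s zeta phi f).

Let X_fin : X_norm s zeta phi f = X%:E.
Proof.
have [_ _ _ _ Xoo] := fX; rewrite fineK// ge0_fin_numE//.
exact: X_norm_ge0.
Qed.

Let X0 : 0 <= X.
Proof. by rewrite -lee_fin -X_fin; exact: X_norm_ge0. Qed.

Definition block k : 'rV[R]_n -> R[i] := sharp zeta phi f (- k%:Z).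

Lemma block0 x : block 0 x = f x - convolution f zeta x.
Proof. by []. Qed.

Lemma blockS k x : block k.+1 x = convolution f (dilate (2 ^+ k.+1) phi) x.
Proof. by []. Qed.

Lemma block_ae k : \forall x \ae mu, normc (block k x) <= r ^+ k * X.
Proof.
have rk0 : 0 < r ^+ k by rewrite exprn_gt0// powR_gt0.
apply: cLnorm_ooP.
have : ((2 `^ (s * (- k%:Z)%:~R))%:E * cLnorm +oo (block k) <= X%:E)%E.
  by rewrite -X_fin; apply: ereal_sup_ubound; exists (- k%:Z) => //=; rewrite oppr_le0.
rewrite mulrNz mulrN powRN powRrM powR_mulrn ?powR_ge0// => h.
rewrite EFinM -lee_pdivrMl//.
Qed.

Lemma block_telescope J x :
  f x = \sum_(k < J.+1) block k x + convolution f (dilate (2 ^+ J) zeta) x.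
Proof.
elim: J => [|J IH].
  by rewrite big_ord_recl big_ord0 addr0 block0 expr0 dilate1 subrK.
rewrite big_ord_recr/= {1}IH -addrA; congr (_ + _).
have p k : 0 < 2 ^+ k :> R by exact: exprn_gt0.
rewrite blockS (dilate_phi phiE) !convolutionE.
under [X in _ = X + _]eq_Cint do rewrite mulrBr.
have e : 2 ^+ J.+1 / 2 = 2 ^+ J :> R by rewrite exprS mulrAC mulfV ?mul1r.
by rewrite e CintB ?subrK//; exact: fzi.
Qed.

Lemma block_finite : exists J, forall x, f x = \sum_(k < J.+1) block k x.
Proof.
have [d [d0 hd]] := low_frequency_vanish.
(* [2 / d] is below [J.+1], which is at most [2 ^+ J]; hence [2 / 2 ^+ J < d] and the remainder
   vanishes. *)
pose J := Num.truncn (2 / d); exists J => x.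
rewrite (block_telescope J) hd ?addr0 ?exprn_gt0//.
rewrite ltr_pdivrMr ?exprn_gt0// -ltr_pdivrMl// mulrC.
rewrite (lt_le_trans (truncnS_gt _))// -natrX ler_nat.
by rewrite ltn_expl.
Qed.

(** Finiteness of the sum turns the block bounds into a bound on [f], almost everywhere and then
    everywhere because [f] itself is continuous. [ccontinuous_block] rests on it. *)
Lemma X_bounded : exists M, forall x, normc (f x) <= M.
Proof.
have [J hJ] := block_finite.
exists (\sum_(k < J.+1) r ^+ k * X); apply: ae_le_continuous => //.
have : \forall x \ae mu, forall k : nat, normc (block k x) <= r ^+ k * X.
  apply/ae_foralln => k; exact: block_ae.
apply: filterS => x h; rewrite hJ.
by apply: le_trans (ler_normc_sum _ _ _) _; apply: ler_sum => k _; exact: h.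
Qed.

Let phiS : schwartz phi.
Proof.
have h0 : 0 < 2^-1 :> R by rewrite invr_gt0.
have := schwartz_lin (-1) zetaS (schwartz_dilate 0 h0 zetaS).
rewrite (_ : (fun x => _) = phi)//; apply/funext => x.
by rewrite addr0 mulN1r addrC phiE.
Qed.

Let p0 k : 0 < 2 ^+ k :> R. Proof. exact: exprn_gt0. Qed.

Lemma ccontinuous_block k : ccontinuous (block k).
Proof.
have [M fM] := X_bounded.
have C g t : schwartz g -> 0 < t -> ccontinuous (convolution f (dilate t g)).
  move=> gS t0; have := schwartz_decays (schwartz_dilate 0 t0 gS).
  under eq_fun do rewrite addr0.
  by move=> dg; have [+ <- _] := decays_conv_bounded dg mf fM.
case: k => [|k]; last exact: C.
by apply: ccontinuousB => //; rewrite -(dilate1 zeta); exact: C.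
Qed.

Lemma block_bound k x : normc (block k x) <= r ^+ k * X.
Proof. exact: (ae_le_continuous (ccontinuous_block k) (block_ae k)). Qed.

Lemma block_conv_zeta k : block k.+1 =
  convolution (dilate (2 ^+ k.+1 / 4) zeta) (block k.+1).
Proof.
have [M fM] := X_bounded.
have u0 : 0 < 2 ^+ k.+1 / 4 :> R by rewrite divr_gt0.
have zi := tame_integrable (zt u0).
have tp : tame (dilate (2 ^+ k.+1) phi).
  by apply: tame_dilate => //; exact: schwartz_tame.
have mB : Cmeasurable (block k.+1) by exact/ccontinuous_Cmeasurable/ccontinuous_block.
rewrite -(convolutionC mB (block_bound k.+1) zi).
have -> : block k.+1 = convolution f (dilate (2 ^+ k.+1) phi) by [].
rewrite (convolutionA mf fM (tame_integrable tp) zi); last first.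
  by move=> x; exact: tame_conv_integrable.
congr convolution; apply/esym.
apply: (conv_phi_zeta zetaS hat_zeta0 hat_zeta1 phiE) => //.
by rewrite mulrC divfK.
Qed.

Lemma delta_minus_block k : normc (delta_minus rho (block k.+1)) <=
  X * (r ^+ k.+1 * defect rho (dilate (2 ^+ k.+1 / 4) zeta)).
Proof.
have u0 : 0 < 2 ^+ k.+1 / 4 :> R by rewrite divr_gt0.
have mB : Cmeasurable (block k.+1) by exact/ccontinuous_Cmeasurable/ccontinuous_block.
have td := tame_defect rhoi (zt u0).
rewrite block_conv_zeta (delta_minus_conv rhoi (zt u0) (ztE _) mB (block_bound k.+1)).
rewrite mulrA (mulrC X) /defect -RintegralZl//; last exact/integrable_normc/tame_integrable.
apply: le_normc_Cint.
- by apply: CmeasurableM => //; exact: tame_meas.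
- exact/integrableZR/integrable_normc/tame_integrable.
- move=> x; rewrite normcM [leLHS]mulrC.
  by apply: ler_wpM2r; [exact: normc_ge0|exact: block_bound].
Qed.

Let bint k : Cintegrable mu (fun x => rho x * block k x).
Proof.
apply: (CintegrableMr rhoi _ (block_bound k)).
exact/ccontinuous_Cmeasurable/ccontinuous_block.
Qed.

(** The frequencies of the top block have no bound uniform over X, so no fixed dilate of [zeta]
    reproduces it. The trivial estimate is used instead and accounts for [1 + N1 rho] in the final
    constant. *)
Lemma delta_minus_block0 : normc (delta_minus rho (block 0)) <= (1 + N1 rho) * X.
Proof.
have b x : normc (block 0 x) <= X by have := block_bound 0 x; rewrite expr0 mul1r.
apply: le_trans (ler_normcB _ _) _; rewrite mulrDl mul1r lerD//.
rewrite mulrC -RintegralZl//; last exact: integrable_normc.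
apply: le_normc_Cint; first exact: Cintegrable_meas (bint 0).
  exact/integrableZR/integrable_normc.
by move=> x; rewrite normcM mulrC ler_wpM2r ?normc_ge0.
Qed.

Lemma delta_minus_bound (S : R) :
  (forall N, \sum_(k < N) r ^+ k * defect rho (dilate (2 ^+ k / 4) zeta) <= S) ->
  ((normc (delta_minus rho f))%:E <= (1 + N1 rho + S)%:E * X_norm s zeta phi f)%E.
Proof.
move=> hS; rewrite X_fin -EFinM lee_fin.
have [J hJ] := block_finite.
have -> : delta_minus rho f = \sum_(k < J.+1) delta_minus rho (block k).
  change (f 0 - Cint mu (fun x => rho x * f x) =
    \sum_(k < J.+1) (block k 0 - Cint mu (fun x => rho x * block k x))).
  rewrite hJ sumrB; congr (_ - _).
  rewrite -(Cint_sum _ (fun k : 'I_J.+1 => bint k)).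
  by apply: eq_Cint => x; rewrite hJ mulr_sumr.
apply: le_trans (ler_normc_sum _ _ _) _.
rewrite big_ord_recl/= mulrDl; apply: lerD; first exact: delta_minus_block0.
apply: le_trans (ler_sum _ (fun k _ => delta_minus_block _)) _.
rewrite -mulr_sumr mulrC ler_wpM2r//; apply: le_trans (hS J.+1).
rewrite big_ord_recl/= lerDr mulr_ge0 ?defect_ge0//.
Qed.

End sufficiency.

Theorem theorem4p1 (R : realType) (n : nat) (n_gt0 : (0 < n)%N)
    (zeta phi : 'rV[R]_n -> R[i])
    (zetaS : schwartz zeta) (phiS : schwartz phi)
    (zeta_supp : supp (fourier zeta) `<=` [set xi | enorm xi < 2])
    (zeta_one : exists U : set 'rV[R]_n,
       [/\ open U, [set xi | enorm xi <= 1] `<=` U &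
           forall xi, U xi -> fourier zeta xi = 1])
    (phiE : forall x : 'rV[R]_n, phi x = dilate 2^-1 zeta x - zeta x)
    (phi_even : forall x : 'rV[R]_n, phi (- x) = phi x)
    (rho : 'rV[R]_n -> R[i]) (rhoL1 : cintegrable rho) (rho1 : cint rho = 1)
    (s : R) (s_gt0 : 0 < s) :
  (exists eta : 'rV[R]_n -> R[i],
     [/\ schwartz eta, cint eta != 0 &
         (\int[lebesgue_measure]_(e in `]0%R, 1%R[)
            ((e `^ (s + 1))^-1%:E *
             cLnorm 1 (fun x => eta x - convolution eta (dilate e rho) x)%R)
          < +oo)%E])
  <->
  (exists C : R, forall (T : functional R n) (f : 'rV[R]_n -> R[i]),
     in_X s zeta phi T f ->
     ((normc (delta_minus rho f))%:E <= C%:E * X_norm s zeta phi f)%E).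
Proof.
have hat0 xi : 2 <= enorm xi -> fourier zeta xi = 0.
  move=> h; apply/eqP/negP => /negP z0.
  have /zeta_supp /= : supp (fourier zeta) xi by exact: subset_closure.
  by rewrite ltNge h.
have hat1 xi : enorm xi <= 1 -> fourier zeta xi = 1.
  by have [U [_ U1 hU]] := zeta_one => h; exact/hU/U1.
have zeta1 : cint zeta = 1.
  transitivity (fourier zeta 0); first by rewrite fourier0.
  by rewrite hat1// /enorm dotp0l sqrtr0.
have zE := zeta_even zetaS phiE n_gt0 phi_even.
split=> [[eta [etaS eta0 hint]]|[C hC]].
  have [S hS] := sum_defect_zeta rhoL1 s_gt0 zetaS hat0 hat1 (schwartz_tame etaS) eta0 hint.
  exists (1 + N1 rho + S) => T f fX.
  by have := delta_minus_bound zetaS hat0 hat1 phiE zE rhoL1 fX hS.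
exists zeta; split => //; first by rewrite zeta1 oner_neq0.
apply: (integral_defect_zeta rhoL1 s_gt0 zetaS hat0 hat1 phiE rho1).
exact: sum_defect_phi hC.
Qed.
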